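(* Let $f(z)=\sum_{n=1}^\infty a_n e(nz)$ be a nonzero cusp form of weight $r>0$ with respect to a congruence group $\Gamma$ for which the cusp at $i\infty$ has width $1$, and let $\alpha>r/2$. Then the function $f_\alpha(x)=\sum_{n=1}^\infty \frac{a_n}{n^\alpha}e(nx)$ satisfies $\beta^{**}(x_0)=\alpha-r/2$ for every $x_0\in\mathbb{Q}$. If, in addition, $\alpha\ge 1+\lfloor 2\alpha-r\rfloor$, then $f_\alpha$ satisfies $\beta(x_0)=2\alpha-r$ for every $x_0\in\mathbb{Q}$. Moreover, if the coefficients $a_n$ are real, then the same holds for $f_\alpha^c(x)=\sum_{n=1}^\infty \frac{a_n}{n^\alpha}\cos(2\pi nx)$ and $f_\alpha^s(x)=\sum_{n=1}^\infty \frac{a_n}{n^\alpha}\sin(2\pi nx)$.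
   Context: Notation: $e(x)=e^{2\pi i x}$. For $\alpha>r/2$ the series are understood as the limits of their partial sums, which converge uniformly on $\mathbb{R}$, so the functions are continuous. Modular forms: $\Gamma$ is a congruence group, i.e. $\Gamma(N)<\Gamma<\mathrm{SL}_2(\mathbb{Z})$ for some principal congruence subgroup $\Gamma(N)$. A modular form of weight $r>0$ (real) with respect to $\Gamma$ is a function $f$, holomorphic on the upper half plane and at the cusps of $\Gamma$, with $f(\gamma z)=m_\gamma\,(j_\gamma(z))^r f(z)$ for all $\gamma\in\Gamma$, where $m_\gamma$ is a multiplier system with $|m_\gamma|=1$ and $j_\gamma(z)$ is the denominator of the linear fractional transformation $\gamma$ (i.e. $j_\gamma(z)=cz+d$ if $(c,d)$ is the bottom row of $\gamma$). It is assumed that the width of the cusp at $i\infty$ is $1$, so that the integral translations belong to $\Gamma$ and $f(z)=\sum_{n\ge0}a_n e(nz)$. A cusp form is a modular form vanishing at all cusps. Hölder exponents of a continuous function $g:\mathbb{R}\to\mathbb{C}$ at $x_0\in\mathbb{R}$: (1) For $s\ge 0$, $C^s(x_0)$ is the set of continuous functions $g:\mathbb{R}\to\mathbb{C}$ for which there is a polynomial $P$ of degree at most $s$ with $|g(x)-P(x-x_0)|=O(|x-x_0|^s)$ as $x\to x_0$. The pointwise Hölder exponent is $\beta(x_0)=\sup\{s\ge0: g\in C^s(x_0)\}$. (2) For an open set $\mathcal{U}\subset\mathbb{R}$, an integer $k\ge0$ and $0<s\le 1$, $C^{k,s}(\mathcal{U})$ is the set of $k$-times differentiable functions with $|g^{(k)}(x)-g^{(k)}(y)|=O(|x-y|^s)$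 for all $x,y\in\mathcal{U}$; $C^{k,0}(\mathcal{U})$ is the set of functions with $k$ continuous derivatives on $\mathcal{U}$. The local Hölder exponent is $\beta^{**}(x_0)=\lim_{n\to\infty}\sup\{k+s: g\in C^{k,s}(I_n),\ k\ge0,\ 0\le s\le1\}$, where $I_1\supset I_2\supset\cdots$ are nested open intervals with $\bigcap I_n=\{x_0\}$ (the value does not depend on the choice of the intervals). *)

(* Defs.v *)
From Stdlib Require Import Reals ZArith Lia.
From Coquelicot Require Import Coquelicot.
Open Scope R_scope.

(** * Complex exponential, real powers, complex series *)

Definition Cexp (z : C) : C :=
  (exp (Re z) * cos (Im z), exp (Re z) * sin (Im z)).

(** [ee z] is e(z) = exp (2 pi i z). *)
Definition ee (z : C) : C := Cexp (RtoC (2 * PI) * Ci * z)%C.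

(** Principal argument, in (-pi, pi] (and a junk value at 0). *)
Definition Carg (z : C) : R :=
  if Rle_dec 0 (Im z) then acos (Re z / Cmod z) else - acos (Re z / Cmod z).

(** [Crpow z s] is z^s for real s and z <> 0, with the principal branch. *)
Definition Crpow (z : C) (s : R) : C :=
  Cexp (RtoC s * (ln (Cmod z), Carg z))%C.

Definition is_Cseries (u : nat -> C) (l : C) : Prop :=
  is_series (K := C_AbsRing) (V := C_NormedModule) u l.

(** The limit of the partial sums, taken on real and imaginary parts with
    Coquelicot's total operator; it is the sum whenever the series converges. *)
Definition CSeries (u : nat -> C) : C :=
  (Series (fun n => Re (u n)), Series (fun n => Im (u n))).

(** * SL_2(Z) and congruence groups *)

Record SL2Z : Type := MkSL2Z
  { ma : Z; mb : Z; mc : Z; md : Z;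
    mdet : (ma * md - mb * mc = 1)%Z }.

Lemma SL2Z_mul_det (g h : SL2Z) :
  ((ma g * ma h + mb g * mc h) * (mc g * mb h + md g * md h)
   - (ma g * mb h + mb g * md h) * (mc g * ma h + md g * mc h) = 1)%Z.
Proof.
  transitivity ((ma g * md g - mb g * mc g) * (ma h * md h - mb h * mc h))%Z.
  - ring.
  - rewrite !mdet; reflexivity.
Qed.

Lemma SL2Z_inv_det (g : SL2Z) :
  (md g * ma g - (- mb g) * (- mc g) = 1)%Z.
Proof. rewrite <- (mdet g); ring. Qed.

Lemma SL2Z_trans_det (h : Z) : (1 * 1 - h * 0 = 1)%Z.
Proof. lia. Qed.

Definition SL2Z_mul (g h : SL2Z) : SL2Z := MkSL2Z _ _ _ _ (SL2Z_mul_det g h).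
Definition SL2Z_inv (g : SL2Z) : SL2Z := MkSL2Z _ _ _ _ (SL2Z_inv_det g).
Definition SL2Z_one : SL2Z := MkSL2Z 1 0 0 1 eq_refl.
Definition SL2Z_mone : SL2Z := MkSL2Z (-1) 0 0 (-1) eq_refl.
(** The translation z |-> z + h. *)
Definition SL2Z_trans (h : Z) : SL2Z := MkSL2Z 1 h 0 1 (SL2Z_trans_det h).

Definition is_subgroup (G : SL2Z -> Prop) : Prop :=
  G SL2Z_one /\
  (forall g h, G g -> G h -> G (SL2Z_mul g h)) /\
  (forall g, G g -> G (SL2Z_inv g)).

(** Gamma(N). *)
Definition principal_congruence (N : Z) (g : SL2Z) : Prop :=
  (N | ma g - 1)%Z /\ (N | mb g)%Z /\ (N | mc g)%Z /\ (N | md g - 1)%Z.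

Definition congruence_group (G : SL2Z -> Prop) : Prop :=
  is_subgroup G /\
  exists N : Z, (0 < N)%Z /\ forall g, principal_congruence N g -> G g.

(** [cusp_width G sigma h]: h is the width of the cusp sigma(oo) of G, that is
    the least h > 0 with sigma T^h sigma^{-1} in G, where T z = z + 1. *)
Definition cusp_stab (G : SL2Z -> Prop) (sigma : SL2Z) (h : Z) : Prop :=
  G (SL2Z_mul (SL2Z_mul sigma (SL2Z_trans h)) (SL2Z_inv sigma)).

Definition cusp_width (G : SL2Z -> Prop) (sigma : SL2Z) (h : Z) : Prop :=
  (0 < h)%Z /\ cusp_stab G sigma h /\
  forall k : Z, (0 < k < h)%Z -> ~ cusp_stab G sigma k.

(** * Modular forms of real weight *)

Definition upper (z : C) : Prop := 0 < Im z.

Definition jfac (g : SL2Z) (z : C) : C :=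
  (RtoC (IZR (mc g)) * z + RtoC (IZR (md g)))%C.

Definition mobius (g : SL2Z) (z : C) : C :=
  ((RtoC (IZR (ma g)) * z + RtoC (IZR (mb g))) / jfac g z)%C.

Definition multiplier_system (G : SL2Z -> Prop) (r : R) (m : SL2Z -> C) : Prop :=
  (forall g, G g -> Cmod (m g) = 1) /\
  (forall g h, G g -> G h -> forall z, upper z ->
     (m (SL2Z_mul g h) * Crpow (jfac (SL2Z_mul g h) z) r =
      m g * m h * Crpow (jfac g (mobius h z)) r * Crpow (jfac h z) r)%C) /\
  (G SL2Z_mone -> (m SL2Z_mone * Crpow (RtoC (-1)) r = RtoC 1)%C).

Definition holomorphic_upper (f : C -> C) : Prop :=
  forall z, upper z -> ex_derive (K := C_AbsRing) (V := C_NormedModule) f z.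

(** (f | sigma)(z) = j_sigma(z)^{-r} f(sigma z). *)
Definition slash (r : R) (f : C -> C) (sigma : SL2Z) (z : C) : C :=
  (f (mobius sigma z) / Crpow (jfac sigma z) r)%C.

(** Fourier expansion of f at the cusp sigma(oo), of width h.  The multiplier
    system makes f | sigma h-periodic only up to a factor e(kappa), so that the
    exponents are the n + kappa with 0 <= kappa < 1.  That n ranges over the
    natural numbers expresses holomorphy at the cusp. *)
Definition cusp_expansion (G : SL2Z -> Prop) (r : R) (f : C -> C) (sigma : SL2Z)
    (h : Z) (kappa : R) (c : nat -> C) : Prop :=
  cusp_width G sigma h /\ 0 <= kappa < 1 /\
  forall z, upper z ->
    is_Cseries (fun n => c n * ee (RtoC ((INR n + kappa) / IZR h) * z))%C
               (slash r f sigma z).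

Definition holomorphic_at_cusps (G : SL2Z -> Prop) (r : R) (f : C -> C) : Prop :=
  forall sigma, exists h kappa c, cusp_expansion G r f sigma h kappa c.

(** The term of exponent 0, which occurs only if kappa = 0, is zero. *)
Definition vanishes_at_cusps (G : SL2Z -> Prop) (r : R) (f : C -> C) : Prop :=
  forall sigma h kappa c, cusp_expansion G r f sigma h kappa c ->
    kappa = 0 -> c 0%nat = RtoC 0.

Definition modular_form (G : SL2Z -> Prop) (r : R) (f : C -> C) : Prop :=
  holomorphic_upper f /\
  (exists m, multiplier_system G r m /\
     forall g, G g -> forall z, upper z ->
       f (mobius g z) = (m g * Crpow (jfac g z) r * f z)%C) /\
  holomorphic_at_cusps G r f.

Definition cusp_form (G : SL2Z -> Prop) (r : R) (f : C -> C) : Prop :=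
  modular_form G r f /\ vanishes_at_cusps G r f.

(** * The Fourier series.  The sums start at n = 1, hence the shifted index. *)

Definition f_alpha (a : nat -> C) (alpha : R) (x : R) : C :=
  CSeries (fun n => a (S n) / RtoC (Rpower (INR (S n)) alpha)
                    * ee (RtoC (INR (S n) * x)))%C.

Definition f_alpha_c (a : nat -> C) (alpha : R) (x : R) : C :=
  CSeries (fun n => a (S n) / RtoC (Rpower (INR (S n)) alpha)
                    * RtoC (cos (2 * PI * INR (S n) * x)))%C.

Definition f_alpha_s (a : nat -> C) (alpha : R) (x : R) : C :=
  CSeries (fun n => a (S n) / RtoC (Rpower (INR (S n)) alpha)
                    * RtoC (sin (2 * PI * INR (S n) * x)))%C.

(** * Hölder exponents *)

Definition Ccontinuous_at (g : R -> C) (x : R) : Prop :=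
  continuous (T := R_UniformSpace) (U := C_UniformSpace) g x.

(** Derivative of a complex-valued function of a real variable. *)
Definition is_derive_RC (g : R -> C) (x : R) (l : C) : Prop :=
  is_derive (K := R_AbsRing)
    (V := prod_NormedModule R_AbsRing R_NormedModule R_NormedModule) g x l.

(** t |-> sum_(j <= d) p_j t^j. *)
Definition Cpoly (d : nat) (p : nat -> C) (t : R) : C :=
  sum_n (G := C_AbelianMonoid) (fun j => p j * RtoC (t ^ j))%C d.

(** The class C^s(x0).  The bound is asked for x <> x0 only, because
    [Rpower 0 s] is 1; at x0 it follows by continuity. *)
Definition holder_at (g : R -> C) (x0 s : R) : Prop :=
  (forall x, Ccontinuous_at g x) /\
  exists (d : nat) (p : nat -> C), INR d <= s /\
  exists M : R, locally' x0 (fun x =>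
    Cmod (g x - Cpoly d p (x - x0))%C <= M * Rpower (Rabs (x - x0)) s).

(** beta(x0). *)
Definition pointwise_holder_exponent (g : R -> C) (x0 : R) : Rbar :=
  Lub_Rbar (fun s => 0 <= s /\ holder_at g x0 s).

(** The class C^{k,s}(U), for U open; D j is the j-th derivative of g on U. *)
Definition holder_on (g : R -> C) (U : R -> Prop) (k : nat) (s : R) : Prop :=
  exists D : nat -> R -> C,
    (forall x, U x -> D 0%nat x = g x) /\
    (forall j x, (j < k)%nat -> U x -> is_derive_RC (D j) x (D (S j) x)) /\
    ((s = 0 /\ forall x, U x -> Ccontinuous_at (D k) x) \/
     (0 < s <= 1 /\
      exists M : R, forall x y, U x -> U y -> x <> y ->
        Cmod (D k x - D k y)%C <= M * Rpower (Rabs (x - y)) s)).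

Definition open_interval (u v : Rbar) (x : R) : Prop :=
  Rbar_lt u x /\ Rbar_lt x v.

Definition shrinking_intervals (u v : nat -> Rbar) (x0 : R) : Prop :=
  (forall n x, open_interval (u (S n)) (v (S n)) x -> open_interval (u n) (v n) x) /\
  (forall x, (forall n, open_interval (u n) (v n) x) <-> x = x0).

Definition holder_sup_on (g : R -> C) (U : R -> Prop) : Rbar :=
  Lub_Rbar (fun t => exists (k : nat) (s : R),
    0 <= s <= 1 /\ t = INR k + s /\ holder_on g U k s).

(** beta^{**}(x0) = l, for a finite l and whatever the choice of intervals.
    The suprema may be infinite, hence the clause on finiteness. *)
Definition is_local_holder_exponent (g : R -> C) (x0 l : R) : Prop :=
  forall u v : nat -> Rbar, shrinking_intervals u v x0 ->
    eventually (fun n => is_finite (holder_sup_on g (open_interval (u n) (v n)))) /\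
    is_lim_seq (fun n => real (holder_sup_on g (open_interval (u n) (v n)))) l.

(* Main.v *)
Require Import Defs.
From Stdlib Require Import Reals ZArith Lra Lia Psatz Classical FunctionalExtensionality.
From Coquelicot Require Import Coquelicot.
Open Scope R_scope.

(** Write [c n = a (n + 1)] and [F(x, y) = f(x + i y)].  Three properties of the form
    carry the proof.  The function [y^(r/2) |f|] is invariant under the group and bounded
    ([Phi_bounded]).  At a rational point [x0] the form vanishes at the cusp, so that
    [|f(x0 + w)| <= K y^(-A) |w|^(2A - r)] for every [A >= r/2] ([form_bound_rational]).
    And [y^(r/2) |f|] is a positive constant along a sequence tending tangentially to
    [x0], made of the images of one point under the parabolic elements fixing [x0]
    ([form_large], [form_growth]).

    Regularity.  Boundedness of [y^(r/2) |f|] makes the partial sums of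
    [sum c_n e((n + 1) x)] of size [O(n^rho)] for every [rho > r/2]
    ([partial_sum_bound]).  Summation by parts then yields the convergence of [f_alpha], its
    Hölder continuity of every order below [alpha - r/2], and the rule that
    differentiation lowers [alpha] by one; hence the lower bound for the local exponent.  For
    the pointwise exponent at [x0], [f_alpha(x0 + u)] is a multiple of the integral of
    [f(x0 + u + i y) y^(alpha - 1)] over [y > 0] ([fal_mellin]).  For [y < |u|] the integrand is
    small because the form vanishes at the cusp; for [y > |u|] it is replaced by its Taylor
    polynomial in [u], whose coefficients are integrable up to [y = 0].  The error is
    [O(|u|^s)] for every [s < 2 alpha - r] ([pointwise_expansion]).

    Irregularity.  Let [g] be [f_alpha] or its real or imaginary part; a conjugate has
    only negative frequencies, so up to a nonzero factor all three have the same positive ones.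
    The [m]-th derivative of the harmonic extension of [g] is the convolution of [g] with
    [sum n^m e(n z) = O(|z|^(-m-1))], and a fractional integration of order [m - alpha] in
    the imaginary direction turns it into [f].  The kernel kills nonpositive frequencies, so a
    Taylor polynomial of [g] may be traded for a trigonometric polynomial with nonpositive
    frequencies and subtracted.  Consequently an expansion of [g] at [x] of order
    [s < alpha] forces [f(x + u + i y) = O(((y + |u|) / y)^s y^(s - alpha))]
    ([boundary_regularity_bound]).  Along the tangential sequence this is impossible for
    [x = x0] once [s > 2 alpha - r], and for [x] moving with the sequence once
    [s > alpha - r/2].  The hypothesis on the integer part enters as [2 alpha - r < alpha],
    which leaves room for an [s] between the two. *)

(** * Finite sums and convergence of complex sequences *)

Fixpoint Csum (u : nat -> C) (n : nat) : C :=
  match n with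
  | O => RtoC 0
  | S n => (Csum u n + u n)%C
  end.

Lemma Csum_ext (u v : nat -> C) n :
  (forall k, (k < n)%nat -> u k = v k) -> Csum u n = Csum v n.
Proof.
  induction n as [|n IH]; intros H; simpl; [reflexivity|].
  rewrite IH by (intros; apply H; lia). now rewrite H by lia.
Qed.

Lemma Csum_minus (u v : nat -> C) n :
  Csum (fun k => u k - v k)%C n = (Csum u n - Csum v n)%C.
Proof. induction n as [|n IH]; simpl; [ring|rewrite IH; ring]. Qed.

Lemma Csum_scal (c : C) (u : nat -> C) n :
  Csum (fun k => c * u k)%C n = (c * Csum u n)%C.
Proof. induction n as [|n IH]; simpl; [ring|rewrite IH; ring]. Qed.

Lemma Csum_head (u : nat -> C) n :
  Csum u (S n) = (u 0%nat + Csum (fun k => u (S k)) n)%C.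
Proof.
  induction n as [|n IH]; [simpl; ring|].
  change (Csum u (S (S n))) with (Csum u (S n) + u (S n))%C. rewrite IH. simpl. ring.
Qed.

Lemma sum_n_Csum (u : nat -> C) n : sum_n (G := C_AbelianMonoid) u n = Csum u (S n).
Proof.
  induction n as [|n IH].
  - rewrite sum_O. simpl. ring.
  - rewrite sum_Sn, IH. reflexivity.
Qed.

Lemma Re_le_Cmod z : Rabs (Re z) <= Cmod z.
Proof.
  unfold Cmod, Re. rewrite <- (sqrt_Rsqr_abs (fst z)). apply sqrt_le_1_alt.
  unfold Rsqr. nra.
Qed.

Lemma Im_le_Cmod z : Rabs (Im z) <= Cmod z.
Proof.
  unfold Cmod, Im. rewrite <- (sqrt_Rsqr_abs (snd z)). apply sqrt_le_1_alt.
  unfold Rsqr. nra.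
Qed.

Lemma Cmod_le_abs z : Cmod z <= Rabs (Re z) + Rabs (Im z).
Proof.
  assert (Hz : z = (RtoC (Re z) + Ci * RtoC (Im z))%C).
  { destruct z; unfold RtoC, Cmult, Cplus, Ci; simpl; f_equal; ring. }
  rewrite Hz at 1. eapply Rle_trans; [apply Cmod_triangle|].
  rewrite Cmod_mult, !Cmod_R.
  replace (Cmod Ci) with 1; [lra|].
  unfold Cmod, Ci; simpl. replace (0 * (0 * 1) + 1 * (1 * 1)) with 1 by ring.
  now rewrite sqrt_1.
Qed.

Lemma Cmod_minus_sym z w : Cmod (z - w)%C = Cmod (w - z)%C.
Proof. rewrite <- Cmod_opp. f_equal. ring. Qed.

Lemma Cmod_minus_triangle x y z : Cmod (x - z)%C <= Cmod (x - y)%C + Cmod (y - z)%C.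
Proof.
  replace (x - z)%C with ((x - y) + (y - z))%C by ring. apply Cmod_triangle.
Qed.

Lemma Cmod_ge_minus x y : Cmod x - Cmod y <= Cmod (x - y)%C.
Proof.
  replace x with ((x - y) + y)%C at 1 by ring.
  pose proof (Cmod_triangle (x - y)%C y). lra.
Qed.

Lemma Cmod_Rscal (a : R) (z : C) : 0 <= a -> Cmod (RtoC a * z)%C = a * Cmod z.
Proof. intros Ha. rewrite Cmod_mult, Cmod_R, Rabs_pos_eq; auto. Qed.

(** All tails below are bounded by comparison with a telescoping majorant;
    this makes every rate of convergence explicit. *)
Lemma Csum_telescope (u : nat -> C) (v : nat -> R) n m : (n <= m)%nat ->
  (forall k, (n <= k < m)%nat -> Cmod (u k) <= v k - v (S k)) ->
  Cmod (Csum u m - Csum u n)%C <= v n - v m.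
Proof.
  intros Hnm. induction Hnm as [|m Hnm IH]; intros H.
  - replace (Csum u n - Csum u n)%C with (RtoC 0) by ring. rewrite Cmod_0. lra.
  - simpl. replace (Csum u m + u m - Csum u n)%C with ((Csum u m - Csum u n) + u m)%C by ring.
    eapply Rle_trans; [apply Cmod_triangle|].
    assert (Cmod (Csum u m - Csum u n)%C <= v n - v m) by (apply IH; intros; apply H; lia).
    assert (Cmod (u m) <= v m - v (S m)) by (apply H; lia). lra.
Qed.

Lemma Csum_bound (u : nat -> C) (B : R) n :
  (forall k, (k < n)%nat -> Cmod (u k) <= B) -> Cmod (Csum u n) <= INR n * B.
Proof.
  induction n as [|n IH]; intros H.
  - simpl. rewrite Cmod_0. lra.
  - rewrite S_INR. simpl Csum. eapply Rle_trans; [apply Cmod_triangle|].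
    assert (Cmod (Csum u n) <= INR n * B) by (apply IH; intros; apply H; lia).
    assert (Cmod (u n) <= B) by (apply H; lia). lra.
Qed.

Lemma lim0_ev (e : nat -> R) eps : is_lim_seq e 0 -> 0 < eps ->
  exists N, forall n, (N <= n)%nat -> Rabs (e n) < eps.
Proof.
  intros He Heps. apply is_lim_seq_spec in He.
  destruct (He (mkposreal eps Heps)) as [N HN]. exists N. intros n Hn.
  specialize (HN n Hn). simpl in HN. now rewrite Rminus_0_r in HN.
Qed.

(** How limits are taken throughout: an inequality is proved up to an error term along a
    sequence, and the error is then removed. *)
Lemma le_of_le_lim0 (a b : R) (e : nat -> R) : is_lim_seq e 0 ->
  (exists N0, forall n, (N0 <= n)%nat -> a <= b + e n) -> a <= b.
Proof.
  intros He [N0 H]. apply Rnot_lt_le. intros Hab.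
  destruct (lim0_ev e (a - b) He) as [N HN]; [lra|].
  specialize (HN (max N0 N) ltac:(lia)). specialize (H (max N0 N) ltac:(lia)).
  apply Rabs_def2 in HN. lra.
Qed.

Lemma real_series_rate (u : nat -> R) (e : nat -> R) :
  (forall n m, (n <= m)%nat -> Rabs (sum_n u m - sum_n u n) <= e n) ->
  is_lim_seq e 0 ->
  is_lim_seq (sum_n u) (Series u).
Proof.
  intros H He.
  assert (Hc : ex_finite_lim_seq (sum_n u)).
  { apply ex_lim_seq_cauchy_corr. intros eps.
    destruct (lim0_ev e eps He (cond_pos eps)) as [N HN].
    exists N. intros n m Hn Hm.
    destruct (Nat.le_ge_cases n m) as [Hnm|Hnm].
    - rewrite Rabs_minus_sym. eapply Rle_lt_trans; [apply H, Hnm|].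
      eapply Rle_lt_trans; [apply Rle_abs|]. apply HN, Hn.
    - eapply Rle_lt_trans; [apply H, Hnm|].
      eapply Rle_lt_trans; [apply Rle_abs|]. apply HN, Hm. }
  assert (Hs : ex_series u) by exact Hc.
  exact (Series_correct u Hs).
Qed.

Lemma sum_n_Re (u : nat -> C) n : sum_n (fun k => Re (u k)) n = Re (Csum u (S n)).
Proof.
  induction n as [|n IH].
  - rewrite sum_O. simpl. unfold Re; simpl. ring.
  - rewrite sum_Sn, IH. reflexivity.
Qed.

Lemma sum_n_Im (u : nat -> C) n : sum_n (fun k => Im (u k)) n = Im (Csum u (S n)).
Proof.
  induction n as [|n IH].
  - rewrite sum_O. simpl. unfold Im; simpl. ring.
  - rewrite sum_Sn, IH. reflexivity.
Qed.

Lemma CSeries_rate (u : nat -> C) (e : nat -> R) :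
  (forall n m, (n <= m)%nat -> Cmod (Csum u m - Csum u n)%C <= e n) ->
  is_lim_seq e 0 ->
  forall n, Cmod (CSeries u - Csum u n)%C <= e n.
Proof.
  intros H He.
  assert (He' : is_lim_seq (fun n => e (S n)) 0) by (apply is_lim_seq_incr_1 in He; exact He).
  assert (HR : is_lim_seq (sum_n (fun k => Re (u k))) (Series (fun k => Re (u k)))).
  { apply real_series_rate with (e := fun n => e (S n)); auto. intros n m Hnm.
    rewrite !sum_n_Re.
    replace (Re (Csum u (S m)) - Re (Csum u (S n))) with (Re (Csum u (S m) - Csum u (S n)))
      by reflexivity.
    eapply Rle_trans; [apply Re_le_Cmod|apply H; lia]. }
  assert (HI : is_lim_seq (sum_n (fun k => Im (u k))) (Series (fun k => Im (u k)))).
  { apply real_series_rate with (e := fun n => e (S n)); auto. intros n m Hnm.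
    rewrite !sum_n_Im.
    replace (Im (Csum u (S m)) - Im (Csum u (S n))) with (Im (Csum u (S m) - Csum u (S n)))
      by reflexivity.
    eapply Rle_trans; [apply Im_le_Cmod|apply H; lia]. }
  intros n.
  set (d := fun m => Rabs (Series (fun k => Re (u k)) - sum_n (fun k => Re (u k)) m) +
     Rabs (Series (fun k => Im (u k)) - sum_n (fun k => Im (u k)) m)).
  assert (Hd : is_lim_seq d 0).
  { unfold d. replace (Finite 0) with (Finite (Rabs (Series (fun k => Re (u k)) - Series (fun k => Re (u k)))
      + Rabs (Series (fun k => Im (u k)) - Series (fun k => Im (u k))))).
    2:{ f_equal. rewrite !Rminus_diag, Rabs_R0. ring. }
    apply is_lim_seq_plus'.
    - apply (is_lim_seq_abs _ (Finite _)). apply is_lim_seq_minus'; auto. apply is_lim_seq_const.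
    - apply (is_lim_seq_abs _ (Finite _)). apply is_lim_seq_minus'; auto. apply is_lim_seq_const. }
  apply le_of_le_lim0 with (1 := Hd). exists n. intros m Hm.
  eapply Rle_trans; [apply (Cmod_minus_triangle _ (Csum u (S m)))|].
  assert (Cmod (Csum u (S m) - Csum u n)%C <= e n) by (apply H; lia).
  enough (Cmod (CSeries u - Csum u (S m))%C <= d m) by lra.
  eapply Rle_trans; [apply Cmod_le_abs|]. unfold d.
  rewrite sum_n_Re, sum_n_Im. apply Rle_refl.
Qed.

Lemma CSeries_is (u : nat -> C) l : is_Cseries u l -> CSeries u = l.
Proof.
  intros H.
  assert (Hm : forall eps : posreal, exists N, forall n, (N <= n)%nat ->
            Cmod (Csum u (S n) - l)%C < eps).
  { intros eps. unfold is_Cseries, is_series in H.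
    apply filterlim_locally_ball_norm with (eps := eps) in H.
    destruct H as [N HN]. exists N. intros n Hn. specialize (HN n Hn).
    unfold ball_norm in HN. rewrite <- sum_n_Csum. exact HN. }
  unfold CSeries. destruct l as [l1 l2]. f_equal.
  - apply is_series_unique. apply (is_lim_seq_spec _ (Finite l1)). intros eps.
    destruct (Hm eps) as [N HN]. exists N. intros n Hn. rewrite sum_n_Re.
    eapply Rle_lt_trans; [|apply (HN n Hn)]. apply (Re_le_Cmod (Csum u (S n) - (l1, l2))%C).
  - apply is_series_unique. apply (is_lim_seq_spec _ (Finite l2)). intros eps.
    destruct (Hm eps) as [N HN]. exists N. intros n Hn. rewrite sum_n_Im.
    eapply Rle_lt_trans; [|apply (HN n Hn)]. apply (Im_le_Cmod (Csum u (S n) - (l1, l2))%C).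
Qed.

Lemma is_Cseries_lim (u : nat -> C) l : is_Cseries u l ->
  is_lim_seq (fun n => Cmod (Csum u n - l)%C) 0.
Proof.
  intros H. apply is_lim_seq_incr_1. apply is_lim_seq_spec. intros eps.
  unfold is_Cseries, is_series in H.
  apply filterlim_locally_ball_norm with (eps := eps) in H.
  destruct H as [N HN]. exists N. intros n Hn. specialize (HN n Hn).
  unfold ball_norm in HN. rewrite Rminus_0_r, Rabs_pos_eq by apply Cmod_ge_0.
  rewrite <- sum_n_Csum. exact HN.
Qed.

(** * Complex-valued functions of a real variable *)

Definition cis (t : R) : C := (cos (2 * PI * t), sin (2 * PI * t)).

Lemma cis_plus s t : cis (s + t) = (cis s * cis t)%C.
Proof.
  unfold cis, Cmult; simpl. rewrite Rmult_plus_distr_l, cos_plus, sin_plus. f_equal; ring.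
Qed.

Lemma cis_0 : cis 0 = RtoC 1.
Proof. unfold cis. rewrite Rmult_0_r, cos_0, sin_0. reflexivity. Qed.

Lemma cis_opp t : cis (- t) = Cconj (cis t).
Proof.
  unfold cis, Cconj; simpl. replace (2 * PI * - t) with (- (2 * PI * t)) by ring.
  now rewrite cos_neg, sin_neg.
Qed.

Lemma Cmod_cis t : Cmod (cis t) = 1.
Proof.
  unfold Cmod, cis; simpl. rewrite !Rmult_1_r.
  replace (cos (2 * PI * t) * cos (2 * PI * t) + sin (2 * PI * t) * sin (2 * PI * t)) with 1.
  - apply sqrt_1.
  - pose proof (sin2_cos2 (2 * PI * t)). unfold Rsqr in H. lra.
Qed.

Lemma cis_INR n : cis (INR n) = RtoC 1.
Proof.
  unfold cis. replace (2 * PI * INR n) with (0 + 2 * INR n * PI) by ring.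
  rewrite cos_period, sin_period, cos_0, sin_0. reflexivity.
Qed.

(** Continuity and derivative are taken on components, which keeps all
    limits and integrals real. *)
Definition ccont (h : R -> C) (t : R) : Prop :=
  continuous (fun s => Re (h s)) t /\ continuous (fun s => Im (h s)) t.

Definition cder (h : R -> C) (t : R) (l : C) : Prop :=
  is_derive (fun s => Re (h s)) t (Re l) /\ is_derive (fun s => Im (h s)) t (Im l).

Lemma cder_ccont h t l : cder h t l -> ccont h t.
Proof.
  intros [H1 H2]; split.
  - apply (ex_derive_continuous (fun s => Re (h s))). eexists; eassumption.
  - apply (ex_derive_continuous (fun s => Im (h s))). eexists; eassumption.
Qed.

Lemma ccont_ext (h k : R -> C) t : (forall s, h s = k s) -> ccont h t -> ccont k t.
Proof.
  intros E [H1 H2]; split.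
  - apply continuous_ext with (2 := H1). intros; now rewrite E.
  - apply continuous_ext with (2 := H2). intros; now rewrite E.
Qed.

Lemma cder_ext (h k : R -> C) t l : (forall s, h s = k s) -> cder h t l -> cder k t l.
Proof.
  intros E [H1 H2]; split.
  - apply is_derive_ext with (2 := H1). intros; now rewrite E.
  - apply is_derive_ext with (2 := H2). intros; now rewrite E.
Qed.

Lemma ccont_const c t : ccont (fun _ => c) t.
Proof. split; apply continuous_const. Qed.

Lemma ccont_real (g : R -> R) t : continuous g t -> ccont (fun s => RtoC (g s)) t.
Proof. intros H; split; simpl; [exact H|apply continuous_const]. Qed.

Lemma ccont_plus h k t : ccont h t -> ccont k t -> ccont (fun s => h s + k s)%C t.
Proof.
  intros [H1 H2] [K1 K2]; split; simpl.
  - apply (continuous_plus (fun s => Re (h s)) (fun s => Re (k s))); auto.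
  - apply (continuous_plus (fun s => Im (h s)) (fun s => Im (k s))); auto.
Qed.

Lemma ccont_minus h k t : ccont h t -> ccont k t -> ccont (fun s => h s - k s)%C t.
Proof.
  intros [H1 H2] [K1 K2]; split; simpl.
  - apply (continuous_minus (fun s => Re (h s)) (fun s => Re (k s))); auto.
  - apply (continuous_minus (fun s => Im (h s)) (fun s => Im (k s))); auto.
Qed.

Lemma ccont_mult h k t : ccont h t -> ccont k t -> ccont (fun s => h s * k s)%C t.
Proof.
  intros [H1 H2] [K1 K2]; split; simpl.
  - apply (continuous_minus (fun s => Re (h s) * Re (k s)) (fun s => Im (h s) * Im (k s)));
      apply @continuous_mult; auto.
  - apply (continuous_plus (fun s => Re (h s) * Im (k s)) (fun s => Im (h s) * Re (k s)));
      apply @continuous_mult; auto.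
Qed.

Lemma ccont_conj h t : ccont h t -> ccont (fun s => Cconj (h s)) t.
Proof.
  intros [H1 H2]; split; simpl; auto. apply (continuous_opp (fun s => Im (h s))); auto.
Qed.

Lemma ccont_comp (g : R -> R) h t : continuous g t -> ccont h (g t) -> ccont (fun s => h (g s)) t.
Proof.
  intros Hg [H1 H2]; split.
  - apply (continuous_comp g (fun s => Re (h s))); auto.
  - apply (continuous_comp g (fun s => Im (h s))); auto.
Qed.

Lemma ccont_Csum (u : nat -> R -> C) n t :
  (forall k, (k < n)%nat -> ccont (u k) t) -> ccont (fun s => Csum (fun k => u k s) n) t.
Proof.
  induction n as [|n IH]; intros H; simpl.
  - apply ccont_const.
  - apply ccont_plus; [apply IH; intros; apply H; lia|apply H; lia].
Qed.

Lemma cder_const c t : cder (fun _ => c) t (RtoC 0).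
Proof. split; simpl; apply @is_derive_const. Qed.

Lemma cder_plus h k t l m : cder h t l -> cder k t m -> cder (fun s => h s + k s)%C t (l + m)%C.
Proof.
  intros [H1 H2] [K1 K2]; split; simpl.
  - apply (is_derive_plus (fun s => Re (h s)) (fun s => Re (k s))); auto.
  - apply (is_derive_plus (fun s => Im (h s)) (fun s => Im (k s))); auto.
Qed.

Lemma cder_minus h k t l m : cder h t l -> cder k t m -> cder (fun s => h s - k s)%C t (l - m)%C.
Proof.
  intros [H1 H2] [K1 K2]; split; simpl.
  - apply (is_derive_minus (fun s => Re (h s)) (fun s => Re (k s))); auto.
  - apply (is_derive_minus (fun s => Im (h s)) (fun s => Im (k s))); auto.
Qed.

Lemma is_derive_eq (g : R -> R) t (l m : R) : is_derive g t l -> l = m -> is_derive g t m.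
Proof. now intros H <-. Qed.

Lemma cder_mult h k t l m : cder h t l -> cder k t m ->
  cder (fun s => h s * k s)%C t (l * k t + h t * m)%C.
Proof.
  intros [H1 H2] [K1 K2].
  assert (P : forall (a b : R -> R) a' b', is_derive a t a' -> is_derive b t b' ->
     is_derive (fun s => a s * b s) t (a' * b t + a t * b')).
  { intros a b a' b' Ha Hb. apply (is_derive_mult a b); auto. intros; apply Rmult_comm. }
  split; eapply is_derive_eq.
  - apply (is_derive_minus (fun s => Re (h s) * Re (k s)) (fun s => Im (h s) * Im (k s)) t).
    + apply (P (fun s => Re (h s)) (fun s => Re (k s))); eauto.
    + apply (P (fun s => Im (h s)) (fun s => Im (k s))); eauto.
  - unfold minus, plus, opp, Re, Im; simpl; ring.
  - apply (is_derive_plus (fun s => Re (h s) * Im (k s)) (fun s => Im (h s) * Re (k s)) t).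
    + apply (P (fun s => Re (h s)) (fun s => Im (k s))); eauto.
    + apply (P (fun s => Im (h s)) (fun s => Re (k s))); eauto.
  - unfold plus, Re, Im; simpl; ring.
Qed.

Lemma cder_scal c h t l : cder h t l -> cder (fun s => c * h s)%C t (c * l)%C.
Proof.
  intros H. pose proof (cder_mult _ _ _ _ _ (cder_const c t) H) as K.
  replace (c * l)%C with (RtoC 0 * h t + c * l)%C by ring. exact K.
Qed.

Lemma cder_Csum (u u' : nat -> R -> C) n t :
  (forall k, (k < n)%nat -> cder (u k) t (u' k t)) ->
  cder (fun s => Csum (fun k => u k s) n) t (Csum (fun k => u' k t) n).
Proof.
  induction n as [|n IH]; intros H; simpl.
  - apply cder_const.
  - apply cder_plus; [apply IH; intros; apply H; lia|apply H; lia].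
Qed.

Lemma cder_real (g : R -> R) t l : is_derive g t l -> cder (fun s => RtoC (g s)) t (RtoC l).
Proof. intros H; split; simpl; [exact H|apply @is_derive_const]. Qed.

Lemma cder_cis a b t :
  cder (fun s => cis (a * s + b)) t (RtoC (2 * PI * a) * Ci * cis (a * t + b))%C.
Proof.
  split; unfold cis; simpl.
  - replace ((2 * PI * a * 0 - 0 * 1) * cos (2 * PI * (a * t + b)) -
      (2 * PI * a * 1 + 0 * 0) * sin (2 * PI * (a * t + b)))
      with (- (2 * PI * a * sin (2 * PI * (a * t + b)))) by ring.
    auto_derive; auto. ring.
  - replace ((2 * PI * a * 0 - 0 * 1) * sin (2 * PI * (a * t + b)) +
      (2 * PI * a * 1 + 0 * 0) * cos (2 * PI * (a * t + b)))
      with (2 * PI * a * cos (2 * PI * (a * t + b))) by ring.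
    auto_derive; auto. ring.
Qed.

Lemma ccont_cis a b t : ccont (fun s => cis (a * s + b)) t.
Proof. eapply cder_ccont, cder_cis. Qed.

Lemma ccont_cis_scal a t : ccont (fun s => cis (a * s)) t.
Proof.
  eapply ccont_ext; [|apply (ccont_cis a 0)]. intros; simpl. now rewrite Rplus_0_r.
Qed.

(** A unimodular factor reduces estimates of complex quantities to their real parts. *)
Lemma Cmod_rotate (z : C) : exists c : C, Cmod c = 1 /\ (c * z)%C = RtoC (Cmod z).
Proof.
  destruct (classic (z = RtoC 0)) as [->|Hz].
  - exists (RtoC 1). split; [apply Cmod_1|]. rewrite Cmod_0. ring.
  - assert (Hp : 0 < Cmod z) by now apply Cmod_gt_0.
    exists (Cconj z * RtoC (/ Cmod z))%C. split.
    + rewrite Cmod_mult, Cmod_R, Cmod_conj, Rabs_pos_eq.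
      * field. lra.
      * apply Rlt_le, Rinv_0_lt_compat, Hp.
    + replace (Cconj z * RtoC (/ Cmod z) * z)%C with ((z * Cconj z) * RtoC (/ Cmod z))%C by ring.
      rewrite <- Cmod2_conj. rewrite <- !RtoC_mult. f_equal. field. lra.
Qed.

Lemma cder_mean_value h h' (a b M : R) :
  (forall t, Rmin a b <= t <= Rmax a b -> cder h t (h' t)) ->
  (forall t, Rmin a b <= t <= Rmax a b -> Cmod (h' t) <= M) ->
  Cmod (h b - h a)%C <= M * Rabs (b - a).
Proof.
  intros Hd HM. destruct (Cmod_rotate (h b - h a)) as [c [Hc1 Hc]].
  destruct (MVT_gen (fun t => Re (c * h t)%C) a b (fun t => Re (c * h' t)%C)) as [t [Ht E]].
  - intros x Hx. apply (cder_scal c h x (h' x)). apply Hd. lra.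
  - intros x Hx. apply continuity_pt_filterlim.
    apply (cder_ccont _ _ _ (cder_scal c h x (h' x) (Hd x Hx))).
  - assert (E2 : Re (c * h b)%C - Re (c * h a)%C = Cmod (h b - h a)).
    { replace (Re (c * h b)%C - Re (c * h a)%C) with (Re (c * (h b - h a))%C)
        by (unfold Re; simpl; ring). rewrite Hc. reflexivity. }
    rewrite <- E2, E. eapply Rle_trans; [apply Rle_abs|]. rewrite Rabs_mult.
    apply Rmult_le_compat_r; [apply Rabs_pos|].
    eapply Rle_trans; [apply Re_le_Cmod|]. rewrite Cmod_mult, Hc1, Rmult_1_l. now apply HM.
Qed.

(** * Integrals of complex-valued functions *)

Definition CInt (h : R -> C) (a b : R) : C :=
  (RInt (fun t => Re (h t)) a b, RInt (fun t => Im (h t)) a b).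

Definition ccont_on (h : R -> C) (a b : R) : Prop := forall t, a <= t <= b -> ccont h t.

Lemma ccont_on_ex h a b : a <= b -> ccont_on h a b ->
  ex_RInt (fun t => Re (h t)) a b /\ ex_RInt (fun t => Im (h t)) a b.
Proof.
  intros Hab H; split; apply (ex_RInt_continuous (V := R_CompleteNormedModule)); intros t Ht;
    rewrite Rmin_left, Rmax_right in Ht by lra; apply (H t Ht).
Qed.

Lemma CInt_ext h k a b : a <= b -> (forall t, a < t < b -> h t = k t) -> CInt h a b = CInt k a b.
Proof.
  intros Hab H. unfold CInt. f_equal; apply RInt_ext; intros t Ht;
    rewrite Rmin_left, Rmax_right in Ht by lra; now rewrite H.
Qed.

Lemma CInt_plus h k a b : a <= b -> ccont_on h a b -> ccont_on k a b ->
  CInt (fun t => h t + k t)%C a b = (CInt h a b + CInt k a b)%C.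
Proof.
  intros Hab H K. destruct (ccont_on_ex _ _ _ Hab H). destruct (ccont_on_ex _ _ _ Hab K).
  unfold CInt, Cplus; simpl. f_equal.
  - apply (RInt_plus (fun t => Re (h t)) (fun t => Re (k t))); auto.
  - apply (RInt_plus (fun t => Im (h t)) (fun t => Im (k t))); auto.
Qed.

Lemma RInt_Rscal (f : R -> R) (a b l : R) : ex_RInt f a b ->
  RInt (fun t => l * f t) a b = l * RInt f a b.
Proof. intros H. apply (RInt_scal f a b l); auto. Qed.

Lemma CInt_scal c h a b : a <= b -> ccont_on h a b ->
  CInt (fun t => c * h t)%C a b = (c * CInt h a b)%C.
Proof.
  intros Hab H. destruct (ccont_on_ex _ _ _ Hab H) as [H1 H2].
  assert (E1 : forall l, ex_RInt (fun t => l * Re (h t)) a b)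
    by (intros l; apply (ex_RInt_scal (fun t => Re (h t))); auto).
  assert (E2 : forall l, ex_RInt (fun t => l * Im (h t)) a b)
    by (intros l; apply (ex_RInt_scal (fun t => Im (h t))); auto).
  unfold CInt, Cmult; simpl. f_equal.
  - rewrite <- !RInt_Rscal by auto.
    apply (RInt_minus (fun t => fst c * Re (h t)) (fun t => snd c * Im (h t))); auto.
  - rewrite <- !RInt_Rscal by auto.
    apply (RInt_plus (fun t => fst c * Im (h t)) (fun t => snd c * Re (h t))); auto.
Qed.

Lemma CInt_minus h k a b : a <= b -> ccont_on h a b -> ccont_on k a b ->
  CInt (fun t => h t - k t)%C a b = (CInt h a b - CInt k a b)%C.
Proof.
  intros Hab H K.
  replace (CInt h a b - CInt k a b)%C with (CInt h a b + RtoC (-1) * CInt k a b)%C.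
  2:{ change (RtoC (-1)) with (RtoC (- (1))). rewrite RtoC_opp. ring. }
  rewrite <- CInt_scal, <- CInt_plus; auto.
  - apply CInt_ext; auto. intros. change (RtoC (-1)) with (RtoC (- (1))). rewrite RtoC_opp. ring.
  - intros t Ht. apply ccont_mult; [apply ccont_const|auto].
Qed.

Lemma CInt_Csum (u : nat -> R -> C) n a b : a <= b ->
  (forall k, (k < n)%nat -> ccont_on (u k) a b) ->
  CInt (fun t => Csum (fun k => u k t) n) a b = Csum (fun k => CInt (u k) a b) n.
Proof.
  intros Hab. induction n as [|n IH]; intros H; simpl.
  - unfold CInt; simpl. rewrite RInt_const. unfold scal, RtoC; simpl. unfold mult; simpl.
    f_equal; ring.
  - rewrite CInt_plus; auto.
    + rewrite IH; auto.
    + intros t Ht. apply ccont_Csum. intros k Hk. apply H; [lia|auto].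
Qed.

Lemma CInt_conj h a b : a <= b -> ccont_on h a b ->
  CInt (fun t => Cconj (h t)) a b = Cconj (CInt h a b).
Proof.
  intros Hab H. destruct (ccont_on_ex _ _ _ Hab H). unfold CInt, Cconj; simpl. f_equal.
  apply (RInt_opp (fun t => Im (h t))); auto.
Qed.

Lemma CInt_bound h (g : R -> R) a b : a <= b -> ccont_on h a b -> ex_RInt g a b ->
  (forall t, a < t < b -> Cmod (h t) <= g t) -> Cmod (CInt h a b) <= RInt g a b.
Proof.
  intros Hab H Hg HB. destruct (Cmod_rotate (CInt h a b)) as [c [Hc1 Hc]].
  rewrite <- CInt_scal in Hc by auto.
  assert (K : ccont_on (fun t => c * h t)%C a b).
  { intros t Ht. apply ccont_mult; [apply ccont_const|auto]. }
  destruct (ccont_on_ex _ _ _ Hab K) as [K1 _].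
  assert (E : Cmod (CInt h a b) = RInt (fun t => Re (c * h t)%C) a b).
  { transitivity (Re (RtoC (Cmod (CInt h a b)))); [reflexivity|]. rewrite <- Hc. reflexivity. }
  rewrite E. apply RInt_le; auto. intros t Ht.
  eapply Rle_trans; [apply Rle_abs|]. eapply Rle_trans; [apply Re_le_Cmod|].
  rewrite Cmod_mult, Hc1, Rmult_1_l. auto.
Qed.

Lemma CInt_bound_const h B a b : a <= b -> ccont_on h a b ->
  (forall t, a < t < b -> Cmod (h t) <= B) -> Cmod (CInt h a b) <= (b - a) * B.
Proof.
  intros Hab H HB. eapply Rle_trans; [apply (CInt_bound h (fun _ => B)); auto|].
  - apply ex_RInt_const.
  - rewrite RInt_const. apply Rle_refl.
Qed.

Lemma CInt_derive h h' a b : a <= b -> (forall t, a <= t <= b -> cder h t (h' t)) ->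
  ccont_on h' a b -> CInt h' a b = (h b - h a)%C.
Proof.
  intros Hab H H'. unfold CInt.
  apply injective_projections; simpl.
  - apply is_RInt_unique. apply (is_RInt_derive (fun t => Re (h t)) (fun t => Re (h' t)));
      intros t Ht; rewrite Rmin_left, Rmax_right in Ht by lra; [apply H|apply H']; auto.
  - apply is_RInt_unique. apply (is_RInt_derive (fun t => Im (h t)) (fun t => Im (h' t)));
      intros t Ht; rewrite Rmin_left, Rmax_right in Ht by lra; [apply H|apply H']; auto.
Qed.

Lemma CInt_Chasles h a b c : a <= b -> b <= c -> ccont_on h a c ->
  (CInt h a b + CInt h b c)%C = CInt h a c.
Proof.
  intros Hab Hbc H.
  destruct (ccont_on_ex h a b) as [A1 A2]; [lra|intros t Ht; apply H; lra|].
  destruct (ccont_on_ex h b c) as [B1 B2]; [lra|intros t Ht; apply H; lra|].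
  unfold CInt, Cplus; simpl. f_equal; apply (RInt_Chasles (V := R_CompleteNormedModule)); auto.
Qed.

(** * Uniform limits and Taylor expansions *)

Lemma CVU_of_rate (F : R -> R) (S : nat -> R -> R) (e : nat -> R) c (d : posreal) :
  is_lim_seq e 0 -> (forall n t, Boule c d t -> Rabs (F t - S n t) <= e n) -> CVU S F c d.
Proof.
  intros He H eps Heps. destruct (lim0_ev e eps He Heps) as [N HN]. exists N. intros n y Hn Hy.
  eapply Rle_lt_trans; [apply H, Hy|]. eapply Rle_lt_trans; [apply Rle_abs|]. auto.
Qed.

Lemma ccont_uniform_limit (F : R -> C) (S : nat -> R -> C) (e : nat -> R) t0 (d : posreal) :
  is_lim_seq e 0 ->
  (forall n t, Rabs (t - t0) < d -> Cmod (F t - S n t)%C <= e n) ->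
  (forall n t, ccont (S n) t) -> ccont F t0.
Proof.
  intros He H HS.
  assert (B0 : Boule t0 d t0).
  { unfold Boule. rewrite Rminus_diag, Rabs_R0. apply cond_pos. }
  split; apply continuity_pt_filterlim.
  - apply (CVU_continuity (fun n t => Re (S n t)) (fun t => Re (F t)) t0 d); auto.
    + apply CVU_of_rate with (e := e); auto. intros n t Ht.
      eapply Rle_trans; [|apply (H n t Ht)]. apply (Re_le_Cmod (F t - S n t)%C).
    + intros n y _. apply continuity_pt_filterlim. apply HS.
  - apply (CVU_continuity (fun n t => Im (S n t)) (fun t => Im (F t)) t0 d); auto.
    + apply CVU_of_rate with (e := e); auto. intros n t Ht.
      eapply Rle_trans; [|apply (H n t Ht)]. apply (Im_le_Cmod (F t - S n t)%C).
    + intros n y _. apply continuity_pt_filterlim. apply HS.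
Qed.

Lemma cder_uniform_limit (F F' : R -> C) (S S' : nat -> R -> C) (e : nat -> R) t0 :
  is_lim_seq e 0 ->
  (forall n t, Cmod (F t - S n t)%C <= e n) ->
  (forall n t, Cmod (F' t - S' n t)%C <= e n) ->
  (forall n t, cder (S n) t (S' n t)) -> cder F t0 (F' t0).
Proof.
  intros He H H' HS.
  assert (d : posreal) by exact (mkposreal 1 Rlt_0_1).
  assert (B0 : Boule t0 d t0).
  { unfold Boule. rewrite Rminus_diag, Rabs_R0. apply cond_pos. }
  assert (L : forall (G : R -> R) (T : nat -> R -> R) t, (forall n, Rabs (G t - T n t) <= e n) ->
             Un_cv (fun n => T n t) (G t)).
  { intros G T t HG. apply is_lim_seq_Reals. apply is_lim_seq_spec. intros eps.
    destruct (lim0_ev e eps He (cond_pos eps)) as [N HN]. exists N. intros n Hn.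
    rewrite Rabs_minus_sym. eapply Rle_lt_trans; [apply HG|].
    eapply Rle_lt_trans; [apply Rle_abs|]. auto. }
  split; apply is_derive_Reals.
  - apply (CVU_derivable (fun n t => Re (S n t)) (fun n t => Re (S' n t))
      (fun t => Re (F t)) (fun t => Re (F' t)) t0 d); auto.
    + apply CVU_of_rate with (e := e); auto. intros n t Ht.
      eapply Rle_trans; [|apply (H' n t)]. apply (Re_le_Cmod (F' t - S' n t)%C).
    + intros t _. apply (L (fun t => Re (F t)) (fun n t => Re (S n t))). intros n.
      eapply Rle_trans; [|apply (H n t)]. apply (Re_le_Cmod (F t - S n t)%C).
    + intros n t _. apply is_derive_Reals, HS.
  - apply (CVU_derivable (fun n t => Im (S n t)) (fun n t => Im (S' n t))
      (fun t => Im (F t)) (fun t => Im (F' t)) t0 d); auto.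
    + apply CVU_of_rate with (e := e); auto. intros n t Ht.
      eapply Rle_trans; [|apply (H' n t)]. apply (Im_le_Cmod (F' t - S' n t)%C).
    + intros t _. apply (L (fun t => Im (F t)) (fun n t => Im (S n t))). intros n.
      eapply Rle_trans; [|apply (H n t)]. apply (Im_le_Cmod (F t - S n t)%C).
    + intros n t _. apply is_derive_Reals, HS.
Qed.

(** By induction on [k]: the remainder of [D 0] vanishes at [x0] and its derivative is the
    remainder of [D 1], so the mean value inequality gains one factor [rad].  The last
    derivative is only assumed to vary little, which covers Hölder conditions. *)
Lemma taylor_bound k : forall (D : nat -> R -> C) x0 rad M, 0 <= rad ->
  (forall j x, (j < k)%nat -> Rabs (x - x0) <= rad -> cder (D j) x (D (S j) x)) ->
  (forall x, Rabs (x - x0) <= rad -> Cmod (D k x - D k x0)%C <= M) ->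
  forall x, Rabs (x - x0) <= rad ->
  Cmod (D 0%nat x - Csum (fun j => D j x0 * RtoC (/ INR (fact j) * (x - x0) ^ j))%C (S k))%C
    <= M * rad ^ k.
Proof.
  induction k as [|k IH]; intros D x0 rad M Hr HD HM x Hx.
  - replace (M * rad ^ 0) with M by (simpl; ring).
    eapply Rle_trans; [|apply (HM x Hx)]. right; f_equal. simpl.
    replace (/ 1 * 1) with 1 by field. ring.
  - set (T := fun (E : nat -> R -> C) n (s : R) =>
        Csum (fun j => E j x0 * RtoC (/ INR (fact j) * (s - x0) ^ j))%C n).
    assert (HT : forall n s, cder (T D (S n)) s (T (fun j => D (S j)) n s)).
    { intros n s. induction n as [|n IHn].
      - unfold T; simpl Csum. eapply cder_ext; [|apply (cder_const (D 0%nat x0))].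
        intros; simpl. replace (/ 1 * 1) with 1 by field. ring.
      - apply (cder_plus (T D (S n)) (fun s => D (S n) x0 * RtoC (/ INR (fact (S n)) * (s - x0) ^ (S n)))%C);
          auto.
        apply cder_scal. apply cder_real.
        rewrite fact_simpl, mult_INR.
        assert (INR (S n) <> 0) by (apply not_0_INR; lia).
        assert (INR (fact n) <> 0) by (apply INR_fact_neq_0).
        auto_derive; auto.
        change (match n with O => 1 | S _ => INR n + 1 end) with (INR (S n)).
        change (s + - x0) with (s - x0). field. auto. }
    assert (K := fun s (Hs : Rabs (s - x0) <= rad) => IH (fun j => D (S j)) x0 rad M Hr
       (fun j x Hj => HD (S j) x ltac:(lia)) HM s Hs).
    set (Rm := fun s => (D 0%nat s - T D (S (S k)) s)%C).
    set (Rm' := fun s => (D 1%nat s - T (fun j => D (S j)) (S k) s)%C).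
    assert (Hseg : forall t, Rmin x0 x <= t <= Rmax x0 x -> Rabs (t - x0) <= rad).
    { intros t Ht. apply Rabs_le. apply Rabs_le_between in Hx.
      revert Ht. unfold Rmin, Rmax. destruct (Rle_dec x0 x); lra. }
    assert (Q : Cmod (Rm x - Rm x0)%C <= (M * rad ^ k) * Rabs (x - x0)).
    { apply cder_mean_value with (h' := Rm').
      - intros t Ht. apply cder_minus; [apply HD; [lia|auto]|]. apply (HT (S k) t).
      - intros t Ht. apply K. auto. }
    assert (E0 : Rm x0 = RtoC 0).
    { unfold Rm, T. rewrite Csum_head.
      rewrite (Csum_ext _ (fun j => RtoC 0 * RtoC 0)%C).
      - rewrite Csum_scal. rewrite Rminus_diag. simpl. replace (/ 1 * 1) with 1 by field. ring.
      - intros j _. rewrite Rminus_diag. simpl. rewrite Rmult_0_l, Rmult_0_r. ring. }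
    rewrite E0 in Q. replace (Rm x - RtoC 0)%C with (Rm x) in Q by ring.
    change (Cmod (Rm x) <= M * rad ^ S k).
    eapply Rle_trans; [apply Q|]. simpl. rewrite (Rmult_comm rad), <- Rmult_assoc.
    apply Rmult_le_compat_l; auto. apply Rmult_le_pos; [|apply pow_le, Hr].
    eapply Rle_trans; [|apply (HM x Hx)]. apply Cmod_ge_0.
Qed.

(** * Summation by parts *)

Definition nu (n : nat) : R := INR (S n).

Lemma nu_ge1 n : 1 <= nu n.
Proof. unfold nu. rewrite S_INR. pose proof (pos_INR n). lra. Qed.

Lemma nu_pos n : 0 < nu n.
Proof. pose proof (nu_ge1 n). lra. Qed.

Lemma nu_S n : nu (S n) = nu n + 1.
Proof. unfold nu. now rewrite (S_INR (S n)). Qed.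

Lemma nu_le n m : (n <= m)%nat -> nu n <= nu m.
Proof. intros H. unfold nu. apply le_INR. lia. Qed.

Lemma Rpower_pos x a : 0 < Rpower x a.
Proof. apply exp_pos. Qed.

Lemma Rpower_le_neg x y a : 0 <= a -> 0 < x <= y -> Rpower y (- a) <= Rpower x (- a).
Proof.
  intros Ha [Hx Hxy]. rewrite !Rpower_Ropp. apply Rinv_le_contravar; [apply Rpower_pos|].
  apply Rle_Rpower_l; lra.
Qed.

Lemma exp_le_mono a b : a <= b -> exp a <= exp b.
Proof.
  intros H. destruct (Rle_lt_or_eq_dec _ _ H) as [K|K]; [apply Rlt_le, exp_increasing, K|rewrite K; lra].
Qed.

Lemma Rpower_anti t s s' : 0 < t <= 1 -> s' <= s -> Rpower t s <= Rpower t s'.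
Proof.
  intros Ht Hs. unfold Rpower. apply exp_le_mono.
  assert (ln t <= 0).
  { rewrite <- ln_1. destruct (Rle_lt_or_eq_dec _ _ (proj2 Ht)) as [L|L].
    - apply Rlt_le, ln_increasing; lra.
    - rewrite L; lra. }
  nra.
Qed.

Lemma Rpower_1_base a : Rpower 1 a = 1.
Proof. unfold Rpower. rewrite ln_1, Rmult_0_r. apply exp_0. Qed.

Lemma Rpower_ge1 x a : 1 <= x -> 0 <= a -> 1 <= Rpower x a.
Proof. intros Hx Ha. rewrite <- (Rpower_1_base a). apply Rle_Rpower_l; lra. Qed.

Lemma lim_inv_INR : is_lim_seq (fun n => / nu n) 0.
Proof.
  unfold nu. apply (is_lim_seq_incr_1 (fun n => / INR n)).
  apply (is_lim_seq_inv _ p_infty); [apply is_lim_seq_INR|discriminate].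
Qed.

Lemma lim_nu_pow K d : 0 < d -> is_lim_seq (fun n => K * Rpower (nu n) (- d)) 0.
Proof.
  intros Hd. replace (Finite 0) with (Rbar_mult K 0) by (simpl; f_equal; ring).
  apply is_lim_seq_scal_l. apply is_lim_seq_spec. intros eps.
  destruct (lim0_ev (fun n => / nu n) (Rpower eps (/ d)) lim_inv_INR (Rpower_pos _ _)) as [N HN].
  exists N. intros n Hn. specialize (HN n Hn). simpl in HN.
  pose proof (nu_pos n). rewrite Rabs_pos_eq in HN by (apply Rlt_le, Rinv_0_lt_compat; lra).
  rewrite Rminus_0_r, Rabs_pos_eq by (apply Rlt_le, Rpower_pos).
  replace (pos eps) with (Rpower (Rpower eps (/ d)) d).
  2:{ rewrite Rpower_mult. replace (/ d * d) with 1 by (field; lra). apply Rpower_1, cond_pos. }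
  replace (Rpower (nu n) (- d)) with (Rpower (/ nu n) d).
  2:{ unfold Rpower. rewrite ln_Rinv by lra. f_equal; ring. }
  apply Rlt_Rpower_l; [lra|]. split; [apply Rinv_0_lt_compat; lra|auto].
Qed.

(** With [q = (n + 1) / n <= 2], both differences are comparable to [ln q]. *)
Lemma abel_weight rho a n : 0 <= rho < a ->
  Rpower (nu n) rho * (Rpower (nu n) (- a) - Rpower (nu (S n)) (- a)) <=
  a * Rpower 2 (a - rho) / (a - rho) *
    (Rpower (nu n) (- (a - rho)) - Rpower (nu (S n)) (- (a - rho))).
Proof.
  intros Hr. pose proof (nu_ge1 n) as Hn. set (d := a - rho).
  set (l := ln (nu (S n) / nu n)).
  assert (Hq : 1 < nu (S n) / nu n <= 2).
  { rewrite nu_S. split.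
    - apply Rmult_lt_reg_r with (nu n); [lra|]. field_simplify; lra.
    - apply Rmult_le_reg_r with (nu n); [lra|]. field_simplify; lra. }
  assert (Hl : 0 <= l <= ln 2).
  { unfold l. split; [rewrite <- ln_1; apply Rlt_le, ln_increasing; lra|].
    destruct (Rle_lt_or_eq_dec _ _ (proj2 Hq)) as [H|H]; [apply Rlt_le, ln_increasing; lra|].
    rewrite H; lra. }
  assert (E : forall s, Rpower (nu (S n)) (- s) = Rpower (nu n) (- s) * exp (- (s * l))).
  { intros s. unfold Rpower, l. rewrite <- exp_plus. f_equal.
    unfold Rdiv. rewrite ln_mult, ln_Rinv by (try apply Rinv_0_lt_compat; rewrite ?nu_S; lra). ring. }
  rewrite !E. clear E.
  assert (E : Rpower (nu n) rho * Rpower (nu n) (- a) = Rpower (nu n) (- d)).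
  { rewrite <- Rpower_plus. f_equal. unfold d; ring. }
  replace (Rpower (nu n) rho * (Rpower (nu n) (- a) - Rpower (nu n) (- a) * exp (- (a * l))))
    with (Rpower (nu n) (- d) * (1 - exp (- (a * l)))) by (rewrite <- E; ring).
  replace (a * Rpower 2 d / d * (Rpower (nu n) (- d) - Rpower (nu n) (- d) * exp (- (d * l))))
    with (Rpower (nu n) (- d) * (a * Rpower 2 d / d * (1 - exp (- (d * l))))) by ring.
  apply Rmult_le_compat_l; [apply Rlt_le, Rpower_pos|].
  assert (Hd : 0 < d) by (unfold d; lra).
  assert (A1 : 1 - exp (- (a * l)) <= a * l) by (pose proof (exp_ineq1_le (- (a * l))); lra).
  assert (A2 : d * l * / Rpower 2 d <= 1 - exp (- (d * l))).
  { assert (exp (- (d * l)) * exp (d * l) = 1) by (rewrite <- exp_plus, Rplus_opp_l; apply exp_0).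
    assert (B : / Rpower 2 d <= exp (- (d * l))).
    { rewrite <- Rpower_Ropp. unfold Rpower.
      destruct (Rle_lt_or_eq_dec (- d * ln 2) (- (d * l))) as [K|K]; [nra|
        apply Rlt_le, exp_increasing, K|rewrite K; lra]. }
    pose proof (exp_ineq1_le (d * l)). pose proof (exp_pos (- (d * l))).
    apply Rle_trans with (d * l * exp (- (d * l))); [apply Rmult_le_compat_l; nra|]. nra. }
  apply Rle_trans with (1 := A1).
  replace (a * l) with (a * Rpower 2 d / d * (d * l * / Rpower 2 d)).
  2:{ field. split; [apply Rgt_not_eq, Rpower_pos|lra]. }
  apply Rmult_le_compat_l; auto. unfold Rdiv.
  pose proof (Rpower_pos 2 d). pose proof (Rinv_0_lt_compat d Hd).
  apply Rmult_le_pos; [|lra]. apply Rmult_le_pos; lra.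
Qed.

Definition abel_const (rho a : R) : R := 2 + a * Rpower 2 (a - rho) / (a - rho).

(** Tails of a series with power-bounded partial sums against weights that
    decrease no faster than [n^(-a)]; the weights are left general because they
    will also be truncated Mellin integrals. *)
Lemma abel_tail (b : nat -> C) (w : nat -> R) rho a M W : 0 <= rho < a -> 0 <= M -> 0 <= W ->
  (forall n, Cmod (Csum b (S n)) <= M * Rpower (nu n) rho) ->
  (forall n, 0 <= w n <= W * Rpower (nu n) (- a)) ->
  (forall n, 0 <= w n - w (S n) <= W * (Rpower (nu n) (- a) - Rpower (nu (S n)) (- a))) ->
  forall n m, (n <= m)%nat ->
  Cmod (Csum (fun k => b k * RtoC (w k))%C m - Csum (fun k => b k * RtoC (w k))%C n)%C <=
    M * W * abel_const rho a * Rpower (nu n) (- (a - rho)).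
Proof.
  intros Hr HM HW Hb Hw Hdw n m Hnm. set (d := a - rho). assert (Hd : 0 < d) by (unfold d; lra).
  set (B := fun k => (Csum b k * RtoC (w k))%C).
  set (t := fun k => (Csum b (S k) * RtoC (w k - w (S k)))%C).
  assert (E : forall k, Csum (fun k => b k * RtoC (w k))%C k = (B k + Csum t k - B 0%nat)%C).
  { induction k as [|k IH]; [simpl; ring|].
    cbn [Csum]. rewrite IH. unfold t, B. cbn [Csum]. rewrite RtoC_minus. ring. }
  rewrite !E.
  replace (B m + Csum t m - B 0%nat - (B n + Csum t n - B 0%nat))%C with
    ((Csum t m - Csum t n) + (B m - B n))%C by ring.
  assert (HB : forall k, (n <= k)%nat -> Cmod (B k) <= M * W * Rpower (nu n) (- d)).
  { intros k Hk. unfold B. rewrite Cmod_mult, Cmod_R, Rabs_pos_eq by apply Hw.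
    assert (P0 : 0 <= M * W * Rpower (nu n) (- d)).
    { apply Rmult_le_pos; [apply Rmult_le_pos; auto|apply Rlt_le, Rpower_pos]. }
    destruct k as [|k]; [simpl; rewrite Cmod_0, Rmult_0_l; auto|].
    apply Rle_trans with ((M * Rpower (nu k) rho) * (W * Rpower (nu (S k)) (- a))).
    - apply Rmult_le_compat; [apply Cmod_ge_0|apply Hw|apply Hb|apply Hw].
    - replace (M * Rpower (nu k) rho * (W * Rpower (nu (S k)) (- a))) with
        (M * W * (Rpower (nu k) rho * Rpower (nu (S k)) (- a))) by ring.
      apply Rmult_le_compat_l; [apply Rmult_le_pos; auto|].
      apply Rle_trans with (Rpower (nu (S k)) rho * Rpower (nu (S k)) (- a)).
      + apply Rmult_le_compat_r; [apply Rlt_le, Rpower_pos|]. apply Rle_Rpower_l; [lra|].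
        split; [apply nu_pos|apply nu_le; lia].
      + rewrite <- Rpower_plus. replace (rho + - a) with (- d) by (unfold d; ring).
        apply Rpower_le_neg; [lra|]. split; [apply nu_pos|apply nu_le; lia]. }
  set (L := a * Rpower 2 d / d).
  assert (HT : Cmod (Csum t m - Csum t n)%C <=
     M * W * L * Rpower (nu n) (- d) - M * W * L * Rpower (nu m) (- d)).
  { apply (Csum_telescope t (fun k => M * W * L * Rpower (nu k) (- d))); auto. intros k _.
    unfold t. rewrite Cmod_mult, Cmod_R, Rabs_pos_eq by apply Hdw.
    apply Rle_trans with ((M * Rpower (nu k) rho) *
       (W * (Rpower (nu k) (- a) - Rpower (nu (S k)) (- a)))).
    - apply Rmult_le_compat; [apply Cmod_ge_0|apply Hdw|apply Hb|apply Hdw].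
    - pose proof (abel_weight rho a k Hr) as A. fold d L in A.
      replace (M * Rpower (nu k) rho * (W * (Rpower (nu k) (- a) - Rpower (nu (S k)) (- a))))
       with (M * W * (Rpower (nu k) rho * (Rpower (nu k) (- a) - Rpower (nu (S k)) (- a)))) by ring.
      replace (M * W * L * Rpower (nu k) (- d) - M * W * L * Rpower (nu (S k)) (- d)) with
        (M * W * (L * (Rpower (nu k) (- d) - Rpower (nu (S k)) (- d)))) by ring.
      apply Rmult_le_compat_l; [apply Rmult_le_pos; auto|exact A]. }
  assert (0 <= M * W * L * Rpower (nu m) (- d)).
  { apply Rmult_le_pos; [|apply Rlt_le, Rpower_pos].
    apply Rmult_le_pos; [apply Rmult_le_pos; auto|]. unfold L, Rdiv.
    apply Rmult_le_pos; [apply Rmult_le_pos; [lra|apply Rlt_le, Rpower_pos]|].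
    apply Rlt_le, Rinv_0_lt_compat, Hd. }
  eapply Rle_trans; [apply Cmod_triangle|].
  pose proof (HB m Hnm). pose proof (HB n (Nat.le_refl n)).
  assert (Cmod (B m - B n)%C <= Cmod (B m) + Cmod (B n)).
  { unfold Cminus. eapply Rle_trans; [apply Cmod_triangle|]. rewrite Cmod_opp. lra. }
  unfold abel_const. fold d L. nra.
Qed.

Lemma power_weight_ok a : 0 <= a -> forall n,
  0 <= Rpower (nu n) (- a) <= 1 * Rpower (nu n) (- a) /\
  0 <= Rpower (nu n) (- a) - Rpower (nu (S n)) (- a) <=
    1 * (Rpower (nu n) (- a) - Rpower (nu (S n)) (- a)).
Proof.
  intros Ha n. pose proof (Rpower_pos (nu n) (- a)).
  assert (Rpower (nu (S n)) (- a) <= Rpower (nu n) (- a)).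
  { apply Rpower_le_neg; auto. split; [apply nu_pos|apply nu_le; lia]. }
  split; lra.
Qed.

(** * Power series on the upper half plane *)

(** The growth condition equivalent to convergence of [sum c_n e(n z)] in the whole upper
    half plane; it is stable under multiplication by powers of [n]. *)
Definition subexp (c : nat -> C) : Prop :=
  forall eta, 0 < eta -> exists K, forall n, Cmod (c n) <= K * exp (eta * nu n).

Lemma Rpower_exp_bound p eta : 0 < p -> 0 < eta -> exists K, 0 < K /\
  forall z, 0 < z -> Rpower z p <= K * exp (eta * z).
Proof.
  intros Hp Heta. set (s := eta / p). assert (Hs : 0 < s) by (apply Rdiv_lt_0_compat; auto).
  exists (exp (p * (- ln s))). split; [apply exp_pos|]. intros z Hz.
  unfold Rpower. rewrite <- exp_plus. apply exp_le_mono.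
  assert (A : ln (s * z) <= s * z).
  { pose proof (exp_ineq1_le (ln (s * z))) as B.
    rewrite exp_ln in B by (apply Rmult_lt_0_compat; lra). lra. }
  rewrite ln_mult in A by lra.
  replace eta with (p * s) by (unfold s; field; lra). nra.
Qed.

Lemma nu_pow_exp p eta : 0 < eta -> exists K, 0 < K /\
  forall n, Rpower (nu n) p <= K * exp (eta * nu n).
Proof.
  intros Heta. pose proof (Rmax_r p 1) as H1.
  destruct (Rpower_exp_bound (Rmax p 1) eta) as [K [HK H]]; [lra|auto|].
  exists K. split; auto. intros n. pose proof (nu_ge1 n) as Hn.
  eapply Rle_trans; [|apply (H (nu n)); lra]. unfold Rpower. apply exp_le_mono.
  apply Rmult_le_compat_r; [|apply Rmax_l].
  rewrite <- ln_1. destruct (Rle_lt_or_eq_dec _ _ Hn) as [L|L].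
  - apply Rlt_le, ln_increasing; lra.
  - rewrite <- L; lra.
Qed.

Lemma subexp_mult c d K p : subexp c -> (forall n, Cmod (d n) <= K * Rpower (nu n) p) ->
  subexp (fun n => c n * d n)%C.
Proof.
  intros Hc Hd eta Heta. destruct (Hc (eta / 2)) as [K1 H1]; [lra|].
  destruct (nu_pow_exp p (eta / 2)) as [K2 [HK2 H2]]; [lra|].
  assert (HK : 0 <= K).
  { pose proof (Hd 0%nat). pose proof (Cmod_ge_0 (d 0%nat)). pose proof (Rpower_pos (nu 0) p). nra. }
  exists (K1 * (K * K2)). intros n. rewrite Cmod_mult.
  replace (eta * nu n) with (eta / 2 * nu n + eta / 2 * nu n) by field. rewrite exp_plus.
  replace (K1 * (K * K2) * (exp (eta / 2 * nu n) * exp (eta / 2 * nu n))) with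
    ((K1 * exp (eta / 2 * nu n)) * (K * (K2 * exp (eta / 2 * nu n)))) by ring.
  apply Rmult_le_compat; try apply Cmod_ge_0; auto.
  eapply Rle_trans; [apply Hd|]. apply Rmult_le_compat_l; auto.
Qed.

Definition ser_term (c : nat -> C) (x y : R) (n : nat) : C :=
  (c n * RtoC (exp (- (2 * PI * nu n * y))) * cis (nu n * x))%C.

Definition ser (c : nat -> C) (x y : R) : C := CSeries (ser_term c x y).

Lemma Cmod_ser_term c x y n :
  Cmod (ser_term c x y n) = Cmod (c n) * exp (- (2 * PI * nu n * y)).
Proof.
  unfold ser_term. rewrite !Cmod_mult, Cmod_cis, Cmod_R, Rabs_pos_eq.
  - ring.
  - apply Rlt_le, exp_pos.
Qed.

Lemma exp_pow a n : exp a ^ n = exp (INR n * a).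
Proof.
  induction n as [|n IH]; [simpl; rewrite Rmult_0_l, exp_0; ring|].
  simpl pow. rewrite IH, <- exp_plus. f_equal. rewrite S_INR. ring.
Qed.

(** Half of the decay of [exp (- 2 pi n y0)] absorbs the coefficients, the other half leaves a
    geometric series; the rate depends on [y0] alone, hence uniformity in [x] and [y >= y0]. *)
Lemma ser_rate c y0 : subexp c -> 0 < y0 -> exists e : nat -> R, is_lim_seq e 0 /\
  (forall x y n m, y0 <= y -> (n <= m)%nat ->
     Cmod (Csum (ser_term c x y) m - Csum (ser_term c x y) n)%C <= e n) /\
  (forall x y n, y0 <= y -> Cmod (ser c x y - Csum (ser_term c x y) n)%C <= e n).
Proof.
  intros Hc Hy0. pose proof PI_RGT_0 as HPI.
  destruct (Hc (PI * y0)) as [K HK]; [apply Rmult_lt_0_compat; auto|].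
  set (q := exp (- (PI * y0))).
  assert (Hq : 0 < q < 1).
  { split; [apply exp_pos|]. unfold q. rewrite <- exp_0. apply exp_increasing.
    assert (0 < PI * y0) by (apply Rmult_lt_0_compat; auto). lra. }
  assert (HK0 : 0 <= K).
  { pose proof (HK 0%nat). pose proof (Cmod_ge_0 (c 0%nat)).
    pose proof (exp_pos (PI * y0 * nu 0)). nra. }
  set (e := fun n => K * / (1 - q) * q ^ S n).
  assert (He : is_lim_seq e 0).
  { unfold e. replace (Finite 0) with (Rbar_mult (K * / (1 - q)) 0) by (simpl; f_equal; ring).
    apply is_lim_seq_scal_l. apply (is_lim_seq_incr_1 (fun n => q ^ n)).
    apply is_lim_seq_geom. rewrite Rabs_pos_eq; lra. }
  assert (H : forall x y n m, y0 <= y -> (n <= m)%nat ->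
     Cmod (Csum (ser_term c x y) m - Csum (ser_term c x y) n)%C <= e n).
  { intros x y n m Hy Hnm. apply Rle_trans with (e n - e m).
    - apply Csum_telescope; auto. intros k _. rewrite Cmod_ser_term.
      replace (e k - e (S k)) with (K * q ^ S k) by (unfold e; simpl; field; lra).
      unfold q. rewrite exp_pow. fold (nu k).
      apply Rle_trans with (K * exp (PI * y0 * nu k) * exp (- (2 * PI * nu k * y))).
      + apply Rmult_le_compat_r; [apply Rlt_le, exp_pos|auto].
      + rewrite Rmult_assoc. apply Rmult_le_compat_l; auto. rewrite <- exp_plus.
        apply exp_le_mono. pose proof (nu_pos k).
        assert (nu k * PI * y0 <= nu k * PI * y)
          by (apply Rmult_le_compat_l; [apply Rlt_le, Rmult_lt_0_compat; auto|auto]). nra.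
    - assert (0 <= e m); [|lra]. unfold e.
      assert (0 < / (1 - q)) by (apply Rinv_0_lt_compat; lra).
      apply Rmult_le_pos; [apply Rmult_le_pos; lra|apply pow_le; lra]. }
  exists e. repeat split; auto.
  intros x y n Hy. unfold ser. apply (CSeries_rate (ser_term c x y) e); auto.
Qed.

Lemma ccont_ser_term_x c y n x : ccont (fun x => ser_term c x y n) x.
Proof.
  unfold ser_term. apply ccont_mult; [apply ccont_const|apply ccont_cis_scal].
Qed.

Lemma ccont_ser_term_y c x n y : ccont (fun y => ser_term c x y n) y.
Proof.
  unfold ser_term. apply ccont_mult; [|apply ccont_const].
  apply ccont_mult; [apply ccont_const|]. apply ccont_real.
  apply (ex_derive_continuous (fun s => exp (- (2 * PI * nu n * s)))). auto_derive; auto.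
Qed.

Lemma ser_ccont_x c y x : subexp c -> 0 < y -> ccont (fun x => ser c x y) x.
Proof.
  intros Hc Hy. destruct (ser_rate c y Hc Hy) as [e [He [_ H]]].
  apply (ccont_uniform_limit _ (fun n x => Csum (ser_term c x y) n) e x (mkposreal 1 Rlt_0_1)); auto.
  - intros n t _. apply H. lra.
  - intros n t. apply (ccont_Csum (fun k x => ser_term c x y k)). intros; apply ccont_ser_term_x.
Qed.

Lemma ser_ccont_y c x y : subexp c -> 0 < y -> ccont (fun y => ser c x y) y.
Proof.
  intros Hc Hy. assert (Hy2 : 0 < y / 2) by lra.
  destruct (ser_rate c (y / 2) Hc Hy2) as [e [He [_ H]]].
  apply (ccont_uniform_limit _ (fun n y => Csum (ser_term c x y) n) e y (mkposreal _ Hy2)); auto.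
  - intros n t Ht. apply H. simpl in Ht. apply Rabs_def2 in Ht. lra.
  - intros n t. apply (ccont_Csum (fun k y => ser_term c x y k)). intros; apply ccont_ser_term_y.
Qed.

Definition deriv_coef (c : nat -> C) : nat -> C := fun n => (c n * (RtoC (2 * PI * nu n) * Ci))%C.

Lemma Cmod_Ci : Cmod Ci = 1.
Proof.
  unfold Cmod, Ci; simpl. replace (0 * (0 * 1) + 1 * (1 * 1)) with 1 by ring. apply sqrt_1.
Qed.

Lemma subexp_deriv c : subexp c -> subexp (deriv_coef c).
Proof.
  intros Hc. apply subexp_mult with (K := 2 * PI) (p := 1); auto. intros n.
  pose proof PI_RGT_0. pose proof (nu_pos n).
  rewrite Cmod_mult, Cmod_Ci, Cmod_R, Rpower_1, Rabs_pos_eq by nra. lra.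
Qed.

Lemma ser_cder_x c y x : subexp c -> 0 < y ->
  cder (fun x => ser c x y) x (ser (deriv_coef c) x y).
Proof.
  intros Hc Hy. destruct (ser_rate c y Hc Hy) as [e [He [_ H]]].
  destruct (ser_rate (deriv_coef c) y (subexp_deriv c Hc) Hy) as [e' [He' [_ H']]].
  assert (Hee : is_lim_seq (fun n => Rabs (e n) + Rabs (e' n)) 0).
  { replace (Finite 0) with (Finite (Rabs 0 + Rabs 0)) by (rewrite Rabs_R0; f_equal; ring).
    apply is_lim_seq_plus'; apply (is_lim_seq_abs _ (Finite 0)); auto. }
  apply (cder_uniform_limit (fun x => ser c x y) (fun x => ser (deriv_coef c) x y)
     (fun n x => Csum (ser_term c x y) n) (fun n x => Csum (ser_term (deriv_coef c) x y) n)
     (fun n => Rabs (e n) + Rabs (e' n)) x); auto.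
  - intros n t. eapply Rle_trans; [apply H; lra|].
    pose proof (Rle_abs (e n)). pose proof (Rabs_pos (e' n)). lra.
  - intros n t. eapply Rle_trans; [apply H'; lra|].
    pose proof (Rle_abs (e' n)). pose proof (Rabs_pos (e n)). lra.
  - intros n t. apply (cder_Csum (fun k x => ser_term c x y k) (fun k x => ser_term (deriv_coef c) x y k)).
    intros k _. unfold ser_term, deriv_coef.
    eapply cder_ext with (h := fun s => (c k * RtoC (exp (- (2 * PI * nu k * y))) * cis (nu k * s + 0))%C).
    { intros s. now rewrite Rplus_0_r. }
    replace (c k * (RtoC (2 * PI * nu k) * Ci) * RtoC (exp (- (2 * PI * nu k * y))) * cis (nu k * t))%C
     with (c k * RtoC (exp (- (2 * PI * nu k * y))) * (RtoC (2 * PI * nu k) * Ci * cis (nu k * t + 0)))%C.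
    2:{ rewrite Rplus_0_r. ring. }
    apply cder_scal. apply cder_cis.
Qed.

(** * Fourier coefficients *)

Lemma cis_IZR (k : Z) : cis (IZR k) = RtoC 1.
Proof.
  destruct (Z_le_gt_dec 0 k) as [H|H].
  - rewrite <- (Z2Nat.id k) by auto. rewrite <- INR_IZR_INZ. apply cis_INR.
  - replace (IZR k) with (- INR (Z.to_nat (- k))).
    + rewrite cis_opp, cis_INR. unfold Cconj, RtoC; simpl. f_equal; ring.
    + rewrite INR_IZR_INZ, Z2Nat.id by lia. rewrite opp_IZR. ring.
Qed.

Lemma CInt_cis (k : Z) b : k <> 0%Z -> CInt (fun t => cis (IZR k * t)) b (b + 1) = RtoC 0.
Proof.
  intros Hk. assert (Hk' : IZR k <> 0) by (apply not_0_IZR; auto).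
  pose proof PI_RGT_0 as HPI.
  assert (Hd : RtoC (2 * PI * IZR k) <> RtoC 0).
  { intros E. apply RtoC_inj in E. apply Rmult_integral in E. destruct E; [lra|auto]. }
  assert (Hi : Ci <> RtoC 0).
  { intros E. apply (f_equal snd) in E. simpl in E. lra. }
  set (c := (/ (RtoC (2 * PI * IZR k) * Ci))%C).
  rewrite (CInt_derive (fun t => c * cis (IZR k * t + 0))%C); [|lra| |].
  - rewrite !Rplus_0_r.
    replace (IZR k * (b + 1)) with (IZR k * b + IZR k) by ring.
    rewrite cis_plus, cis_IZR. ring.
  - intros t _.
    assert (E : cis (IZR k * t) = (c * (RtoC (2 * PI * IZR k) * Ci * cis (IZR k * t + 0)))%C).
    { rewrite Rplus_0_r. unfold c. field. split; auto. }
    rewrite E. apply cder_scal, cder_cis.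
  - intros t _. apply ccont_cis_scal.
Qed.

Lemma CInt_const (c : C) b : CInt (fun _ => c) b (b + 1) = c.
Proof.
  unfold CInt. rewrite !RInt_const. unfold scal; simpl. unfold mult; simpl.
  destruct c as [c1 c2]; unfold Re, Im; simpl. f_equal; ring.
Qed.

Lemma Csum_zero (u : nat -> C) n : (forall k, (k < n)%nat -> u k = RtoC 0) -> Csum u n = RtoC 0.
Proof.
  induction n as [|n IH]; intros H; simpl; [reflexivity|].
  rewrite IH, H; auto. ring.
Qed.

Lemma Csum_single (u : nat -> C) j n : (j < n)%nat ->
  (forall k, (k < n)%nat -> k <> j -> u k = RtoC 0) -> Csum u n = u j.
Proof.
  induction n as [|n IH]; intros Hj H; [lia|]. simpl.
  destruct (Nat.eq_dec j n) as [->|Hn].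
  - rewrite Csum_zero; [ring|]. intros; apply H; lia.
  - rewrite IH; [|lia|intros; apply H; lia]. rewrite (H n) by lia. ring.
Qed.

(** The index [n] stands for the frequency [n + 1].  Every unit interval is allowed because
    the estimates below centre the interval at the point under study. *)
Definition has_coef (h : R -> C) (c : nat -> C) : Prop :=
  forall n b, CInt (fun t => h t * cis (- nu n * t))%C b (b + 1) = c n.

(** Common core of the next two lemmas: multiplying by [e(l t)] and integrating may be done
    term by term, since the partial sums converge uniformly. *)
Lemma coef_limit (h : R -> C) (c : nat -> C) (e : nat -> R) (l : Z) b (v : C) :
  (forall t, ccont h t) -> is_lim_seq e 0 ->
  (forall n t, Cmod (h t - Csum (fun k => c k * cis (nu k * t)) n)%C <= e n) ->
  (exists N, forall n, (N <= n)%nat ->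
     Csum (fun k => c k * CInt (fun t => cis (IZR (Z.of_nat (S k) + l) * t)) b (b + 1))%C n = v) ->
  CInt (fun t => h t * cis (IZR l * t))%C b (b + 1) = v.
Proof.
  intros Hh He H [N Hv].
  assert (Hb : b <= b + 1) by lra.
  assert (K : Cmod (CInt (fun t => h t * cis (IZR l * t))%C b (b + 1) - v)%C <= 0).
  { apply le_of_le_lim0 with (1 := He). exists N. intros n Hn. rewrite Rplus_0_l.
    rewrite <- (Hv n Hn).
    set (S := fun t => Csum (fun k => c k * cis (nu k * t))%C n).
    assert (HS : forall t, ccont S t).
    { intros t. apply (ccont_Csum (fun k t => c k * cis (nu k * t))%C). intros k _.
      apply ccont_mult; [apply ccont_const|apply ccont_cis_scal]. }
    assert (E : Csum (fun k => c k * CInt (fun t => cis (IZR (Z.of_nat (Datatypes.S k) + l) * t)) b (b + 1))%C n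
       = CInt (fun t => S t * cis (IZR l * t))%C b (b + 1)).
    { transitivity (CInt (fun t => Csum (fun k => c k * cis (IZR (Z.of_nat (Datatypes.S k) + l) * t)) n)%C b (b + 1)).
      - rewrite (CInt_Csum (fun k t => c k * cis (IZR (Z.of_nat (Datatypes.S k) + l) * t))%C).
        + apply Csum_ext. intros k _. rewrite CInt_scal; auto. intros t _; apply ccont_cis_scal.
        + lra.
        + intros k _ t _. apply ccont_mult; [apply ccont_const|apply ccont_cis_scal].
      - apply CInt_ext; [lra|]. intros t _. unfold S. rewrite Cmult_comm, <- Csum_scal.
        apply Csum_ext. intros k _. rewrite plus_IZR, <- INR_IZR_INZ. fold (nu k).
        rewrite Rmult_plus_distr_r, cis_plus. ring. }
    rewrite E. rewrite <- CInt_minus; auto.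
    - replace (e n) with ((b + 1 - b) * e n) by ring. apply CInt_bound_const; [lra| |].
      + intros t _. apply ccont_minus; (apply ccont_mult; [auto|apply ccont_cis_scal]).
      + intros t _. replace (h t * cis (IZR l * t) - S t * cis (IZR l * t))%C with
          ((h t - S t) * cis (IZR l * t))%C by ring.
        rewrite Cmod_mult, Cmod_cis, Rmult_1_r. apply H.
    - intros t _. apply ccont_mult; [auto|apply ccont_cis_scal].
    - intros t _. apply ccont_mult; [auto|apply ccont_cis_scal]. }
  assert (K0 : Cmod (CInt (fun t => h t * cis (IZR l * t))%C b (b + 1) - v)%C = 0).
  { apply Rle_antisym; [auto|apply Cmod_ge_0]. }
  apply Cmod_eq_0 in K0.
  replace (CInt (fun t => h t * cis (IZR l * t))%C b (b + 1)) with
   ((CInt (fun t => h t * cis (IZR l * t))%C b (b + 1) - v) + v)%C by ring.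
  rewrite K0. ring.
Qed.

Lemma coef_of_series (h : R -> C) (c : nat -> C) (e : nat -> R) :
  (forall t, ccont h t) -> is_lim_seq e 0 ->
  (forall n t, Cmod (h t - Csum (fun k => c k * cis (nu k * t)) n)%C <= e n) ->
  has_coef h c.
Proof.
  intros Hh He H j b.
  replace (- nu j) with (IZR (- Z.of_nat (S j))) by (rewrite opp_IZR, <- INR_IZR_INZ; reflexivity).
  apply (coef_limit h c e); auto. exists (S j). intros n Hn.
  rewrite (Csum_single _ j); auto.
  - rewrite Z.add_opp_diag_r. rewrite (CInt_ext _ (fun _ => RtoC 1)).
    + rewrite CInt_const. ring.
    + lra.
    + intros. rewrite Rmult_0_l. apply cis_0.
  - intros k Hk Hkj. rewrite CInt_cis by lia. ring.
Qed.

Lemma coef_nonneg_freq (h : R -> C) (c : nat -> C) (e : nat -> R) (l : nat) b :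
  (forall t, ccont h t) -> is_lim_seq e 0 ->
  (forall n t, Cmod (h t - Csum (fun k => c k * cis (nu k * t)) n)%C <= e n) ->
  CInt (fun t => h t * cis (INR l * t))%C b (b + 1) = RtoC 0.
Proof.
  intros Hh He H. rewrite INR_IZR_INZ. apply (coef_limit h c e); auto.
  exists 0%nat. intros n _. apply Csum_zero. intros k _. rewrite CInt_cis by lia. ring.
Qed.

(** * Geometric kernels *)

(** Duplication reduces the claim to [0, pi/4], where [cos >= 1 / sqrt 2]. *)
Lemma sin_ge_half x : 0 <= x <= PI / 2 -> x / 2 <= sin x.
Proof.
  intros Hx. pose proof PI_RGT_0. replace x with (2 * (x / 2)) at 2 by field. rewrite sin_2a.
  assert (Hs : 0 < sqrt 2) by (apply sqrt_lt_R0; lra).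
  assert (Hc : forall y, 0 <= y <= PI / 4 -> / sqrt 2 <= cos y).
  { intros y Hy. replace (/ sqrt 2) with (cos (PI / 4)) by (rewrite cos_PI4; field; lra).
    apply cos_decr_1; lra. }
  assert (Hsin : x / 2 * / sqrt 2 <= sin (x / 2)).
  { destruct (MVT_gen sin 0 (x / 2) cos) as [c [Hcc E]].
    - intros y _. apply is_derive_Reals, derivable_pt_lim_sin.
    - intros y _. apply continuity_sin.
    - rewrite Rmin_left, Rmax_right in Hcc by lra.
      rewrite sin_0 in E. assert (sin (x / 2) = cos c * (x / 2)) by lra.
      rewrite H0. pose proof (Hc c). nra. }
  assert (H2 : / sqrt 2 * / sqrt 2 = / 2).
  { rewrite <- Rinv_mult. f_equal. apply sqrt_def; lra. }
  pose proof (Hc (x / 2)). assert (0 < / sqrt 2) by (apply Rinv_0_lt_compat; auto). 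
  assert (x / 2 * / sqrt 2 * / sqrt 2 <= sin (x / 2) * cos (x / 2)).
  { apply Rmult_le_compat; [apply Rmult_le_pos; lra|lra|auto|apply H0; lra]. }
  nra.
Qed.

Definition geo_const : R := exp (- (2 * PI)) / 2.

Lemma geo_const_pos : 0 < geo_const.
Proof. unfold geo_const. pose proof (exp_pos (- (2 * PI))). lra. Qed.

(** The point [q = e(t + i s)]; [s] may be negative, which places [q] outside the unit disc. *)
Definition qpt (s t : R) : C := (RtoC (exp (- (2 * PI * s))) * cis t)%C.

Lemma Cmod_qpt s t : Cmod (qpt s t) = exp (- (2 * PI * s)).
Proof.
  unfold qpt. rewrite Cmod_mult, Cmod_cis, Cmod_R, Rabs_pos_eq; [ring|apply Rlt_le, exp_pos].
Qed.

Lemma qpt_pow s t n : Cpow (qpt s t) n = (RtoC (exp (- (2 * PI * INR n * s))) * cis (INR n * t))%C.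
Proof.
  induction n as [|n IH].
  - simpl. rewrite Rmult_0_r, !Rmult_0_l, Ropp_0, exp_0, cis_0. ring.
  - rewrite Cpow_S, IH. unfold qpt. rewrite S_INR.
    replace (- (2 * PI * (INR n + 1) * s)) with (- (2 * PI * s) + - (2 * PI * INR n * s)) by ring.
    replace ((INR n + 1) * t) with (t + INR n * t) by ring.
    rewrite exp_plus, cis_plus, RtoC_mult. ring.
Qed.

(** The distance from [1] to [q] controls its radial and angular parts separately; each is
    linear in [s], resp. [t], with a constant uniform on the rectangle. *)
Lemma geo_lower s t : Rabs s <= 1 -> Rabs t <= 1 / 2 ->
  geo_const * (Rabs s + Rabs t) <= Cmod (RtoC 1 - qpt s t)%C.
Proof.
  intros Hs Ht. pose proof PI_RGT_0 as HPI. set (rho := exp (- (2 * PI * s))).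
  set (k := exp (- (2 * PI))).
  assert (Hk : 0 < k) by apply exp_pos.
  assert (Hk1 : k < 1) by (unfold k; rewrite <- exp_0; apply exp_increasing; lra).
  apply Rabs_le_between in Hs.
  assert (Hrho : k <= rho) by (apply exp_le_mono; nra).
  assert (HR : forall z, Rabs z <= Cmod (RtoC 1 - qpt s t)%C <-> z ^ 2 <=
      (1 - rho) ^ 2 + 4 * rho * sin (PI * t) ^ 2).
  { intros z.
    assert (E : Cmod (RtoC 1 - qpt s t)%C = sqrt ((1 - rho) ^ 2 + 4 * rho * sin (PI * t) ^ 2)).
    { unfold Cmod, qpt, cis; simpl. f_equal. fold rho.
      replace (2 * PI * t) with (2 * (PI * t)) by ring.
      rewrite cos_2a_sin, sin_2a.
      pose proof (sin2_cos2 (PI * t)) as Q. unfold Rsqr in Q.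
      assert (Q' : cos (PI * t) * cos (PI * t) = 1 - sin (PI * t) * sin (PI * t)) by lra.
      set (S := sin (PI * t)) in *. set (Cc := cos (PI * t)) in *.
      replace ((1 + - (rho * (1 - 2 * S * S) - 0 * (2 * S * Cc))) *
 ((1 + - (rho * (1 - 2 * S * S) - 0 * (2 * S * Cc))) * 1) +
 (0 + - (rho * (2 * S * Cc) + 0 * (1 - 2 * S * S))) *
 ((0 + - (rho * (2 * S * Cc) + 0 * (1 - 2 * S * S))) * 1)) with
      ((1 - rho * (1 - 2 * S * S)) ^ 2 + 4 * rho * rho * S * S * (Cc * Cc)) by ring.
      rewrite Q'. ring. }
    rewrite E. split; intros H.
    - rewrite <- (pow2_sqrt ((1 - rho) ^ 2 + 4 * rho * sin (PI * t) ^ 2)).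
      + rewrite <- (pow2_abs z). apply pow_incr. split; [apply Rabs_pos|auto].
      + pose proof (pow2_ge_0 (1 - rho)). pose proof (pow2_ge_0 (sin (PI * t))). nra.
    - rewrite <- sqrt_Rsqr_abs. apply sqrt_le_1_alt. unfold Rsqr. nra. }
  assert (A1 : Rabs (k * s) <= Cmod (RtoC 1 - qpt s t)%C).
  { apply HR. assert ((k * s) ^ 2 <= (1 - rho) ^ 2).
    { assert (Habs : Rabs (k * s) <= Rabs (1 - rho)).
      { pose proof PI2_3_2. rewrite Rabs_mult, (Rabs_pos_eq k) by lra.
        destruct (Rle_dec 0 s) as [H0|H0].
        - rewrite (Rabs_pos_eq s) by auto.
          assert (rho * (1 + 2 * PI * s) <= 1).
          { pose proof (exp_ineq1_le (2 * PI * s)).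
            assert (rho * exp (2 * PI * s) = 1)
             by (unfold rho; rewrite <- exp_plus, Rplus_opp_l; apply exp_0).
            assert (0 < rho) by apply exp_pos. nra. }
          assert (0 <= PI * s) by nra.
          assert (s <= 2 * PI * s) by nra.
          assert (k * s <= rho * (2 * PI * s)) by (apply Rmult_le_compat; lra).
          assert (0 <= k * s) by (apply Rmult_le_pos; lra).
          rewrite Rabs_pos_eq; lra.
        - rewrite (Rabs_left s) by lra.
          assert (1 + - (2 * PI * s) <= rho) by apply exp_ineq1_le.
          assert (PI * s <= 1 * s) by nra.
          rewrite Rabs_left1 by nra. nra. }
      rewrite <- (pow2_abs (k * s)), <- (pow2_abs (1 - rho)). apply pow_incr.
      split; [apply Rabs_pos|auto]. }
    pose proof (pow2_ge_0 (sin (PI * t))). nra. }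
  assert (A2 : Rabs (k * t) <= Cmod (RtoC 1 - qpt s t)%C).
  { apply HR.
    assert (St : t ^ 2 <= 4 * sin (PI * t) ^ 2).
    { assert (K : Rabs t <= 2 * Rabs (sin (PI * t))).
      { pose proof PI2_3_2. apply Rabs_le_between in Ht.
        assert (P : forall u, 0 <= u <= 1 / 2 -> u <= 2 * sin (PI * u)).
        { intros u Hu. pose proof (sin_ge_half (PI * u)). nra. }
        destruct (Rle_dec 0 t) as [H0|H0].
        - pose proof (P t ltac:(lra)). rewrite !Rabs_pos_eq; lra.
        - pose proof (P (- t) ltac:(lra)) as P1.
          replace (PI * - t) with (- (PI * t)) in P1 by ring. rewrite sin_neg in P1.
          rewrite (Rabs_left t), Rabs_left1; lra. }
      rewrite <- (pow2_abs t). rewrite <- (pow2_abs (sin (PI * t))).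
      pose proof (Rabs_pos t). nra. }
    pose proof (pow2_ge_0 (1 - rho)). pose proof (pow2_ge_0 (sin (PI * t))). pose proof (pow2_ge_0 t).
    assert (k * k * t ^ 2 <= rho * (4 * sin (PI * t) ^ 2)).
    { apply Rmult_le_compat; nra. }
    nra. }
  rewrite Rabs_mult, (Rabs_pos_eq k) in A1, A2 by lra.
  unfold geo_const. fold k. lra.
Qed.

(** Sequences annihilated by the [(m+1)]-st difference operator; multiplying their
    generating function by [1 - q] lowers [m] by one. *)
Fixpoint poly_seq (m : nat) (p : nat -> R) : Prop :=
  match m with
  | O => forall n, p (S n) = p n
  | S m => poly_seq m (fun n => p (S n) - p n)
  end.

Lemma poly_seq_ext m : forall p p', (forall n, p n = p' n) -> poly_seq m p -> poly_seq m p'.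
Proof.
  induction m as [|m IH]; simpl; intros p p' E H.
  - intros n. now rewrite <- !E.
  - apply (IH (fun n => p (S n) - p n)); auto. intros n. now rewrite <- !E.
Qed.

Lemma poly_seq_plus m : forall p p', poly_seq m p -> poly_seq m p' -> poly_seq m (fun n => p n + p' n).
Proof.
  induction m as [|m IH]; simpl; intros p p' H H'.
  - intros n. now rewrite H, H'.
  - eapply poly_seq_ext; [|apply (IH _ _ H H')]. intros; simpl; ring.
Qed.

Lemma poly_seq_shift m : forall p, poly_seq m p -> poly_seq m (fun n => p (S n)).
Proof.
  induction m as [|m IH]; simpl; intros p H; [auto|]. apply (IH _ H).
Qed.

Lemma poly_seq_mult m : forall p, poly_seq m p -> poly_seq (S m) (fun n => nu n * p n).
Proof.
  induction m as [|m IH]; intros p H.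
  - simpl in *. intros n. rewrite !H, !nu_S. ring.
  - change (poly_seq (S m) (fun n => nu (S n) * p (S n) - nu n * p n)).
    apply poly_seq_ext with (p := fun n => nu n * (p (S n) - p n) + p (S n)).
    + intros n. rewrite nu_S. ring.
    + apply poly_seq_plus; [apply IH; exact H|apply poly_seq_shift, H].
Qed.

Lemma poly_seq_pow m : poly_seq m (fun n => nu n ^ m).
Proof.
  induction m as [|m IH]; [simpl; auto|]. apply (poly_seq_mult m _ IH).
Qed.

Lemma poly_seq_growth m : forall p, poly_seq m p ->
  exists K, 0 <= K /\ forall n, Rabs (p n) <= K * nu n ^ m.
Proof.
  induction m as [|m IH]; intros p H.
  - exists (Rabs (p 0%nat)). split; [apply Rabs_pos|]. induction n as [|n IHn]; [simpl; lra|].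
    simpl in *. now rewrite H.
  - destruct (IH _ H) as [K [HK Hd]]. exists (Rabs (p 0%nat) + K). split.
    { pose proof (Rabs_pos (p 0%nat)). lra. }
    assert (Q : forall n, Rabs (p n) <= Rabs (p 0%nat) + INR n * (K * nu n ^ m)).
    { induction n as [|n IHn]; [simpl; lra|].
      replace (p (S n)) with ((p (S n) - p n) + p n) by ring.
      eapply Rle_trans; [apply Rabs_triang|]. pose proof (Hd n). rewrite (S_INR n).
      assert (nu n ^ m <= nu (S n) ^ m).
      { apply pow_incr. split; [apply Rlt_le, nu_pos|apply nu_le; lia]. }
      assert (K * nu n ^ m <= K * nu (S n) ^ m) by (apply Rmult_le_compat_l; auto).
      pose proof (pos_INR n).
      assert (INR n * (K * nu n ^ m) <= INR n * (K * nu (S n) ^ m)) by (apply Rmult_le_compat_l; auto).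
      lra. }
    intros n. eapply Rle_trans; [apply Q|]. pose proof (nu_ge1 n) as Hn.
    assert (1 <= nu n ^ S m) by (apply pow_R1_Rle; auto).
    assert (INR n * nu n ^ m <= nu n ^ S m).
    { simpl. apply Rmult_le_compat_r; [apply pow_le; lra|]. unfold nu. apply le_INR. lia. }
    pose proof (Rabs_pos (p 0%nat)). nra.
Qed.

Lemma poly_kernel_id (p : nat -> R) (q : C) N :
  ((RtoC 1 - q) * Csum (fun n => RtoC (p n) * Cpow q (S n)) N =
   q * (RtoC (p 0%nat) + Csum (fun n => RtoC (p (S n) - p n) * Cpow q (S n)) N
        - RtoC (p N) * Cpow q N))%C.
Proof.
  induction N as [|N IH]; [simpl; ring|].
  cbn [Csum]. rewrite Cmult_plus_distr_l, IH. rewrite RtoC_minus, !Cpow_S. ring.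
Qed.

(** By induction on [m], since [1 - q] times the sum for [p] is, up to boundary terms, the sum
    for the differences of [p].  The truncation contributes the term with [|q|^N], negligible for large [N]. *)
Lemma poly_kernel m : forall p, poly_seq m p -> exists K, 0 <= K /\ forall q N, Cmod q <= 1 ->
  Cmod (Csum (fun n => RtoC (p n) * Cpow q (S n))%C N) * Cmod (RtoC 1 - q)%C ^ S m <=
  K * Cmod q * (1 + nu N ^ m * Cmod q ^ N).
Proof.
  assert (Hstep : forall p q N, Cmod (Csum (fun n => RtoC (p n) * Cpow q (S n))%C N) * Cmod (RtoC 1 - q)%C
     <= Cmod q * (Rabs (p 0%nat) + Cmod (Csum (fun n => RtoC (p (S n) - p n) * Cpow q (S n))%C N)
          + Rabs (p N) * Cmod q ^ N)).
  { intros p q N. rewrite <- Cmod_mult, Cmult_comm, poly_kernel_id, Cmod_mult.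
    apply Rmult_le_compat_l; [apply Cmod_ge_0|].
    unfold Cminus. eapply Rle_trans; [apply Cmod_triangle|].
    rewrite Cmod_opp, Cmod_mult, Cmod_pow, Cmod_R. apply Rplus_le_compat_r.
    eapply Rle_trans; [apply Cmod_triangle|]. rewrite Cmod_R. apply Rle_refl. }
  assert (H2 : forall q, Cmod q <= 1 -> 0 <= Cmod (RtoC 1 - q)%C <= 2).
  { intros q Hq. split; [apply Cmod_ge_0|]. unfold Cminus.
    eapply Rle_trans; [apply Cmod_triangle|]. rewrite Cmod_1, Cmod_opp. lra. }
  induction m as [|m IH]; intros p H.
  - exists (Rabs (p 0%nat)). split; [apply Rabs_pos|]. intros q N Hq.
    rewrite pow_1. eapply Rle_trans; [apply Hstep|].
    rewrite (Csum_zero (fun n => RtoC (p (S n) - p n) * Cpow q (S n))%C).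
    + rewrite Cmod_0. assert (E : p N = p 0%nat) by (induction N; [auto|rewrite H; auto]).
      rewrite E. simpl. right; ring.
    + intros k _. rewrite H, Rminus_diag. ring.
  - destruct (IH _ H) as [K [HK Hd]]. destruct (poly_seq_growth _ _ H) as [L0 [HL0 _]].
    destruct (poly_seq_growth _ _ (H : poly_seq (S m) p)) as [L [HL Hg]].
    exists ((Rabs (p 0%nat) + L) * 2 ^ S m + K). split.
    { apply Rplus_le_le_0_compat; auto. apply Rmult_le_pos; [|apply pow_le; lra].
      pose proof (Rabs_pos (p 0%nat)); lra. }
    intros q N Hq. pose proof (H2 q Hq) as Hq2. specialize (Hd q N Hq). pose proof (Hstep p q N) as Hs.
    set (T := Cmod (Csum (fun n => RtoC (p n) * Cpow q (S n))%C N)) in *.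
    set (T' := Cmod (Csum (fun n => RtoC (p (S n) - p n) * Cpow q (S n))%C N)) in *.
    set (w := Cmod (RtoC 1 - q)%C) in *.
    replace (T * w ^ S (S m)) with ((T * w) * w ^ S m) by (simpl; ring).
    assert (Hw : 0 <= w ^ S m <= 2 ^ S m) by (split; [apply pow_le|apply pow_incr]; lra).
    eapply Rle_trans; [apply Rmult_le_compat_r; [apply Hw|apply Hs]|].
    pose proof (Cmod_ge_0 q) as Hq0. assert (HqN : 0 <= Cmod q ^ N) by (apply pow_le; auto).
    pose proof (nu_ge1 N) as HN. assert (HN1 : 1 <= nu N ^ m) by (apply pow_R1_Rle; auto).
    assert (HN2 : nu N ^ m <= nu N ^ S m) by (simpl; nra).
    replace (Cmod q * (Rabs (p 0%nat) + T' + Rabs (p N) * Cmod q ^ N) * w ^ S m) with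
     (Cmod q * (Rabs (p 0%nat) * w ^ S m + T' * w ^ S m + Rabs (p N) * Cmod q ^ N * w ^ S m)) by ring.
    rewrite (Rmult_comm (_ + K)), (Rmult_assoc (Cmod q) (_ + K)). apply Rmult_le_compat_l; auto.
    set (B := 1 + nu N ^ S m * Cmod q ^ N).
    assert (HB : 1 <= B) by (unfold B; nra).
    assert (E1 : Rabs (p 0%nat) * w ^ S m <= Rabs (p 0%nat) * 2 ^ S m * B).
    { pose proof (Rabs_pos (p 0%nat)). rewrite Rmult_assoc. apply Rmult_le_compat_l; auto. nra. }
    assert (E2 : T' * w ^ S m <= K * B).
    { eapply Rle_trans; [apply Hd|].
      apply Rle_trans with (K * (1 + nu N ^ m * Cmod q ^ N)).
      - apply Rmult_le_compat_r; nra.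
      - apply Rmult_le_compat_l; auto. unfold B. nra. }
    assert (E3 : Rabs (p N) * Cmod q ^ N * w ^ S m <= L * 2 ^ S m * B).
    { apply Rle_trans with (L * nu N ^ S m * Cmod q ^ N * 2 ^ S m).
      - apply Rmult_le_compat; [apply Rmult_le_pos; [apply Rabs_pos|auto]|apply Hw| |apply Hw].
        apply Rmult_le_compat_r; auto.
      - replace (L * nu N ^ S m * Cmod q ^ N * 2 ^ S m) with
          (L * 2 ^ S m * (nu N ^ S m * Cmod q ^ N)) by ring.
        apply Rmult_le_compat_l; [apply Rmult_le_pos; lra|]. unfold B. lra. }
    replace (((Rabs (p 0%nat) + L) * 2 ^ S m + K) * B) with
      (Rabs (p 0%nat) * 2 ^ S m * B + K * B + L * 2 ^ S m * B) by ring.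
    lra.
Qed.

(** The terms of the [m]-th derivative of the geometric series, up to [(2 pi i)^m]. *)
Definition kernel (m : nat) (y t : R) (n : nat) : C :=
  (RtoC (nu n ^ m) * (RtoC (exp (- (2 * PI * nu n * y))) * cis (nu n * t)))%C.

Lemma kernel_qpt m y t N :
  Csum (kernel m y t) N = Csum (fun n => RtoC (nu n ^ m) * Cpow (qpt y t) (S n))%C N.
Proof. apply Csum_ext. intros k _. unfold kernel. now rewrite qpt_pow. Qed.

Lemma exp_m2PI_small : exp (- (2 * PI)) <= / 2.
Proof.
  pose proof PI2_3_2. apply Rle_trans with (exp (- (1))); [apply exp_le_mono; lra|].
  rewrite exp_Ropp. apply Rinv_le_contravar; [lra|]. pose proof (exp_ineq1_le 1). lra.
Qed.

Lemma nu_pow_qpt_small m y0 : 0 < y0 -> exists N0, forall N, (N0 <= N)%nat ->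
  nu N ^ m * exp (- (2 * PI * y0)) ^ N <= 1.
Proof.
  intros Hy0. pose proof PI_RGT_0 as HPI.
  assert (Hp : 0 < 2 * PI * y0) by (apply Rmult_lt_0_compat; lra).
  destruct (nu_pow_exp (INR (S m)) (2 * PI * y0) Hp) as [K [HK H]].
  destruct (lim0_ev (fun n => / nu n) (/ (K * exp (2 * PI * y0))) lim_inv_INR) as [N0 HN0].
  { apply Rinv_0_lt_compat, Rmult_lt_0_compat; [auto|apply exp_pos]. }
  exists N0. intros N HN. specialize (HN0 N HN). simpl in HN0. specialize (H N).
  pose proof (nu_pos N) as Hn.
  rewrite Rabs_pos_eq in HN0 by (apply Rlt_le, Rinv_0_lt_compat; auto).
  rewrite Rpower_pow in H by auto. rewrite exp_pow.
  replace (INR N * - (2 * PI * y0)) with (- (2 * PI * y0 * nu N) + 2 * PI * y0)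
    by (unfold nu; rewrite S_INR; ring).
  rewrite exp_plus, exp_Ropp.
  assert (He : 0 < exp (2 * PI * y0 * nu N)) by apply exp_pos.
  assert (He2 : 0 < exp (2 * PI * y0)) by apply exp_pos.
  assert (HKn : K * exp (2 * PI * y0) <= nu N).
  { rewrite <- (Rinv_inv (nu N)), <- (Rinv_inv (K * exp (2 * PI * y0))).
    apply Rlt_le, Rinv_lt_contravar; [|auto].
    apply Rmult_lt_0_compat; apply Rinv_0_lt_compat; auto. apply Rmult_lt_0_compat; auto. }
  apply Rmult_le_reg_r with (nu N * exp (2 * PI * y0 * nu N)); [apply Rmult_lt_0_compat; auto|].
  replace (nu N ^ m * (/ exp (2 * PI * y0 * nu N) * exp (2 * PI * y0)) *
    (nu N * exp (2 * PI * y0 * nu N))) with (nu N ^ S m * exp (2 * PI * y0)).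
  2:{ simpl. field. lra. }
  apply Rle_trans with (K * exp (2 * PI * y0 * nu N) * exp (2 * PI * y0)).
  - apply Rmult_le_compat_r; lra.
  - nra.
Qed.

(** Truncations of the kernel [sum n^m e(n z)] obey the bound of its closed form
    [O(|z|^(-m-1))], uniformly above any fixed height. *)
Lemma kernel_bound m : exists K, 0 < K /\ forall y0, 0 < y0 -> exists N0, forall N, (N0 <= N)%nat ->
  forall y t, y0 <= y -> Rabs t <= 1 / 2 ->
  Cmod (Csum (kernel m y t) N) <= K * Rpower (y + Rabs t) (- INR (S m)).
Proof.
  pose proof PI_RGT_0 as HPI.
  destruct (poly_kernel m _ (poly_seq_pow m)) as [K0 [HK0 H]].
  assert (Hm : 0 < INR (S m)) by (apply lt_0_INR; lia).
  destruct (Rpower_exp_bound (INR (S m)) PI Hm HPI) as [K1 [HK1 H1]].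
  pose proof geo_const_pos as Hg.
  set (Ka := 2 * K0 * / geo_const ^ S m).
  set (Kb := 2 * K0 * 2 ^ S m * K1 * exp PI).
  assert (HKa : 0 <= Ka).
  { unfold Ka. apply Rmult_le_pos; [lra|]. apply Rlt_le, Rinv_0_lt_compat, pow_lt, Hg. }
  assert (HKb : 0 <= Kb).
  { unfold Kb. repeat apply Rmult_le_pos; try lra; [apply pow_le; lra|apply Rlt_le, exp_pos]. }
  exists (Ka + Kb + 1). split; [lra|]. intros y0 Hy0.
  destruct (nu_pow_qpt_small m y0 Hy0) as [N0 HN0]. exists N0. intros N HN y t Hy Ht.
  specialize (HN0 N HN).
  assert (Hq : Cmod (qpt y t) <= 1).
  { rewrite Cmod_qpt, <- exp_0. apply exp_le_mono. nra. }
  specialize (H (qpt y t) N Hq). rewrite <- kernel_qpt in H.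
  assert (HqN : nu N ^ m * Cmod (qpt y t) ^ N <= 1).
  { eapply Rle_trans; [|apply HN0]. apply Rmult_le_compat_l; [apply pow_le, Rlt_le, nu_pos|].
    apply pow_incr. split; [apply Cmod_ge_0|]. rewrite Cmod_qpt. apply exp_le_mono. nra. }
  set (T := Cmod (Csum (kernel m y t) N)) in *.
  set (w := Cmod (RtoC 1 - qpt y t)%C) in *.
  assert (HT : T * w ^ S m <= 2 * K0 * Cmod (qpt y t)).
  { eapply Rle_trans; [apply H|]. pose proof (Cmod_ge_0 (qpt y t)).
    assert (0 <= K0 * Cmod (qpt y t)) by (apply Rmult_le_pos; auto). nra. }
  assert (HT0 : 0 <= T) by apply Cmod_ge_0.
  pose proof (Rabs_pos t) as Ht0.
  assert (Hyt : 0 < y + Rabs t) by lra.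
  rewrite Rpower_Ropp, Rpower_pow by auto.
  assert (Hpw : 0 < (y + Rabs t) ^ S m) by (apply pow_lt; auto).
  apply Rmult_le_reg_r with ((y + Rabs t) ^ S m); auto.
  rewrite Rmult_assoc, Rinv_l, Rmult_1_r by lra.
  destruct (Rle_dec y 1) as [Hy1|Hy1].
  - assert (Hw : geo_const * (y + Rabs t) <= w).
    { rewrite <- (Rabs_pos_eq y) at 1 by lra. apply geo_lower; auto. rewrite Rabs_pos_eq; lra. }
    assert (Hw2 : geo_const ^ S m * (y + Rabs t) ^ S m <= w ^ S m).
    { rewrite <- Rpow_mult_distr. apply pow_incr. split; auto. apply Rmult_le_pos; lra. }
    assert (Hgm : 0 < geo_const ^ S m) by (apply pow_lt; auto).
    apply Rle_trans with Ka; [|lra].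
    apply Rmult_le_reg_l with (geo_const ^ S m); auto.
    replace (geo_const ^ S m * Ka) with (2 * K0) by (unfold Ka; field; apply pow_nonzero; lra).
    apply Rle_trans with (T * w ^ S m).
    + replace (geo_const ^ S m * (T * (y + Rabs t) ^ S m)) with
        (T * (geo_const ^ S m * (y + Rabs t) ^ S m)) by ring.
      apply Rmult_le_compat_l; auto.
    + eapply Rle_trans; [apply HT|]. nra.
  - assert (Hw : / 2 <= w).
    { unfold w. eapply Rle_trans; [|apply Cmod_ge_minus]. rewrite Cmod_1, Cmod_qpt.
      pose proof exp_m2PI_small.
      assert (exp (- (2 * PI * y)) <= exp (- (2 * PI))) by (apply exp_le_mono; nra). lra. }
    assert (Hw2 : / 2 ^ S m <= w ^ S m).
    { rewrite <- pow_inv. apply pow_incr. lra. }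
    assert (H2m : 0 < 2 ^ S m) by (apply pow_lt; lra).
    assert (HT2 : T <= 2 ^ S m * (2 * K0 * Cmod (qpt y t))).
    { apply Rmult_le_reg_l with (/ 2 ^ S m); [apply Rinv_0_lt_compat; auto|].
      rewrite <- Rmult_assoc, Rinv_l, Rmult_1_l by lra.
      eapply Rle_trans; [|apply HT]. rewrite Rmult_comm. apply Rmult_le_compat_l; auto. }
    apply Rle_trans with Kb; [|lra].
    specialize (H1 (y + Rabs t) Hyt). rewrite Rpower_pow in H1 by auto.
    apply Rle_trans with (2 ^ S m * (2 * K0 * Cmod (qpt y t)) * (K1 * exp (PI * (y + Rabs t)))).
    { apply Rmult_le_compat; auto. lra. }
    rewrite Cmod_qpt.
    replace (2 ^ S m * (2 * K0 * exp (- (2 * PI * y))) * (K1 * exp (PI * (y + Rabs t)))) with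
     (2 * K0 * 2 ^ S m * K1 * (exp (- (2 * PI * y)) * exp (PI * (y + Rabs t)))) by ring.
    unfold Kb. apply Rmult_le_compat_l.
    { repeat apply Rmult_le_pos; try lra; try apply pow_le; lra. }
    rewrite <- exp_plus. apply exp_le_mono. nra.
Qed.

(** * Integrals of powers *)

Lemma is_derive_Rpower x p : 0 < x -> is_derive (fun x => Rpower x p) x (p * Rpower x (p - 1)).
Proof. intros H. apply is_derive_Reals. now apply derivable_pt_lim_power. Qed.

Lemma continuous_Rpower x p : 0 < x -> continuous (fun x => Rpower x p) x.
Proof.
  intros H. apply (ex_derive_continuous (fun x => Rpower x p)). eexists. now apply is_derive_Rpower.
Qed.

Lemma is_RInt_Rpower a b y p : 0 < y + a -> a <= b -> p <> 0 ->
  is_RInt (fun t => Rpower (y + t) (p - 1)) a b ((Rpower (y + b) p - Rpower (y + a) p) / p).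
Proof.
  intros Ha Hab Hp.
  replace ((Rpower (y + b) p - Rpower (y + a) p) / p) with
    (minus (Rpower (y + b) p / p) (Rpower (y + a) p / p)).
  2:{ unfold minus, plus, opp; simpl. field. auto. }
  apply (is_RInt_derive (fun t => Rpower (y + t) p / p)).
  - intros x Hx. rewrite Rmin_left, Rmax_right in Hx by auto.
    apply is_derive_eq with (l := / p * (1 * (p * Rpower (y + x) (p - 1)))).
    + apply is_derive_ext with (f := fun t => / p * Rpower (y + t) p).
      { intros t. unfold Rdiv. apply Rmult_comm. }
      apply (is_derive_scal (fun t => Rpower (y + t) p)).
      apply (is_derive_comp (fun t => Rpower t p) (fun t => y + t)).
      * apply is_derive_Rpower. lra.
      * auto_derive; auto.
    + field. auto.
  - intros x Hx. rewrite Rmin_left, Rmax_right in Hx by auto.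
    apply (continuous_comp (fun t => y + t) (fun t => Rpower t (p - 1))).
    + apply (ex_derive_continuous (fun t => y + t)). auto_derive; auto.
    + apply continuous_Rpower. lra.
Qed.

Lemma is_RInt_Rpower_abs x y p : 0 < y -> p <> 0 ->
  is_RInt (fun t => Rpower (y + Rabs (t - x)) (p - 1)) (x - 1 / 2) (x + 1 / 2)
    (2 * ((Rpower (y + 1 / 2) p - Rpower y p) / p)).
Proof.
  intros Hy Hp. set (v := (Rpower (y + 1 / 2) p - Rpower y p) / p).
  replace (2 * v) with (plus v v) by (unfold plus; simpl; ring).
  refine (is_RInt_Chasles (V := R_NormedModule) (fun t => Rpower (y + Rabs (t - x)) (p - 1))
    (x - 1 / 2) x (x + 1 / 2) v v _ _).
  - apply is_RInt_ext with (f := fun t => Rpower (y + (x - t)) (p - 1)).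
    { intros t Ht. rewrite Rmin_left, Rmax_right in Ht by lra. rewrite Rabs_left by lra.
      f_equal; ring. }
    replace v with (minus (- (Rpower (y + (x - x)) p / p)) (- (Rpower (y + (x - (x - 1 / 2))) p / p))).
    2:{ unfold v, minus, plus, opp; simpl. replace (y + (x - x)) with y by ring.
        replace (y + (x - (x - 1 / 2))) with (y + 1 / 2) by ring. field. auto. }
    apply (is_RInt_derive (fun t => - (Rpower (y + (x - t)) p / p))).
    + intros t Ht. rewrite Rmin_left, Rmax_right in Ht by lra.
      apply is_derive_eq with (l := - / p * (-1 * (p * Rpower (y + (x - t)) (p - 1)))).
      * apply is_derive_ext with (f := fun t => - / p * Rpower (y + (x - t)) p).
        { intros s. unfold Rdiv. change (- / p * Rpower (y + (x - s)) p = - (Rpower (y + (x - s)) p * / p)). ring. }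
        apply (is_derive_scal (fun t => Rpower (y + (x - t)) p)).
        apply (is_derive_comp (fun t => Rpower t p) (fun t => y + (x - t))).
        -- apply is_derive_Rpower. lra.
        -- auto_derive; auto.
      * field. auto.
    + intros t Ht. rewrite Rmin_left, Rmax_right in Ht by lra.
      apply (continuous_comp (fun t => y + (x - t)) (fun t => Rpower t (p - 1))).
      * apply (ex_derive_continuous (fun t => y + (x - t))). auto_derive; auto.
      * apply continuous_Rpower. lra.
  - apply is_RInt_ext with (f := fun t => Rpower (y - x + t) (p - 1)).
    { intros t Ht. rewrite Rmin_left, Rmax_right in Ht by lra. rewrite Rabs_pos_eq by lra.
      f_equal; ring. }
    replace v with ((Rpower (y - x + (x + 1 / 2)) p - Rpower (y - x + x) p) / p).
    2:{ unfold v. do 3 f_equal; ring_simplify; auto. }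
    apply is_RInt_Rpower; lra.
Qed.

(** * Derivatives of Fourier series bounded by boundary values *)

(** The sum is the convolution of [h] with the truncated kernel, and the integral of
    [(y + |t|)^s (y + |t|)^(-m-1)] is [O(y^(s-m))].  Working with truncations avoids any
    exchange of sum and integral.  It is applied both to boundary functions and to the
    restriction of the form to a horizontal line. *)
Lemma fourier_bound m s : s < INR m -> exists K, 0 < K /\
  forall y0, 0 < y0 -> exists N0, forall N, (N0 <= N)%nat ->
  forall y x h c M, y0 <= y -> (forall t, ccont h t) -> has_coef h c -> 0 <= M ->
  (forall t, Rabs t <= 1 / 2 -> Cmod (h (x + t)) <= M * Rpower (y + Rabs t) s) ->
  Cmod (Csum (fun n => RtoC (nu n ^ m) * ser_term c x y n)%C N) <= K * M * Rpower y (s - INR m).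
Proof.
  intros Hs. destruct (kernel_bound m) as [K [HK H]].
  set (p := s - INR m). assert (Hp : p < 0) by (unfold p; lra).
  assert (Hip : 0 < / (- p)) by (apply Rinv_0_lt_compat; lra).
  exists (K * 2 * / (- p)). split; [apply Rmult_lt_0_compat; [lra|auto]|].
  intros y0 Hy0. destruct (H y0 Hy0) as [N0 HN0]. exists N0.
  intros N HN y x h c M Hy Hh Hc HM Hb. assert (Hy' : 0 < y) by lra.
  set (g := fun t => (h t * Csum (kernel m y (x - t)) N)%C).
  assert (Hk : forall n t, ccont (fun t => kernel m y (x - t) n) t).
  { intros n t. unfold kernel. apply ccont_mult; [apply ccont_const|].
    apply ccont_mult; [apply ccont_const|].
    eapply ccont_ext; [|apply (ccont_cis (- nu n) (nu n * x))].
    intros u; simpl. f_equal. ring. }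
  assert (Hg : forall t, ccont g t).
  { intros t. unfold g. apply ccont_mult; [apply Hh|].
    apply (ccont_Csum (fun n t => kernel m y (x - t) n)). intros; apply Hk. }
  assert (E : Csum (fun n => RtoC (nu n ^ m) * ser_term c x y n)%C N =
     CInt g (x - 1 / 2) (x + 1 / 2)).
  { transitivity (CInt (fun t => Csum (fun n => (RtoC (nu n ^ m) * RtoC (exp (- (2 * PI * nu n * y)))
       * cis (nu n * x)) * (h t * cis (- nu n * t)))%C N) (x - 1 / 2) (x + 1 / 2)).
    - rewrite (CInt_Csum (fun n t => (RtoC (nu n ^ m) * RtoC (exp (- (2 * PI * nu n * y)))
       * cis (nu n * x)) * (h t * cis (- nu n * t)))%C); [|lra|].
      + apply Csum_ext. intros n _. rewrite CInt_scal; [|lra|].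
        * replace (x + 1 / 2) with (x - 1 / 2 + 1) by field. rewrite Hc.
          unfold ser_term. ring.
        * intros t _. apply ccont_mult; [apply Hh|apply ccont_cis_scal].
      + intros n _ t _. apply ccont_mult; [apply ccont_const|].
        apply ccont_mult; [apply Hh|apply ccont_cis_scal].
    - apply CInt_ext; [lra|]. intros t _. unfold g. rewrite <- Csum_scal. apply Csum_ext.
      intros n _. unfold kernel.
      replace (nu n * (x - t)) with (nu n * x + - nu n * t) by ring. rewrite cis_plus. ring. }
  rewrite E.
  assert (Hpn : p <> 0) by lra.
  pose proof (is_RInt_Rpower_abs x y p Hy' Hpn) as HI.
  eapply Rle_trans; [apply CInt_bound with
    (g := fun t => (M * K) * Rpower (y + Rabs (t - x)) (p - 1))|].
  - lra.
  - intros t _; apply Hg.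
  - apply (ex_RInt_scal (fun t => Rpower (y + Rabs (t - x)) (p - 1))). eexists; apply HI.
  - intros t Ht. unfold g. rewrite Cmod_mult.
    assert (Hxt : Rabs (t - x) <= 1 / 2) by (apply Rabs_le; lra).
    specialize (Hb (t - x) Hxt). replace (x + (t - x)) with t in Hb by ring.
    pose proof (HN0 N HN y (x - t) Hy) as HN1. rewrite (Rabs_minus_sym x t) in HN1.
    specialize (HN1 Hxt).
    apply Rle_trans with ((M * Rpower (y + Rabs (t - x)) s) *
      (K * Rpower (y + Rabs (t - x)) (- INR (S m)))).
    + apply Rmult_le_compat; try apply Cmod_ge_0; auto.
    + right. replace (p - 1) with (s + - INR (S m)) by (unfold p; rewrite S_INR; ring).
      rewrite Rpower_plus. ring.
  - rewrite RInt_Rscal by (eexists; apply HI). rewrite (is_RInt_unique _ _ _ _ HI).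
    pose proof (Rpower_pos y p). pose proof (Rpower_pos (y + 1 / 2) p).
    assert ((Rpower (y + 1 / 2) p - Rpower y p) / p <= Rpower y p * / (- p)).
    { replace ((Rpower (y + 1 / 2) p - Rpower y p) / p) with
        ((Rpower y p - Rpower (y + 1 / 2) p) * / (- p)) by (field; lra).
      apply Rmult_le_compat_r; lra. }
    assert (0 <= M * K) by (apply Rmult_le_pos; lra). nra.
Qed.

(** * Partial sums on the real line *)

(** Hecke's bound, up to a factor [n^eta]: [F(x + i / n)] is integrated against the
    geometric sum of length [n]. *)
Lemma partial_sum_bound (c : nat -> C) (r0 rho K0 : R) : subexp c -> 0 <= r0 < rho ->
  (forall x y, 0 < y -> Cmod (ser c x y) <= K0 * Rpower y (- r0)) ->
  exists M, 0 <= M /\ forall n x,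
    Cmod (Csum (fun k => c k * cis (nu k * x))%C (S n)) <= M * Rpower (nu n) rho.
Proof.
  intros Hc Hr HK0. set (eta := rho - r0). assert (Heta : 0 < eta) by (unfold eta; lra).
  pose proof geo_const_pos as Hg. pose proof PI_RGT_0 as HPI.
  assert (HK : 0 <= K0).
  { specialize (HK0 0 1 Rlt_0_1). rewrite Rpower_1_base in HK0. 
    pose proof (Cmod_ge_0 (ser c 0 1)). lra. }
  set (Q := exp (2 * PI)). assert (HQ : 0 < Q) by apply exp_pos.
  set (D := Q * (1 + Q) * / geo_const).
  assert (HD : 0 < D).
  { unfold D. apply Rmult_lt_0_compat; [apply Rmult_lt_0_compat; lra|apply Rinv_0_lt_compat; auto]. }
  exists (K0 * D * 2 * Rpower 2 eta * / eta).
  assert (Hieta : 0 < / eta) by (apply Rinv_0_lt_compat; auto).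
  split.
  { pose proof (Rpower_pos 2 eta). apply Rmult_le_pos; [|lra]. apply Rmult_le_pos; [|lra].
    apply Rmult_le_pos; [|lra]. apply Rmult_le_pos; lra. }
  intros n x. set (y := / nu n). pose proof (nu_ge1 n) as Hn.
  assert (Hy : 0 < y <= 1).
  { unfold y. split; [apply Rinv_0_lt_compat; lra|]. rewrite <- Rinv_1. apply Rinv_le_contravar; lra. }
  set (h := fun t => ser c t y).
  assert (Hh : forall t, ccont h t) by (intros t; exact (ser_ccont_x c y t Hc (proj1 Hy))).
  set (c' := fun k => (c k * RtoC (exp (- (2 * PI * nu k * y))))%C).
  assert (Hc' : has_coef h c').
  { destruct (ser_rate c y Hc (proj1 Hy)) as [e [He [_ H]]].
    apply (coef_of_series h c' e); auto. intros k t. exact (H t y k (Rle_refl y)). }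
  set (G := fun t => Csum (fun k => Cpow (qpt (- y) (x - t)) (S k)) (S n)).
  assert (HG : forall t, ccont G t).
  { intros t. apply (ccont_Csum (fun k t => Cpow (qpt (- y) (x - t)) (S k))). intros k _.
    eapply ccont_ext; [intros u; symmetry; apply qpt_pow|].
    apply ccont_mult; [apply ccont_const|].
    eapply ccont_ext; [|apply (ccont_cis (- INR (S k)) (INR (S k) * x))].
    intros u; simpl. f_equal. ring. }
  assert (E : Csum (fun k => c k * cis (nu k * x))%C (S n) =
     CInt (fun t => h t * G t)%C (x - 1 / 2) (x + 1 / 2)).
  { transitivity (CInt (fun t => Csum (fun k => (RtoC (exp (2 * PI * nu k * y)) * cis (nu k * x)) *
       (h t * cis (- nu k * t)))%C (S n)) (x - 1 / 2) (x + 1 / 2)).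
    - rewrite (CInt_Csum (fun k t => (RtoC (exp (2 * PI * nu k * y)) * cis (nu k * x)) *
       (h t * cis (- nu k * t)))%C); [|lra|].
      + apply Csum_ext. intros k _. rewrite CInt_scal; [|lra|].
        * replace (x + 1 / 2) with (x - 1 / 2 + 1) by field. rewrite Hc'. unfold c'.
          replace (RtoC (exp (2 * PI * nu k * y)) * cis (nu k * x) *
            (c k * RtoC (exp (- (2 * PI * nu k * y)))))%C with
           (c k * cis (nu k * x) * (RtoC (exp (2 * PI * nu k * y)) * RtoC (exp (- (2 * PI * nu k * y)))))%C
            by ring.
          rewrite <- RtoC_mult, <- exp_plus, Rplus_opp_r, exp_0. ring.
        * intros t _. apply ccont_mult; [apply Hh|apply ccont_cis_scal].
      + intros k _ t _. apply ccont_mult; [apply ccont_const|].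
        apply ccont_mult; [apply Hh|apply ccont_cis_scal].
    - apply CInt_ext; [lra|]. intros t _. unfold G. rewrite <- Csum_scal. apply Csum_ext.
      intros k _. rewrite qpt_pow. fold (nu k).
      replace (nu k * (x - t)) with (nu k * x + - nu k * t) by ring. rewrite cis_plus.
      replace (- (2 * PI * nu k * - y)) with (2 * PI * nu k * y) by ring. ring. }
  rewrite E.
  pose proof (is_RInt_Rpower_abs x y eta (proj1 Hy) ltac:(lra)) as HI.
  set (A := K0 * Rpower y (- r0) * D * Rpower y (- eta)).
  assert (HA : 0 <= A).
  { unfold A. pose proof (Rpower_pos y (- r0)). pose proof (Rpower_pos y (- eta)).
    apply Rmult_le_pos; [|lra]. apply Rmult_le_pos; [|lra]. apply Rmult_le_pos; lra. }
  eapply Rle_trans; [apply CInt_bound with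
    (g := fun t => A * Rpower (y + Rabs (t - x)) (eta - 1))|].
  - lra.
  - intros t _. apply ccont_mult; auto.
  - apply (ex_RInt_scal (fun t => Rpower (y + Rabs (t - x)) (eta - 1))). eexists; apply HI.
  - intros t Ht. rewrite Cmod_mult.
    assert (Hxt : Rabs (x - t) <= 1 / 2) by (apply Rabs_le; lra).
    set (q := qpt (- y) (x - t)).
    assert (Hq : Cmod q <= Q).
    { unfold q, Q. rewrite Cmod_qpt. apply exp_le_mono. nra. }
    assert (HqN : Cmod q ^ S n = Q).
    { unfold q, Q. rewrite Cmod_qpt, exp_pow. f_equal. fold (nu n). unfold y. field. lra. }
    assert (Hgeo : ((RtoC 1 - q) * G t = q * (RtoC 1 - Cpow q (S n)))%C).
    { unfold G. fold q. generalize (S n). induction n0 as [|k IH]; [simpl; ring|].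
      cbn [Csum]. rewrite Cmult_plus_distr_l, IH, !Cpow_S. ring. }
    assert (Hlow : geo_const * (y + Rabs (t - x)) <= Cmod (RtoC 1 - q)%C).
    { pose proof (geo_lower (- y) (x - t)) as L. rewrite Rabs_Ropp, (Rabs_pos_eq y) in L by lra.
      rewrite (Rabs_minus_sym t x). apply L; lra. }
    set (w := y + Rabs (t - x)) in *.
    assert (Hw : 0 < w) by (unfold w; pose proof (Rabs_pos (t - x)); lra).
    assert (HGt : Cmod (G t) <= D * / w).
    { apply Rmult_le_reg_l with (geo_const * w); [apply Rmult_lt_0_compat; auto|].
      replace (geo_const * w * (D * / w)) with (Q * (1 + Q)) by (unfold D; field; split; lra).
      apply Rle_trans with (Cmod (RtoC 1 - q)%C * Cmod (G t)).
      - apply Rmult_le_compat_r; [apply Cmod_ge_0|auto].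
      - rewrite <- Cmod_mult, Hgeo, Cmod_mult. apply Rmult_le_compat; try apply Cmod_ge_0; auto.
        unfold Cminus. eapply Rle_trans; [apply Cmod_triangle|].
        rewrite Cmod_1, Cmod_opp, Cmod_pow, HqN. lra. }
    apply Rle_trans with ((K0 * Rpower y (- r0)) * (D * / w)).
    + apply Rmult_le_compat; [apply Cmod_ge_0|apply Cmod_ge_0|exact (HK0 t y (proj1 Hy))|exact HGt].
    + unfold A. replace (eta - 1) with (eta + - (1)) by ring.
      rewrite (Rpower_plus eta), (Rpower_Ropp w 1), (Rpower_1 w) by auto.
      replace (K0 * Rpower y (- r0) * D * Rpower y (- eta) * (Rpower w eta * / w)) with
        (K0 * Rpower y (- r0) * (D * / w) * (Rpower y (- eta) * Rpower w eta)) by ring.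
      rewrite <- (Rmult_1_r (K0 * Rpower y (- r0) * (D * / w))) at 1.
      apply Rmult_le_compat_l.
      * apply Rmult_le_pos; [apply Rmult_le_pos; [auto|apply Rlt_le, Rpower_pos]|].
        apply Rlt_le, Rmult_lt_0_compat; [auto|apply Rinv_0_lt_compat; auto].
      * rewrite Rpower_Ropp. apply Rmult_le_reg_l with (Rpower y eta); [apply Rpower_pos|].
        rewrite <- Rmult_assoc, Rinv_r, Rmult_1_l, Rmult_1_r by (apply Rgt_not_eq, Rpower_pos).
        apply Rle_Rpower_l; [lra|]. unfold w. pose proof (Rabs_pos (t - x)). lra.
  - rewrite RInt_Rscal by (eexists; apply HI). rewrite (is_RInt_unique _ _ _ _ HI).
    assert (B1 : (Rpower (y + 1 / 2) eta - Rpower y eta) / eta <= Rpower 2 eta * / eta).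
    { apply Rmult_le_compat_r; [lra|]. pose proof (Rpower_pos y eta).
      assert (Rpower (y + 1 / 2) eta <= Rpower 2 eta) by (apply Rle_Rpower_l; lra). lra. }
    apply Rle_trans with (A * (2 * (Rpower 2 eta * / eta))).
    + apply Rmult_le_compat_l; auto. lra.
    + right. unfold A.
      assert (EE : Rpower y (- r0) * Rpower y (- eta) = Rpower (nu n) rho).
      { rewrite <- Rpower_plus. unfold y, Rpower. rewrite ln_Rinv by lra. f_equal. unfold eta. ring. }
      rewrite <- EE. ring.
Qed.

(** * The fractional integral on the real line *)

Definition fal_term (c : nat -> C) (a x : R) (k : nat) : C :=
  (c k * cis (nu k * x) * RtoC (Rpower (nu k) (- a)))%C.

Definition fal (c : nat -> C) (a x : R) : C := CSeries (fal_term c a x).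

(** Everything on the real line follows from this bound; for a form of weight [r] it holds
    with [r0 = r/2]. *)
Definition power_sums (c : nat -> C) (r0 : R) : Prop :=
  0 <= r0 /\ forall rho, r0 < rho -> exists M, 0 <= M /\ forall n x,
    Cmod (Csum (fun k => c k * cis (nu k * x))%C (S n)) <= M * Rpower (nu n) rho.

Lemma fal_rate c r0 a : power_sums c r0 -> r0 < a -> exists e, is_lim_seq e 0 /\
  (forall x n m, (n <= m)%nat ->
     Cmod (Csum (fal_term c a x) m - Csum (fal_term c a x) n)%C <= e n) /\
  (forall x n, Cmod (fal c a x - Csum (fal_term c a x) n)%C <= e n).
Proof.
  intros [Hr0 H] Ha. destruct (H ((r0 + a) / 2)) as [M [HM HB]]; [lra|].
  set (rho := (r0 + a) / 2) in *.
  set (e := fun n => M * 1 * abel_const rho a * Rpower (nu n) (- (a - rho))).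
  assert (He : is_lim_seq e 0) by (apply lim_nu_pow; unfold rho; lra).
  assert (HC : forall x n m, (n <= m)%nat ->
     Cmod (Csum (fal_term c a x) m - Csum (fal_term c a x) n)%C <= e n).
  { intros x n m Hnm. unfold fal_term, e.
    apply (abel_tail (fun k => c k * cis (nu k * x))%C (fun k => Rpower (nu k) (- a)));
      auto; try lra; try (unfold rho; lra).
    - intros k. apply power_weight_ok. lra.
    - intros k. apply power_weight_ok. lra. }
  exists e. repeat split; auto. intros x n. unfold fal. apply (CSeries_rate (fal_term c a x)); auto.
Qed.

Lemma ccont_fal_term c a k x : ccont (fun x => fal_term c a x k) x.
Proof.
  unfold fal_term. apply ccont_mult; [|apply ccont_const].
  apply ccont_mult; [apply ccont_const|apply ccont_cis_scal].
Qed.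

Lemma fal_ccont c r0 a x : power_sums c r0 -> r0 < a -> ccont (fal c a) x.
Proof.
  intros H Ha. destruct (fal_rate c r0 a H Ha) as [e [He [_ HF]]].
  apply (ccont_uniform_limit _ (fun n x => Csum (fal_term c a x) n) e x (mkposreal 1 Rlt_0_1)); auto.
  intros n t. apply (ccont_Csum (fun k x => fal_term c a x k)). intros; apply ccont_fal_term.
Qed.

Definition fal_coef (c : nat -> C) (a : R) (n : nat) : C := (c n * RtoC (Rpower (nu n) (- a)))%C.

Lemma fal_series c r0 a : power_sums c r0 -> r0 < a -> exists e, is_lim_seq e 0 /\
  forall n t, Cmod (fal c a t - Csum (fun k => fal_coef c a k * cis (nu k * t)) n)%C <= e n.
Proof.
  intros H Ha. destruct (fal_rate c r0 a H Ha) as [e [He [_ HF]]]. exists e. split; auto.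
  intros n t. rewrite (Csum_ext _ (fal_term c a t)); auto.
  intros k _. unfold fal_coef, fal_term. ring.
Qed.

Lemma fal_has_coef c r0 a : power_sums c r0 -> r0 < a -> has_coef (fal c a) (fal_coef c a).
Proof.
  intros H Ha. destruct (fal_series c r0 a H Ha) as [e [He HF]].
  apply (coef_of_series _ _ e); auto. intros; eapply fal_ccont; eauto.
Qed.

(** Conjugation turns the frequencies negative. *)
Lemma fal_conj_coef c r0 a : power_sums c r0 -> r0 < a ->
  has_coef (fun t => Cconj (fal c a t)) (fun _ => RtoC 0).
Proof.
  intros H Ha n b. destruct (fal_series c r0 a H Ha) as [e [He HF]].
  assert (Hc : forall t, ccont (fal c a) t) by (intros; eapply fal_ccont; eauto).
  rewrite (CInt_ext _ (fun t => Cconj (fal c a t * cis (nu n * t))%C)); [|lra|].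
  - rewrite CInt_conj; [|lra|].
    + unfold nu. rewrite (coef_nonneg_freq _ (fal_coef c a) e); auto.
      unfold Cconj, RtoC; simpl. f_equal; ring.
    + intros t _. apply ccont_mult; [apply Hc|apply ccont_cis_scal].
  - intros t _. rewrite Cmult_conj. f_equal. rewrite <- cis_opp. f_equal. ring.
Qed.

Lemma fal_cder c r0 a x : power_sums c r0 -> r0 < a - 1 ->
  cder (fal c a) x (RtoC (2 * PI) * Ci * fal c (a - 1) x)%C.
Proof.
  intros H Ha. destruct (fal_rate c r0 a H ltac:(lra)) as [e [He [_ HF]]].
  destruct (fal_rate c r0 (a - 1) H Ha) as [e' [He' [_ HF']]].
  pose proof PI_RGT_0 as HPI.
  set (E := fun n => Rabs (e n) + 2 * PI * Rabs (e' n)).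
  assert (HE : is_lim_seq E 0).
  { replace (Finite 0) with (Finite (Rabs 0 + 2 * PI * Rabs 0)) by (rewrite Rabs_R0; f_equal; ring).
    apply is_lim_seq_plus'; [apply (is_lim_seq_abs _ (Finite 0)); auto|].
    apply (is_lim_seq_scal_l _ (2 * PI) (Finite (Rabs 0))).
    apply (is_lim_seq_abs _ (Finite 0)); auto. }
  apply (cder_uniform_limit (fal c a) (fun x => RtoC (2 * PI) * Ci * fal c (a - 1) x)%C
    (fun n x => Csum (fal_term c a x) n)
    (fun n x => RtoC (2 * PI) * Ci * Csum (fal_term c (a - 1) x) n)%C E x); auto.
  - intros n t. eapply Rle_trans; [apply HF|]. unfold E.
    pose proof (Rle_abs (e n)). pose proof (Rabs_pos (e' n)). nra.
  - intros n t.
    replace (RtoC (2 * PI) * Ci * fal c (a - 1) t - RtoC (2 * PI) * Ci * Csum (fal_term c (a - 1) t) n)%C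
     with (RtoC (2 * PI) * Ci * (fal c (a - 1) t - Csum (fal_term c (a - 1) t) n))%C by ring.
    rewrite !Cmod_mult, Cmod_Ci, Cmod_R, Rabs_pos_eq by lra.
    specialize (HF' t n). unfold E. pose proof (Rle_abs (e' n)). pose proof (Rabs_pos (e n)). nra.
  - intros n t. rewrite <- Csum_scal.
    apply (cder_Csum (fun k x => fal_term c a x k)
      (fun k x => RtoC (2 * PI) * Ci * fal_term c (a - 1) x k)%C). intros k _.
    eapply cder_ext with (h := fun s => ((c k * RtoC (Rpower (nu k) (- a))) * cis (nu k * s + 0))%C).
    { intros s. rewrite Rplus_0_r. unfold fal_term. ring. }
    replace (RtoC (2 * PI) * Ci * fal_term c (a - 1) t k)%C with
      ((c k * RtoC (Rpower (nu k) (- a))) * (RtoC (2 * PI * nu k) * Ci * cis (nu k * t + 0)))%C.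
    + apply cder_scal, cder_cis.
    + rewrite Rplus_0_r. unfold fal_term.
      replace (- (a - 1)) with (- a + 1) by ring.
      rewrite Rpower_plus, Rpower_1 by apply nu_pos. rewrite !RtoC_mult. ring.
Qed.

(** Interpolation between the trivial bound and the mean value inequality, the derivative of
    the partial sum being larger by a factor [n]. *)
Lemma power_sums_diff c r0 rho : power_sums c r0 -> r0 < rho -> exists M, 0 <= M /\
  forall s, 0 < s <= 1 -> forall n x y, x <> y ->
  Cmod (Csum (fun k => c k * (cis (nu k * x) - cis (nu k * y)))%C (S n)) <=
    M * Rpower (Rabs (x - y)) s * Rpower (nu n) (rho + s).
Proof.
  intros [Hr0 H] Hrho. destruct (H rho Hrho) as [M [HM HB]]. pose proof PI_RGT_0 as HPI.
  exists ((6 * PI + 2) * M). split; [nra|]. intros s Hs n x y Hxy.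
  set (S0 := fun t => Csum (fun k => c k * cis (nu k * t))%C (S n)).
  set (S1 := fun t => Csum (fun k => c k * cis (nu k * t) * RtoC (nu k))%C (S n)).
  replace (Csum (fun k => c k * (cis (nu k * x) - cis (nu k * y)))%C (S n)) with (S0 x - S0 y)%C.
  2:{ unfold S0. rewrite <- Csum_minus. apply Csum_ext. intros; ring. }
  assert (HS1 : forall t, Cmod (S1 t) <= 3 * M * (Rpower (nu n) rho * nu n)).
  { intros t. set (b := fun k => (c k * cis (nu k * t))%C).
    assert (E : forall N, Csum (fun k => b k * RtoC (nu k))%C N =
       (Csum b N * RtoC (nu N) - Csum (fun k => Csum b (S k)) N)%C).
    { induction N as [|N IH]; [simpl; ring|]. cbn [Csum]. rewrite IH. cbn [Csum].
      rewrite nu_S, RtoC_plus. ring. }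
    unfold S1. fold b. rewrite (Csum_ext _ (fun k => b k * RtoC (nu k))%C) by reflexivity.
    rewrite E. unfold Cminus. eapply Rle_trans; [apply Cmod_triangle|]. rewrite Cmod_opp.
    pose proof (nu_ge1 n) as Hn. pose proof (Rpower_pos (nu n) rho) as Hp.
    assert (A1 : Cmod (Csum b (S n) * RtoC (nu (S n)))%C <= M * Rpower (nu n) rho * (2 * nu n)).
    { rewrite Cmod_mult, Cmod_R, Rabs_pos_eq by (apply Rlt_le, nu_pos).
      apply Rmult_le_compat; [apply Cmod_ge_0|apply Rlt_le, nu_pos|apply HB|].
      rewrite nu_S. lra. }
    assert (A2 : Cmod (Csum (fun k => Csum b (S k)) (S n)) <= INR (S n) * (M * Rpower (nu n) rho)).
    { apply Csum_bound. intros k Hk. eapply Rle_trans; [apply HB|].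
      apply Rmult_le_compat_l; auto. apply Rle_Rpower_l; [lra|].
      split; [apply nu_pos|apply nu_le; lia]. }
    fold (nu n) in A2. nra. }
  assert (HA : Cmod (S0 x - S0 y)%C <= 2 * M * Rpower (nu n) rho).
  { unfold Cminus. eapply Rle_trans; [apply Cmod_triangle|]. rewrite Cmod_opp.
    pose proof (HB n x). pose proof (HB n y). unfold S0. lra. }
  assert (HD : Cmod (S0 x - S0 y)%C <= 6 * PI * M * (Rpower (nu n) rho * nu n) * Rabs (x - y)).
  { apply (cder_mean_value S0 (fun t => RtoC (2 * PI) * Ci * S1 t)%C).
    - intros t _. unfold S0, S1. rewrite <- Csum_scal.
      apply (cder_Csum (fun k t => c k * cis (nu k * t))%C
        (fun k t => RtoC (2 * PI) * Ci * (c k * cis (nu k * t) * RtoC (nu k)))%C).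
      intros k _. eapply cder_ext with (h := fun s => (c k * cis (nu k * s + 0))%C).
      { intros u. now rewrite Rplus_0_r. }
      replace (RtoC (2 * PI) * Ci * (c k * cis (nu k * t) * RtoC (nu k)))%C with
        (c k * (RtoC (2 * PI * nu k) * Ci * cis (nu k * t + 0)))%C
        by (rewrite Rplus_0_r, RtoC_mult; ring).
      apply cder_scal, cder_cis.
    - intros t _. rewrite !Cmod_mult, Cmod_Ci, Cmod_R, Rabs_pos_eq by lra.
      pose proof (HS1 t). nra. }
  pose proof (nu_ge1 n) as Hn. pose proof (Rpower_pos (nu n) rho) as Hp.
  assert (Hd : 0 < Rabs (x - y)) by (apply Rabs_pos_lt; lra).
  set (d := Rabs (x - y)) in *. rewrite Rpower_plus.
  replace ((6 * PI + 2) * M * Rpower d s * (Rpower (nu n) rho * Rpower (nu n) s)) with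
    ((6 * PI + 2) * M * Rpower (nu n) rho * (Rpower d s * Rpower (nu n) s)) by ring.
  rewrite Rpower_mult_distr by lra. set (v := d * nu n) in *.
  assert (Hv : 0 < v) by (unfold v; apply Rmult_lt_0_compat; lra).
  assert (HMp : 0 <= M * Rpower (nu n) rho) by (apply Rmult_le_pos; lra).
  destruct (Rle_dec v 1) as [Hv1|Hv1].
  - assert (v <= Rpower v s) by (rewrite <- (Rpower_1 v) at 1 by auto; apply Rpower_anti; lra).
    apply Rle_trans with (6 * PI * (M * Rpower (nu n) rho) * v).
    + eapply Rle_trans; [apply HD|]. unfold v. right; ring.
    + assert (M * Rpower (nu n) rho * v <= M * Rpower (nu n) rho * Rpower v s)
        by (apply Rmult_le_compat_l; auto).
      assert (0 <= M * Rpower (nu n) rho * v) by (apply Rmult_le_pos; lra). nra.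
  - assert (1 <= Rpower v s) by (apply Rpower_ge1; lra).
    assert (M * Rpower (nu n) rho * 1 <= M * Rpower (nu n) rho * Rpower v s)
      by (apply Rmult_le_compat_l; auto). nra.
Qed.

(** Summation by parts as for convergence, with the differences of the partial sums at [x] and
    [y] in place of the partial sums: they grow like [n^(rho + s)]. *)
Lemma fal_holder c r0 a s : power_sums c r0 -> 0 < s <= 1 -> r0 + s < a ->
  exists M, forall x y, x <> y -> Cmod (fal c a x - fal c a y)%C <= M * Rpower (Rabs (x - y)) s.
Proof.
  intros Hps Hs Ha. set (rho := (r0 + (a - s)) / 2).
  assert (Hrho : r0 < rho < a - s) by (unfold rho; lra).
  assert (Hr0 : 0 <= r0) by apply Hps.
  destruct (power_sums_diff c r0 rho Hps ltac:(lra)) as [M [HM HB]].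
  destruct (fal_rate c r0 a Hps ltac:(lra)) as [e [He [_ HF]]].
  exists (M * abel_const (rho + s) a).
  intros x y Hxy.
  assert (Hp : 0 < Rpower (Rabs (x - y)) s) by apply Rpower_pos.
  assert (He2 : is_lim_seq (fun n => 2 * e n) 0).
  { replace (Finite 0) with (Rbar_mult 2 0) by (simpl; f_equal; ring).
    apply is_lim_seq_scal_l; auto. }
  apply le_of_le_lim0 with (1 := He2). exists 0%nat. intros n _.
  replace (fal c a x - fal c a y)%C with
   ((Csum (fal_term c a x) n - Csum (fal_term c a y) n) +
     ((fal c a x - Csum (fal_term c a x) n) - (fal c a y - Csum (fal_term c a y) n)))%C by ring.
  eapply Rle_trans; [apply Cmod_triangle|]. apply Rplus_le_compat.
  - rewrite <- Csum_minus.
    pose proof (abel_tail (fun k => c k * (cis (nu k * x) - cis (nu k * y)))%C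
      (fun k => Rpower (nu k) (- a)) (rho + s) a (M * Rpower (Rabs (x - y)) s) 1
      ltac:(lra) ltac:(nra) ltac:(lra) (fun n => HB s Hs n x y Hxy)
      (fun k => proj1 (power_weight_ok a ltac:(lra) k))
      (fun k => proj2 (power_weight_ok a ltac:(lra) k)) 0%nat n ltac:(lia)) as T.
    replace (nu 0) with 1 in T by (unfold nu; simpl; reflexivity).
    rewrite Rpower_1_base in T. simpl (Csum _ 0) in T.
    rewrite (Csum_ext _ (fun k => c k * (cis (nu k * x) - cis (nu k * y)) *
      RtoC (Rpower (nu k) (- a)))%C).
    + eapply Rle_trans; [|eapply Rle_trans; [apply T|]].
      * right. f_equal. ring.
      * right; ring.
    + intros k _. unfold fal_term. ring.
  - unfold Cminus at 1. eapply Rle_trans; [apply Cmod_triangle|]. rewrite Cmod_opp.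
    pose proof (HF x n). pose proof (HF y n). lra.
Qed.

Definition fal_deriv (c : nat -> C) (a : R) (j : nat) (x : R) : C :=
  (Cpow (RtoC (2 * PI) * Ci) j * fal c (a - INR j) x)%C.

Lemma fal_deriv_cder c r0 a j x : power_sums c r0 -> r0 < a - INR (S j) ->
  cder (fal_deriv c a j) x (fal_deriv c a (S j) x).
Proof.
  intros H Ha. unfold fal_deriv. rewrite Cpow_S.
  replace (RtoC (2 * PI) * Ci * Cpow (RtoC (2 * PI) * Ci) j * fal c (a - INR (S j)) x)%C with
   (Cpow (RtoC (2 * PI) * Ci) j * (RtoC (2 * PI) * Ci * fal c (a - INR (S j)) x))%C by ring.
  apply cder_scal. rewrite S_INR in *. replace (a - (INR j + 1)) with (a - INR j - 1) in * by ring.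
  apply (fal_cder c r0); auto.
Qed.

(** * Trigonometric polynomials with nonpositive frequencies *)

(** These functions have no positive frequency, so subtracting one changes nothing in the
    upper half plane.  They replace Taylor polynomials, which are not periodic. *)
Inductive npt : (R -> C) -> Prop :=
| npt_const c : npt (fun _ => c)
| npt_plus Q Q' : npt Q -> npt Q' -> npt (fun t => Q t + Q' t)%C
| npt_scal c Q : npt Q -> npt (fun t => c * Q t)%C
| npt_shift Q : npt Q -> npt (fun t => cis (- t) * Q t)%C
| npt_ext Q Q' : (forall t, Q t = Q' t) -> npt Q -> npt Q'.

Lemma ccont_cis_opp t : ccont (fun t => cis (- t)) t.
Proof.
  eapply ccont_ext; [|apply (ccont_cis_scal (- (1)))]. intros s; simpl; f_equal; ring.
Qed.

Lemma npt_ccont Q : npt Q -> forall t, ccont Q t.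
Proof.
  induction 1; intros t.
  - apply ccont_const.
  - apply ccont_plus; auto.
  - apply ccont_mult; [apply ccont_const|auto].
  - apply ccont_mult; [apply ccont_cis_opp|auto].
  - eapply ccont_ext; eauto.
Qed.

Lemma npt_bounded Q : npt Q -> exists B, 0 <= B /\ forall t, Cmod (Q t) <= B.
Proof.
  induction 1 as [c|Q Q' _ [B [HB H]] _ [B' [HB' H']]|c Q _ [B [HB H]]|Q _ [B [HB H]]
    |Q Q' E _ [B [HB H]]].
  - exists (Cmod c). split; [apply Cmod_ge_0|]. intros; lra.
  - exists (B + B'). split; [lra|]. intros t. eapply Rle_trans; [apply Cmod_triangle|].
    pose proof (H t). pose proof (H' t). lra.
  - exists (Cmod c * B). pose proof (Cmod_ge_0 c). split; [nra|]. intros t. rewrite Cmod_mult.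
    apply Rmult_le_compat_l; auto.
  - exists B. split; auto. intros t. rewrite Cmod_mult, Cmod_cis, Rmult_1_l. auto.
  - exists B. split; auto. intros t. rewrite <- E. auto.
Qed.

Lemma npt_mult Q Q' : npt Q -> npt Q' -> npt (fun t => Q t * Q' t)%C.
Proof.
  intros H H'. induction H.
  - apply npt_scal; auto.
  - eapply npt_ext; [|apply (npt_plus _ _ IHnpt1 IHnpt2)]. intros t; simpl; ring.
  - eapply npt_ext; [|apply (npt_scal c _ IHnpt)]. intros t; simpl; ring.
  - eapply npt_ext; [|apply (npt_shift _ IHnpt)]. intros t; simpl; ring.
  - eapply npt_ext; [|apply IHnpt]. intros t; simpl. now rewrite H.
Qed.

(** The extra frequency [k] makes the statement inductive: the factor of [npt_shift] is
    absorbed by it. *)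
Lemma npt_coef Q : npt Q -> forall (x : R) (k n : nat) b,
  CInt (fun t => Q (t - x)%R * cis (- (INR k + nu n) * t))%C b (b + 1) = RtoC 0.
Proof.
  intros H.
  assert (Hc : forall Q (x a : R), npt Q -> forall t, ccont (fun t => Q (t - x)%R * cis (a * t))%C t).
  { intros P x a HP t. apply ccont_mult; [|apply ccont_cis_scal].
    apply (ccont_comp (fun t => t - x) P); [|apply npt_ccont; auto].
    apply (ex_derive_continuous (fun t => t - x)). auto_derive; auto. }
  assert (Hb : forall b : R, b <= b + 1) by (intros; lra).
  induction H as [c|Q Q' H1 IH1 H2 IH2|c Q H IH|Q H IH|Q Q' E H IH]; intros x k n b.
  - rewrite CInt_scal; auto.
    + replace (- (INR k + nu n)) with (IZR (- Z.of_nat (k + S n))).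
      * rewrite CInt_cis by lia. ring.
      * rewrite opp_IZR, <- INR_IZR_INZ, plus_INR. reflexivity.
    + intros t _. apply ccont_cis_scal.
  - rewrite (CInt_ext _ (fun t => Q (t - x)%R * cis (- (INR k + nu n) * t) +
        Q' (t - x)%R * cis (- (INR k + nu n) * t))%C); auto.
    + rewrite CInt_plus; auto; try (intros t _; apply Hc; auto).
      rewrite IH1, IH2. ring.
    + intros; ring.
  - rewrite (CInt_ext _ (fun t => c * (Q (t - x)%R * cis (- (INR k + nu n) * t)))%C); auto.
    + rewrite CInt_scal; auto; try (intros t _; apply Hc; auto). rewrite IH. ring.
    + intros; ring.
  - rewrite (CInt_ext _ (fun t => cis x * (Q (t - x)%R * cis (- (INR (S k) + nu n) * t)))%C); auto.
    + rewrite CInt_scal; auto; try (intros t _; apply Hc; auto). rewrite IH. ring.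
    + intros t _. rewrite S_INR.
      replace (- (t - x)) with (x + - t) by ring.
      replace (- (INR k + 1 + nu n) * t) with (- t + - (INR k + nu n) * t) by ring.
      rewrite !cis_plus. ring.
  - rewrite <- (IH x k n b). apply CInt_ext; auto. intros t _. now rewrite E.
Qed.

Lemma npt_Cpow Q n : npt Q -> npt (fun t => Cpow (Q t) n).
Proof.
  intros H. induction n as [|n IH]; simpl; [apply npt_const|]. apply npt_mult; auto.
Qed.

Lemma npt_Csum (u : nat -> R -> C) n : (forall k, npt (u k)) -> npt (fun t => Csum (fun k => u k t) n).
Proof.
  intros H. induction n as [|n IH]; simpl; [apply npt_const|]. apply npt_plus; auto.
Qed.

Lemma cder_Cpow h t l n : cder h t l ->
  cder (fun s => Cpow (h s) (S n)) t (RtoC (INR (S n)) * Cpow (h t) n * l)%C.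
Proof.
  intros H. induction n as [|n IH].
  - eapply cder_ext with (h := h); [intros; simpl; ring|]. simpl.
    replace (RtoC 1 * RtoC 1 * l)%C with l by ring. exact H.
  - rewrite (S_INR (S n)), RtoC_plus.
    replace ((RtoC (INR (S n)) + RtoC 1) * Cpow (h t) (S n) * l)%C with
     (l * Cpow (h t) (S n) + h t * (RtoC (INR (S n)) * Cpow (h t) n * l))%C by (rewrite Cpow_S; ring).
    apply (cder_mult h (fun s => Cpow (h s) (S n))); auto.
Qed.

(** With [V = 1 - e(-t)], the truncated series of [- log (1 - V) / (2 pi i)] has
    derivative [1 - V^N], hence differs from [t] by [O(|t|^(N+1))]. *)
Lemma npt_approx_id N : exists Q, npt Q /\ exists K, 0 <= K /\
  forall t, Rabs t <= 1 -> Cmod (RtoC t - Q t)%C <= K * Rabs t ^ N.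
Proof.
  pose proof PI_RGT_0 as HPI.
  set (l := (RtoC (2 * PI) * Ci)%C).
  assert (Hl : l <> RtoC 0).
  { unfold l. intros E. apply (f_equal Cmod) in E. rewrite Cmod_mult, Cmod_Ci, Cmod_R, Cmod_0 in E.
    rewrite Rabs_pos_eq in E; lra. }
  set (V := fun t => (RtoC 1 - cis (- t))%C).
  set (L := fun t => Csum (fun k => / (l * RtoC (INR (S k))) * Cpow (V t) (S k))%C N).
  assert (HV : npt V).
  { unfold V. apply npt_ext with (Q := fun t => (RtoC 1 + RtoC (-1) * (cis (- t) * RtoC 1))%C).
    - intros t. change (RtoC (-1)) with (RtoC (- (1))). rewrite RtoC_opp. ring.
    - apply npt_plus; [apply npt_const|]. apply npt_scal, npt_shift, npt_const. }
  assert (HV' : forall t, cder V t (l * cis (- t))%C).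
  { intros t. unfold V.
    replace (l * cis (- t))%C with (RtoC 0 - RtoC (2 * PI * - (1)) * Ci * cis (- (1) * t + 0))%C.
    - eapply cder_ext; [|apply (cder_minus _ _ _ _ _ (cder_const (RtoC 1) t) (cder_cis (- (1)) 0 t))].
      intros s; simpl. do 2 f_equal. ring.
    - replace (- (1) * t + 0) with (- t) by ring. unfold l. rewrite !RtoC_mult, RtoC_opp. ring. }
  assert (HVb : forall t, Cmod (V t) <= 2 * PI * Rabs t).
  { intros t. replace (V t) with (V t - V 0)%C.
    - rewrite <- (Rminus_0_r t) at 2. apply cder_mean_value with (h' := fun t => (l * cis (- t))%C).
      + intros s _. apply HV'.
      + intros s _. unfold l. rewrite !Cmod_mult, Cmod_cis, Cmod_Ci, Cmod_R, Rabs_pos_eq; lra.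
    - unfold V. rewrite Ropp_0, cis_0. ring. }
  assert (HL : forall t, cder L t (RtoC 1 - Cpow (V t) N)%C).
  { intros t. unfold L.
    replace (RtoC 1 - Cpow (V t) N)%C with (Csum (fun k => Cpow (V t) k * (RtoC 1 - V t))%C N).
    - apply (cder_Csum (fun k t => / (l * RtoC (INR (S k))) * Cpow (V t) (S k))%C
        (fun k t => Cpow (V t) k * (RtoC 1 - V t))%C). intros k _.
      assert (HS : RtoC (INR (S k)) <> RtoC 0).
      { intros E. apply RtoC_inj in E. revert E. apply not_0_INR. lia. }
      replace (Cpow (V t) k * (RtoC 1 - V t))%C with
        (/ (l * RtoC (INR (S k))) * (RtoC (INR (S k)) * Cpow (V t) k * (l * cis (- t))))%C.
      + apply cder_scal. apply cder_Cpow. apply HV'.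
      + unfold V. field. split; auto.
    - clear. induction N as [|N IH]; [simpl; ring|]. cbn [Csum]. rewrite IH, Cpow_S. ring. }
  exists L. split.
  { apply (npt_Csum (fun k t => / (l * RtoC (INR (S k))) * Cpow (V t) (S k))%C). intros k.
    apply npt_scal, npt_Cpow, HV. }
  exists ((2 * PI) ^ N). split; [apply pow_le; lra|]. intros t Ht.
  set (D := fun s => (RtoC s - L s)%C).
  assert (HD0 : D 0 = RtoC 0).
  { unfold D, L. rewrite Csum_zero; [ring|]. intros k _. rewrite Cpow_S. unfold V.
    rewrite Ropp_0, cis_0. ring. }
  replace (RtoC t - L t)%C with (D t - D 0)%C by (rewrite HD0; unfold D; ring).
  eapply Rle_trans; [apply cder_mean_value with (h' := fun s => Cpow (V s) N)
     (M := (2 * PI) ^ N * Rabs t ^ N)|].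
  - intros s _. unfold D.
    replace (Cpow (V s) N) with (RtoC 1 - (RtoC 1 - Cpow (V s) N))%C by ring.
    apply cder_minus; auto. apply cder_real. auto_derive; auto.
  - intros s Hs. rewrite Cmod_pow, <- Rpow_mult_distr. apply pow_incr.
    split; [apply Cmod_ge_0|]. eapply Rle_trans; [apply HVb|].
    apply Rmult_le_compat_l; [lra|]. revert Hs. unfold Rmin, Rmax.
    destruct (Rle_dec 0 t); intros Hs.
    + rewrite !Rabs_pos_eq; lra.
    + rewrite !Rabs_left1; lra.
  - rewrite Rminus_0_r. rewrite <- (Rmult_1_r ((2 * PI) ^ N * Rabs t ^ N)) at 2.
    apply Rmult_le_compat_l; auto. apply Rmult_le_pos; apply pow_le; [lra|apply Rabs_pos].
Qed.

(** Approximations multiply, because all the functions involved are bounded. *)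
Lemma npt_approx_pow N j : exists Q, npt Q /\ exists K, 0 <= K /\
  forall t, Rabs t <= 1 -> Cmod (RtoC (t ^ j) - Q t)%C <= K * Rabs t ^ N.
Proof.
  destruct (npt_approx_id N) as [L [HL [K [HK H]]]].
  destruct (npt_bounded L HL) as [B [HB HBL]].
  induction j as [|j [Q [HQ [K' [HK' H']]]]].
  - exists (fun _ => RtoC 1). split; [apply npt_const|]. exists 0. split; [lra|]. intros t _. simpl.
    replace (RtoC 1 - RtoC 1)%C with (RtoC 0) by ring. rewrite Cmod_0. lra.
  - destruct (npt_bounded Q HQ) as [B' [HB' HBQ]].
    exists (fun t => L t * Q t)%C. split; [apply npt_mult; auto|].
    exists (K' + K * B'). split; [nra|]. intros t Ht.
    replace (RtoC (t ^ S j) - L t * Q t)%C with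
      (RtoC t * (RtoC (t ^ j) - Q t) + (RtoC t - L t) * Q t)%C by (simpl; rewrite RtoC_mult; ring).
    eapply Rle_trans; [apply Cmod_triangle|]. rewrite !Cmod_mult, Cmod_R.
    specialize (H t Ht). specialize (H' t Ht). specialize (HBQ t).
    assert (Rabs t * Cmod (RtoC (t ^ j) - Q t)%C <= 1 * (K' * Rabs t ^ N)).
    { apply Rmult_le_compat; auto; [apply Rabs_pos|apply Cmod_ge_0]. }
    assert (Cmod (RtoC t - L t)%C * Cmod (Q t) <= K * Rabs t ^ N * B').
    { apply Rmult_le_compat; auto; apply Cmod_ge_0. }
    lra.
Qed.

Lemma npt_approx_poly N d : exists K, 0 <= K /\ forall p M, 0 <= M ->
  (forall j, (j < d)%nat -> Cmod (p j) <= M) -> exists Q, npt Q /\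
  (forall t, Cmod (Q t) <= K * M) /\
  forall t, Rabs t <= 1 -> Cmod (Csum (fun j => p j * RtoC (t ^ j))%C d - Q t)%C <= K * M * Rabs t ^ N.
Proof.
  induction d as [|d [K [HK IH]]].
  - exists 0. split; [lra|]. intros p M HM _. exists (fun _ => RtoC 0). split; [apply npt_const|].
    split; intros; simpl.
    + rewrite Cmod_0. lra.
    + replace (RtoC 0 - RtoC 0)%C with (RtoC 0) by ring. rewrite Cmod_0. lra.
  - destruct (npt_approx_pow N d) as [Q1 [HQ1 [K1 [HK1 H1]]]].
    destruct (npt_bounded Q1 HQ1) as [B1 [HB1 HBQ1]].
    exists (K + K1 + B1). split; [lra|]. intros p M HM Hp.
    destruct (IH p M HM) as [Q [HQ [HQb HQa]]]; [intros; apply Hp; lia|].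
    assert (Hpd : Cmod (p d) <= M) by (apply Hp; lia).
    exists (fun t => Q t + p d * Q1 t)%C. split; [apply npt_plus; [auto|apply npt_scal; auto]|].
    split; intros t; [|intros Ht].
    + eapply Rle_trans; [apply Cmod_triangle|]. rewrite Cmod_mult.
      specialize (HQb t). specialize (HBQ1 t). pose proof (Cmod_ge_0 (p d)).
      assert (Cmod (p d) * Cmod (Q1 t) <= M * B1)
        by (apply Rmult_le_compat; auto; apply Cmod_ge_0). nra.
    + cbn [Csum].
      replace (Csum (fun j => p j * RtoC (t ^ j)) d + p d * RtoC (t ^ d) - (Q t + p d * Q1 t))%C with
       ((Csum (fun j => p j * RtoC (t ^ j)) d - Q t) + p d * (RtoC (t ^ d) - Q1 t))%C by ring.
      eapply Rle_trans; [apply Cmod_triangle|]. rewrite Cmod_mult.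
      specialize (HQa t Ht). specialize (H1 t Ht).
      assert (Hpw : 0 <= Rabs t ^ N) by (apply pow_le, Rabs_pos).
      assert (Cmod (p d) * Cmod (RtoC (t ^ d) - Q1 t)%C <= M * (K1 * Rabs t ^ N))
        by (apply Rmult_le_compat; auto; apply Cmod_ge_0).
      assert (0 <= B1 * M * Rabs t ^ N) by (repeat apply Rmult_le_pos; auto). nra.
Qed.

(** * Mellin weights *)

Definition mell (b tau : R) : R := exp (- (2 * PI * tau)) * Rpower tau (b - 1).

Lemma continuous_mell v b tau : 0 < tau ->
  continuous (fun tau => exp (- (2 * PI * v * tau)) * Rpower tau (b - 1)) tau.
Proof.
  intros H. apply (@continuous_mult R_UniformSpace R_AbsRing).
  - apply (ex_derive_continuous (fun tau => exp (- (2 * PI * v * tau)))). auto_derive; auto.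
  - now apply continuous_Rpower.
Qed.

Lemma ex_RInt_pos (f : R -> R) a b : 0 < a <= b -> (forall t, 0 < t -> continuous f t) -> ex_RInt f a b.
Proof.
  intros Hab H. apply (ex_RInt_continuous (V := R_CompleteNormedModule)). intros t Ht.
  rewrite Rmin_left in Ht by lra. apply H. lra.
Qed.

Lemma RInt_Chasles_pos (f : R -> R) a b c : 0 < a <= b -> b <= c ->
  (forall t, 0 < t -> continuous f t) -> RInt f a c = RInt f a b + RInt f b c.
Proof.
  intros Hab Hbc H. symmetry. apply (RInt_Chasles (V := R_CompleteNormedModule) f a b c);
    apply ex_RInt_pos; auto; lra.
Qed.

Lemma RInt_ge0_pos (f : R -> R) a b : 0 < a <= b -> (forall t, 0 < t -> continuous f t) ->
  (forall t, 0 < t -> 0 <= f t) -> 0 <= RInt f a b.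
Proof.
  intros Hab H Hf. apply RInt_ge_0; [lra|apply ex_RInt_pos; auto|]. intros t Ht. apply Hf. lra.
Qed.

Lemma RInt_incl (f : R -> R) a b a' b' : 0 < a' <= a -> a <= b -> b <= b' ->
  (forall t, 0 < t -> continuous f t) -> (forall t, 0 < t -> 0 <= f t) ->
  RInt f a b <= RInt f a' b'.
Proof.
  intros Ha Hab Hb H Hf.
  rewrite (RInt_Chasles_pos f a' a b'), (RInt_Chasles_pos f a b b') by (auto; lra).
  pose proof (RInt_ge0_pos f a' a ltac:(lra) H Hf).
  pose proof (RInt_ge0_pos f b b' ltac:(lra) H Hf). lra.
Qed.

Lemma RInt_Rpower a b p : 0 < a <= b -> p <> 0 ->
  ex_RInt (fun t => Rpower t (p - 1)) a b /\
  RInt (fun t => Rpower t (p - 1)) a b = (Rpower b p - Rpower a p) / p.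
Proof.
  intros Hab Hp.
  assert (H : is_RInt (fun t => Rpower t (p - 1)) a b ((Rpower b p - Rpower a p) / p)).
  { pose proof (is_RInt_Rpower a b 0 p ltac:(lra) ltac:(lra) Hp) as H. rewrite !Rplus_0_l in H.
    eapply is_RInt_ext; [|exact H]. intros t _. simpl. now rewrite Rplus_0_l. }
  split; [eexists; exact H|]. now apply is_RInt_unique.
Qed.

Lemma continuous_shift_power y p q t : 0 < y -> 0 < t ->
  continuous (fun t => Rpower (y + t) p * Rpower t q) t.
Proof.
  intros Hy Ht. apply (@continuous_mult R_UniformSpace R_AbsRing).
  - apply (continuous_comp (fun t => y + t) (fun t => Rpower t p)).
    + apply (ex_derive_continuous (fun t => y + t)). auto_derive; auto.
    + apply continuous_Rpower. lra.
  - now apply continuous_Rpower.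
Qed.

(** The scale invariant integral that turns pointwise bounds into bounds after
    fractional integration in the imaginary direction. *)
Lemma power_integral s a b : 0 < b -> s < a -> exists K, 0 < K /\ forall y u v, 0 < y -> 0 < u <= v ->
  RInt (fun tau => Rpower (y + tau) (s - a - b) * Rpower tau (b - 1)) u v <= K * Rpower y (s - a).
Proof.
  intros Hb Hs.
  assert (Hib : 0 < / b) by (apply Rinv_0_lt_compat; lra).
  assert (His : 0 < / (a - s)) by (apply Rinv_0_lt_compat; lra).
  exists (/ b + / (a - s)). split; [lra|].
  intros y u v Hy Huv.
  set (f := fun tau => Rpower (y + tau) (s - a - b) * Rpower tau (b - 1)).
  assert (Hf : forall t, 0 < t -> continuous f t).
  { intros t Ht. now apply continuous_shift_power. }
  assert (Hf0 : forall t, 0 < t -> 0 <= f t).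
  { intros t Ht. apply Rlt_le, Rmult_lt_0_compat; apply Rpower_pos. }
  apply Rle_trans with (RInt f (Rmin u y) (Rmax v y)).
  { apply RInt_incl; auto; try lra; [|apply Rmax_l].
    split; [apply Rmin_glb_lt; lra|apply Rmin_l]. }
  assert (H1 : 0 < Rmin u y <= y) by (split; [apply Rmin_glb_lt; lra|apply Rmin_r]).
  pose proof (Rmax_r v y) as H2.
  rewrite (RInt_Chasles_pos f _ y) by (auto; lra).
  rewrite Rmult_plus_distr_r. apply Rplus_le_compat.
  - destruct (RInt_Rpower (Rmin u y) y b H1 ltac:(lra)) as [E1 E2].
    apply Rle_trans with (RInt (fun t => Rpower y (s - a - b) * Rpower t (b - 1)) (Rmin u y) y).
    + apply RInt_le; [lra|apply ex_RInt_pos; auto| |].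
      * apply (ex_RInt_scal (fun t => Rpower t (b - 1))). exact E1.
      * intros t Ht. apply Rmult_le_compat_r; [apply Rlt_le, Rpower_pos|].
        replace (s - a - b) with (- (a - s + b)) by ring. apply Rpower_le_neg; lra.
    + rewrite RInt_Rscal by auto. rewrite E2.
      replace (/ b * Rpower y (s - a)) with (Rpower y (s - a - b) * (Rpower y b * / b)).
      * apply Rmult_le_compat_l; [apply Rlt_le, Rpower_pos|]. apply Rmult_le_compat_r; [lra|].
        pose proof (Rpower_pos (Rmin u y) b). lra.
      * rewrite <- Rmult_assoc, <- Rpower_plus. replace (s - a - b + b) with (s - a) by ring. ring.
  - destruct (RInt_Rpower y (Rmax v y) (s - a) ltac:(lra) ltac:(lra)) as [E1 E2].
    apply Rle_trans with (RInt (fun t => Rpower t (s - a - 1)) y (Rmax v y)).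
    + apply RInt_le; [lra|apply ex_RInt_pos; auto; lra|exact E1|].
      intros t Ht. unfold f. replace (s - a - 1) with ((s - a - b) + (b - 1)) by ring.
      rewrite (Rpower_plus (s - a - b)).
      apply Rmult_le_compat_r; [apply Rlt_le, Rpower_pos|].
      replace (s - a - b) with (- (a - s + b)) by ring. apply Rpower_le_neg; lra.
    + rewrite E2.
      replace ((Rpower (Rmax v y) (s - a) - Rpower y (s - a)) / (s - a)) with
        (/ (a - s) * (Rpower y (s - a) - Rpower (Rmax v y) (s - a))) by (field; lra).
      apply Rmult_le_compat_l; [lra|]. pose proof (Rpower_pos (Rmax v y) (s - a)). lra.
Qed.

(** Truncations of the integral that gives [n^(-b)] up to a constant. *)
Definition mell_weight (b : R) (j n : nat) : R :=
  RInt (fun tau => exp (- (2 * PI * nu n * tau)) * Rpower tau (b - 1)) (/ nu j) (nu j).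

Lemma inv_nu_le j : 0 < / nu j <= 1 /\ 1 <= nu j.
Proof.
  pose proof (nu_ge1 j). split; auto. split; [apply Rinv_0_lt_compat; lra|].
  rewrite <- Rinv_1. apply Rinv_le_contravar; lra.
Qed.

Lemma CInt_mell (V : nat -> C) b j n :
  CInt (fun tau => Csum (fun k => V k * RtoC (exp (- (2 * PI * nu k * tau)) * Rpower tau (b - 1)))%C n)
    (/ nu j) (nu j) = Csum (fun k => V k * RtoC (mell_weight b j k))%C n.
Proof.
  destruct (inv_nu_le j) as [Hj1 Hj2].
  assert (Hc : forall k, ccont_on (fun tau => RtoC (exp (- (2 * PI * nu k * tau)) * Rpower tau (b - 1)))
     (/ nu j) (nu j)).
  { intros k t Ht. apply ccont_real, continuous_mell. lra. }
  rewrite (CInt_Csum (fun k tau =>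
    V k * RtoC (exp (- (2 * PI * nu k * tau)) * Rpower tau (b - 1)))%C); [|lra|].
  - apply Csum_ext. intros k _. rewrite CInt_scal; [|lra|apply Hc]. f_equal.
    unfold CInt, mell_weight, RtoC; simpl. f_equal. rewrite RInt_const.
    unfold scal; simpl; unfold mult; simpl. ring.
  - intros k _ t Ht. apply ccont_mult; [apply ccont_const|]. apply (Hc k t Ht).
Qed.

Lemma continuous_mell1 b tau : 0 < tau -> continuous (mell b) tau.
Proof.
  intros H. apply continuous_ext with (f := fun tau => exp (- (2 * PI * 1 * tau)) * Rpower tau (b - 1)).
  - intros t. unfold mell. do 3 f_equal. ring.
  - now apply continuous_mell.
Qed.

Lemma mell_bounded b : 0 < b -> exists B, forall u v, 0 < u <= v -> RInt (mell b) u v <= B.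
Proof.
  intros Hb. pose proof PI_RGT_0 as HPI.
  destruct (Rpower_exp_bound (b + 1) (2 * PI)) as [K [HK H]]; [lra|lra|].
  assert (Hib : 0 < / b) by (apply Rinv_0_lt_compat; lra).
  exists (/ b + K). intros u v Huv.
  assert (Hf0 : forall t, 0 < t -> 0 <= mell b t).
  { intros t Ht. apply Rlt_le, Rmult_lt_0_compat; [apply exp_pos|apply Rpower_pos]. }
  apply Rle_trans with (RInt (mell b) (Rmin u 1) (Rmax v 1)).
  { apply RInt_incl; auto; try lra; try apply Rmax_l; try apply continuous_mell1.
    split; [apply Rmin_glb_lt; lra|apply Rmin_l]. }
  assert (H1 : 0 < Rmin u 1 <= 1) by (split; [apply Rmin_glb_lt; lra|apply Rmin_r]).
  pose proof (Rmax_r v 1) as H2.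
  rewrite (RInt_Chasles_pos _ _ 1) by (auto; try lra; apply continuous_mell1).
  apply Rplus_le_compat.
  - destruct (RInt_Rpower (Rmin u 1) 1 b H1 ltac:(lra)) as [E1 E2].
    apply Rle_trans with (RInt (fun t => Rpower t (b - 1)) (Rmin u 1) 1).
    + apply RInt_le; [lra|apply ex_RInt_pos; auto; apply continuous_mell1|exact E1|].
      intros t Ht. unfold mell. rewrite <- (Rmult_1_l (Rpower t (b - 1))) at 2.
      apply Rmult_le_compat_r; [apply Rlt_le, Rpower_pos|]. rewrite <- exp_0. apply exp_le_mono. nra.
    + rewrite E2, Rpower_1_base. pose proof (Rpower_pos (Rmin u 1) b). unfold Rdiv. nra.
  - destruct (RInt_Rpower 1 (Rmax v 1) (- (1)) ltac:(lra) ltac:(lra)) as [E1 E2].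
    apply Rle_trans with (RInt (fun t => K * Rpower t (- (1) - 1)) 1 (Rmax v 1)).
    + apply RInt_le; [lra|apply ex_RInt_pos; try lra; apply continuous_mell1| |].
      * apply (ex_RInt_scal (fun t => Rpower t (- (1) - 1))). exact E1.
      * intros t Ht. unfold mell. specialize (H t ltac:(lra)).
        replace (b - 1) with ((b + 1) + (- (1) - 1)) by ring. rewrite Rpower_plus.
        rewrite <- Rmult_assoc. apply Rmult_le_compat_r; [apply Rlt_le, Rpower_pos|].
        rewrite exp_Ropp. pose proof (exp_pos (2 * PI * t)).
        apply Rmult_le_reg_l with (exp (2 * PI * t)); auto.
        rewrite <- Rmult_assoc, Rinv_r, Rmult_1_l by lra. lra.
    + rewrite RInt_Rscal by auto. rewrite E2, Rpower_1_base.
      pose proof (Rpower_pos (Rmax v 1) (- (1))). 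
      replace ((Rpower (Rmax v 1) (- (1)) - 1) / - (1)) with (1 - Rpower (Rmax v 1) (- (1))) by field.
      nra.
Qed.

(** Homogeneity: the substitution [tau -> n tau] reduces all weights to one integral. *)
Lemma mell_scale b j n : mell_weight b j n =
  Rpower (nu n) (- b) * RInt (mell b) (nu n * / nu j) (nu n * nu j).
Proof.
  pose proof (nu_pos n) as Hn. destruct (inv_nu_le j) as [Hj1 Hj2].
  assert (E := RInt_comp_lin (V := R_CompleteNormedModule) (mell b) (nu n) 0 (/ nu j) (nu j)).
  rewrite !Rplus_0_r in E. rewrite <- E.
  2:{ apply ex_RInt_pos; [nra|]. apply continuous_mell1. }
  assert (EI : ex_RInt (fun tau => exp (- (2 * PI * nu n * tau)) * Rpower tau (b - 1)) (/ nu j) (nu j)).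
  { apply ex_RInt_pos; [lra|]. intros; now apply continuous_mell. }
  rewrite (RInt_ext _ (fun tau => Rpower (nu n) b * (exp (- (2 * PI * nu n * tau)) * Rpower tau (b - 1)))).
  - rewrite RInt_Rscal by exact EI. rewrite <- Rmult_assoc, <- Rpower_plus.
    rewrite Rplus_opp_l, Rpower_O, Rmult_1_l by auto. reflexivity.
  - intros t Ht. rewrite Rmin_left in Ht by lra.
    unfold scal; simpl; unfold mult; simpl. unfold mell. rewrite Rplus_0_r.
    rewrite <- Rpower_mult_distr by lra. unfold Rminus. rewrite (Rpower_plus b (- (1)) (nu n)).
    rewrite (Rpower_Ropp (nu n) 1), Rpower_1 by auto.
    replace (2 * PI * nu n * t) with (2 * PI * (nu n * t)) by ring. field. lra.
Qed.

(** The truncated integrals increase with [j], and by homogeneity those for different [n] are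
    interleaved up to the factor [n^(-b)]; [Gm] is a value of the Gamma function up to a power
    of [2 pi]. *)
Lemma mell_limit b : 0 < b -> exists Gm, 0 < Gm /\ forall n,
  is_lim_seq (fun j => mell_weight b j n) (Gm * Rpower (nu n) (- b)).
Proof.
  intros Hb. destruct (mell_bounded b Hb) as [B HB].
  assert (Hf0 : forall t, 0 < t -> 0 <= mell b t).
  { intros t Ht. apply Rlt_le, Rmult_lt_0_compat; [apply exp_pos|apply Rpower_pos]. }
  set (J := fun j => RInt (mell b) (/ nu j) (nu j)).
  assert (HJ : forall i j, (i <= j)%nat -> J i <= J j).
  { intros i j Hij. destruct (inv_nu_le i), (inv_nu_le j). pose proof (nu_le i j Hij).
    apply RInt_incl; auto; try lra; try apply continuous_mell1.
    split; [lra|]. apply Rinv_le_contravar; lra. }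
  destruct (ex_finite_lim_seq_incr J B) as [Gm HG].
  { intros j. apply HJ. lia. }
  { intros j. destruct (inv_nu_le j). apply HB. lra. }
  assert (HJG : forall j, J j <= Gm) by (apply is_lim_seq_incr_compare; auto).
  exists Gm. split.
  { apply Rlt_le_trans with (J 1%nat); [|apply HJG]. unfold J. destruct (inv_nu_le 1) as [A1 A2].
    assert (A3 : nu 1 = 2) by (unfold nu; simpl; ring). rewrite A3 in *.
    apply RInt_gt_0; [lra| |].
    - intros t Ht. apply Rmult_lt_0_compat; [apply exp_pos|apply Rpower_pos].
    - intros t Ht. apply continuous_mell1. lra. }
  intros n.
  assert (L : is_lim_seq (fun j => RInt (mell b) (nu n * / nu j) (nu n * nu j)) Gm).
  { pose proof (nu_ge1 n) as Hn.
    apply is_lim_seq_spec. intros eps. apply is_lim_seq_spec in HG. destruct (HG eps) as [i Hi].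
    specialize (Hi i (Nat.le_refl i)).
    destruct (inv_nu_le i) as [Hi1 Hi2].
    destruct (lim0_ev (fun j => / nu j) (/ (nu n * nu i)) lim_inv_INR) as [N HN].
    { apply Rinv_0_lt_compat. nra. }
    exists N. intros j Hj. specialize (HN j Hj). simpl in HN.
    destruct (inv_nu_le j) as [Hj1 Hj2].
    rewrite Rabs_pos_eq in HN by lra.
    assert (Hnij : nu n * nu i <= nu j).
    { rewrite <- (Rinv_inv (nu j)), <- (Rinv_inv (nu n * nu i)).
      apply Rlt_le, Rinv_lt_contravar; [|auto].
      apply Rmult_lt_0_compat; [lra|]. apply Rinv_0_lt_compat. nra. }
    assert (U : RInt (mell b) (nu n * / nu j) (nu n * nu j) <= Gm).
    { destruct (lim0_ev (fun j => / nu j) (/ (nu n * nu j)) lim_inv_INR) as [M HM].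
      { apply Rinv_0_lt_compat. nra. }
      specialize (HM M (Nat.le_refl M)). simpl in HM.
      destruct (inv_nu_le M) as [HM1 HM2]. rewrite Rabs_pos_eq in HM by lra.
      assert (nu n * nu j <= nu M).
      { rewrite <- (Rinv_inv (nu M)), <- (Rinv_inv (nu n * nu j)).
        apply Rlt_le, Rinv_lt_contravar; [|auto].
        apply Rmult_lt_0_compat; [lra|]. apply Rinv_0_lt_compat. nra. }
      eapply Rle_trans; [|apply (HJG M)]. apply RInt_incl; auto; try apply continuous_mell1.
      - split; [lra|]. apply Rle_trans with (/ (nu n * nu j)); [lra|].
        rewrite Rinv_mult. apply Rmult_le_compat_r; [lra|].
        apply Rle_trans with (/ 1); [apply Rinv_le_contravar; lra|lra].
      - apply Rmult_le_compat_l; lra. }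
    assert (Lo : J i <= RInt (mell b) (nu n * / nu j) (nu n * nu j)).
    { apply RInt_incl; auto; try apply continuous_mell1.
      - split; [apply Rmult_lt_0_compat; lra|].
        apply Rmult_le_reg_r with (nu i); [lra|]. rewrite Rinv_l by lra.
        apply Rmult_le_reg_r with (nu j); [lra|].
        replace (nu n * / nu j * nu i * nu j) with (nu n * nu i) by (field; lra). lra.
      - lra.
      - nra. }
    apply Rabs_def2 in Hi. apply Rabs_def1; lra. }
  apply is_lim_seq_ext with (fun j => Rpower (nu n) (- b) * RInt (mell b) (nu n * / nu j) (nu n * nu j)).
  - intros j. symmetry. apply mell_scale.
  - rewrite Rmult_comm.
    change (Finite (Rpower (nu n) (- b) * Gm)) with (Rbar_mult (Rpower (nu n) (- b)) Gm).
    apply is_lim_seq_scal_l. exact L.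
Qed.

Lemma mell_weight_incr (f : R -> R) i j :
  (forall t, 0 < t -> continuous f t) -> (forall t, 0 < t -> 0 <= f t) -> (i <= j)%nat ->
  RInt (fun t => f t) (/ nu i) (nu i) <= RInt f (/ nu j) (nu j).
Proof.
  intros Hc H0 Hij. destruct (inv_nu_le i), (inv_nu_le j). pose proof (nu_le i j Hij).
  apply RInt_incl; auto; try lra. split; [lra|]. apply Rinv_le_contravar; lra.
Qed.

(** The truncated weights satisfy the hypotheses of [abel_tail] uniformly in [j], because
    they and their differences are integrals of nonnegative functions over growing
    intervals. *)
Lemma mell_weight_ok b Gm : 0 < b ->
  (forall n, is_lim_seq (fun j => mell_weight b j n) (Gm * Rpower (nu n) (- b))) ->
  forall j n, 0 <= mell_weight b j n <= Gm * Rpower (nu n) (- b) /\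
   0 <= mell_weight b j n - mell_weight b j (S n) <=
     Gm * (Rpower (nu n) (- b) - Rpower (nu (S n)) (- b)).
Proof.
  intros Hb HG j n. pose proof PI_RGT_0 as HPI.
  assert (Hp : forall k t, 0 <= exp (- (2 * PI * nu k * t)) * Rpower t (b - 1)).
  { intros k t. apply Rlt_le, Rmult_lt_0_compat; [apply exp_pos|apply Rpower_pos]. }
  assert (Hc : forall k t, 0 < t -> continuous (fun t => exp (- (2 * PI * nu k * t)) * Rpower t (b - 1)) t).
  { intros; now apply continuous_mell. }
  assert (Hex : forall k i, ex_RInt (fun t => exp (- (2 * PI * nu k * t)) * Rpower t (b - 1)) (/ nu i) (nu i)).
  { intros k i. destruct (inv_nu_le i). apply ex_RInt_pos; [lra|apply Hc]. }
  set (D := fun t => exp (- (2 * PI * nu n * t)) * Rpower t (b - 1) -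
     exp (- (2 * PI * nu (S n) * t)) * Rpower t (b - 1)).
  assert (ED : forall i, mell_weight b i n - mell_weight b i (S n) = RInt D (/ nu i) (nu i)).
  { intros i. symmetry.
    apply (RInt_minus (fun t => exp (- (2 * PI * nu n * t)) * Rpower t (b - 1))
      (fun t => exp (- (2 * PI * nu (S n) * t)) * Rpower t (b - 1))); auto. }
  assert (HD0 : forall t, 0 < t -> 0 <= D t).
  { intros t Ht. unfold D. rewrite <- Rmult_minus_distr_r. apply Rmult_le_pos; [|apply Rlt_le, Rpower_pos].
    assert (exp (- (2 * PI * nu (S n) * t)) <= exp (- (2 * PI * nu n * t))); [|lra].
    apply exp_le_mono. rewrite nu_S. nra. }
  assert (HDc : forall t, 0 < t -> continuous D t).
  { intros t Ht. apply (continuous_minus (fun t => exp (- (2 * PI * nu n * t)) * Rpower t (b - 1))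
      (fun t => exp (- (2 * PI * nu (S n) * t)) * Rpower t (b - 1))); apply Hc; auto. }
  destruct (inv_nu_le j) as [Hj1 Hj2].
  split; split.
  - apply RInt_ge0_pos; auto; lra.
  - apply (is_lim_seq_incr_compare (fun j => mell_weight b j n)); auto. intros i.
    apply (mell_weight_incr); auto.
  - rewrite ED. apply RInt_ge0_pos; auto; lra.
  - rewrite Rmult_minus_distr_l.
    apply (is_lim_seq_incr_compare (fun j => mell_weight b j n - mell_weight b j (S n))).
    + apply is_lim_seq_minus'; apply HG.
    + intros i. rewrite !ED. apply (mell_weight_incr); auto.
Qed.

Lemma Csum_weight_lim (V : nat -> C) (W : nat -> nat -> R) (L : nat -> R) n :
  (forall k, is_lim_seq (fun j => W j k) (L k)) ->
  is_lim_seq (fun j => Cmod (Csum (fun k => V k * RtoC (W j k - L k))%C n)) 0.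
Proof.
  intros H. induction n as [|n IH].
  - apply is_lim_seq_ext with (fun _ => 0); [intros; simpl; now rewrite Cmod_0|apply is_lim_seq_const].
  - apply is_lim_seq_le_le with (u := fun _ => 0)
      (w := fun j => Cmod (Csum (fun k => V k * RtoC (W j k - L k))%C n) +
               Cmod (V n) * Rabs (W j n - L n)).
    + intros j. split; [apply Cmod_ge_0|]. simpl. eapply Rle_trans; [apply Cmod_triangle|].
      rewrite (Cmod_mult (V n)), Cmod_R. apply Rle_refl.
    + apply is_lim_seq_const.
    + replace (Finite 0) with (Finite (0 + Cmod (V n) * Rabs (L n - L n))).
      2:{ f_equal. rewrite Rminus_diag, Rabs_R0. ring. }
      apply is_lim_seq_plus'; auto.
      apply (is_lim_seq_scal_l _ (Cmod (V n)) (Finite _)). apply (is_lim_seq_abs _ (Finite _)).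
      apply is_lim_seq_minus'; [apply H|apply is_lim_seq_const].
Qed.

(** * Boundary regularity controls the form *)

Lemma npt_has_coef Q x : npt Q -> has_coef (fun t => Q (t - x)) (fun _ => RtoC 0).
Proof.
  intros H n b. rewrite <- (npt_coef Q H x 0 n b). apply CInt_ext; [lra|].
  intros t _. do 2 f_equal. simpl INR. ring.
Qed.

Lemma has_coef_minus h k c d : (forall t, ccont h t) -> (forall t, ccont k t) ->
  has_coef h c -> has_coef k d -> has_coef (fun t => h t - k t)%C (fun n => c n - d n)%C.
Proof.
  intros Hh Hk Hc Hd n b. rewrite <- (Hc n b), <- (Hd n b).
  rewrite <- CInt_minus; [|lra| |].
  - apply CInt_ext; [lra|]. intros; ring.
  - intros t _. apply ccont_mult; [auto|apply ccont_cis_scal].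
  - intros t _. apply ccont_mult; [auto|apply ccont_cis_scal].
Qed.

Lemma exists_nat_gt (x : R) : exists n : nat, x < INR n.
Proof. destruct (INR_unbounded x) as [n Hn]. exists n. lra. Qed.

Lemma pow_le_Rpower t s N : 0 < t <= 1 -> s <= INR N -> t ^ N <= Rpower t s.
Proof. intros Ht Hs. rewrite <- Rpower_pow by lra. now apply Rpower_anti. Qed.

(** After subtraction of a trigonometric polynomial, [g] is [O(|t|^s)] around [x]; the kernel
    bound controls the derivatives of order [m] of its extension at all heights [y + tau], and
    integration against [tau^(m - a - 1)] recovers the form at height [y].  The constant does
    not depend on [x], which the local exponent requires. *)
Lemma boundary_regularity_bound (c : nat -> C) (g : R -> C) (kap : C) (a s M0 M del : R) (d : nat) :
  subexp c -> 0 < a -> kap <> RtoC 0 -> (forall t, ccont g t) ->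
  has_coef g (fun n => kap * fal_coef c a n)%C ->
  (forall t, Cmod (g t) <= M0) -> 0 < s < a -> 0 < del <= 1 -> 0 <= M ->
  exists K, 0 <= K /\ forall (x : R) p, (forall j, (j < d)%nat -> Cmod (p j) <= M) ->
    (forall t, Rabs t <= del -> t <> 0 ->
       Cmod (g (x + t)%R - Csum (fun j => p j * RtoC (t ^ j))%C d)%C <= M * Rpower (Rabs t) s) ->
    g x = Csum (fun j => p j * RtoC (0 ^ j))%C d ->
    forall u y, Rabs u <= 1 / 2 -> 0 < y ->
    Cmod (ser c (x + u) y) <= K * (Rpower ((y + Rabs u) / y) s * Rpower y (s - a)).
Proof.
  intros Hc Ha Hkap Hg Hco HM0 Hs Hdel HM.
  destruct (exists_nat_gt (Rmax 1 s)) as [N HN].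
  assert (HN1 : 1 < INR N) by (eapply Rle_lt_trans; [apply Rmax_l|apply HN]).
  assert (HNs : s <= INR N) by (apply Rlt_le; eapply Rle_lt_trans; [apply Rmax_r|apply HN]).
  destruct (npt_approx_poly N d) as [KQ [HKQ HQ]].
  destruct (exists_nat_gt a) as [m Hm].
  (* [m] derivatives, compensated by a fractional integration of order [b] *)
  set (b := INR m - a). assert (Hb : 0 < b) by (unfold b; lra).
  destruct (fourier_bound m s ltac:(lra)) as [KF [HKF HF]].
  destruct (power_integral s a b Hb ltac:(lra)) as [KI [HKI HI]].
  destruct (mell_limit b Hb) as [Gm [HGm HG]].
  assert (HM00 : 0 <= M0) by (eapply Rle_trans; [apply (Cmod_ge_0 (g 0))|apply HM0]).
  set (Mh := (M0 + KQ * M) * / Rpower del s + M + KQ * M).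
  assert (HKM : 0 <= KQ * M) by (apply Rmult_le_pos; auto).
  assert (Hids : 0 < / Rpower del s) by (apply Rinv_0_lt_compat, Rpower_pos).
  assert (HMh : 0 <= Mh).
  { unfold Mh. assert (0 <= (M0 + KQ * M) * / Rpower del s) by (apply Rmult_le_pos; lra). lra. }
  assert (Hkp : 0 < Cmod kap) by (now apply Cmod_gt_0).
  exists (KF * Mh * KI * / (Cmod kap * Gm)).
  assert (Hikg : 0 < / (Cmod kap * Gm)) by (apply Rinv_0_lt_compat, Rmult_lt_0_compat; auto).
  split. { apply Rmult_le_pos; [|lra]. apply Rmult_le_pos; [|lra]. apply Rmult_le_pos; lra. }
  intros x p Hp Happ Hgx u y Hu Hy.
  destruct (HQ p M HM Hp) as [Q [HQn [HQb HQa]]].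
  set (h := fun t => (g t - Q (t - x)%R)%C).
  assert (HQc : forall t, ccont (fun t => Q (t - x)) t).
  { intros t. apply (ccont_comp (fun t => t - x) Q); [|apply npt_ccont; auto].
    apply (ex_derive_continuous (fun t => t - x)). auto_derive; auto. }
  assert (Hh : forall t, ccont h t) by (intros t; apply ccont_minus; auto).
  assert (Hhc : has_coef h (fun n => kap * fal_coef c a n - RtoC 0)%C).
  { apply (has_coef_minus g (fun t => Q (t - x))); auto. now apply npt_has_coef. }
  assert (Hhx : h x = RtoC 0).
  { unfold h. rewrite Rminus_diag. specialize (HQa 0). rewrite Rabs_R0 in HQa.
    specialize (HQa ltac:(lra)). rewrite <- Hgx in HQa.
    rewrite pow_i in HQa by (apply INR_lt; simpl; lra). rewrite Rmult_0_r in HQa.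
    apply Cmod_eq_0. apply Rle_antisym; [auto|apply Cmod_ge_0]. }
  assert (Hhb : forall t, Rabs t <= 1 -> t <> 0 -> Cmod (h (x + t)) <= Mh * Rpower (Rabs t) s).
  { intros t Ht Ht0. assert (Hat : 0 < Rabs t) by (now apply Rabs_pos_lt).
    unfold h. replace (x + t - x) with t by ring.
    destruct (Rle_dec (Rabs t) del) as [Htd|Htd].
    - replace (g (x + t)%R - Q t)%C with ((g (x + t)%R - Csum (fun j => p j * RtoC (t ^ j)) d) +
        (Csum (fun j => p j * RtoC (t ^ j)) d - Q t))%C by ring.
      eapply Rle_trans; [apply Cmod_triangle|].
      specialize (Happ t Htd Ht0). specialize (HQa t Ht).
      pose proof (pow_le_Rpower (Rabs t) s N (conj Hat Ht) HNs).
      assert (KQ * M * Rabs t ^ N <= KQ * M * Rpower (Rabs t) s) by (apply Rmult_le_compat_l; auto).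
      assert (0 <= (M0 + KQ * M) * / Rpower del s * Rpower (Rabs t) s).
      { apply Rmult_le_pos; [apply Rmult_le_pos; lra|apply Rlt_le, Rpower_pos]. }
      unfold Mh. lra.
    - unfold Cminus. eapply Rle_trans; [apply Cmod_triangle|]. rewrite Cmod_opp.
      specialize (HM0 (x + t)). specialize (HQb t).
      apply Rle_trans with ((M0 + KQ * M) * / Rpower del s * Rpower (Rabs t) s).
      + rewrite Rmult_assoc. rewrite <- (Rmult_1_r (Cmod (g (x + t)) + Cmod (Q t))).
        apply Rmult_le_compat; try lra.
        * pose proof (Cmod_ge_0 (g (x + t))). pose proof (Cmod_ge_0 (Q t)). lra.
        * apply Rmult_le_reg_l with (Rpower del s); [apply Rpower_pos|].
          rewrite <- Rmult_assoc, Rinv_r, Rmult_1_l, Rmult_1_r by (apply Rgt_not_eq, Rpower_pos).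
          apply Rle_Rpower_l; lra.
      + unfold Mh. pose proof (Rpower_pos (Rabs t) s).
        assert (0 <= (M + KQ * M) * Rpower (Rabs t) s) by (apply Rmult_le_pos; lra). lra. }
  (* [|u| + |t| <= lam (y + |t|)], the form in which the kernel bound applies *)
  set (lam := (y + Rabs u) / y).
  pose proof (Rabs_pos u) as Hu0.
  assert (Hlam : 1 <= lam).
  { unfold lam. apply Rmult_le_reg_r with y; auto. field_simplify; lra. }
  destruct (HF y Hy) as [N0 HN0].
  set (B := KF * Mh * KI * (Rpower lam s * Rpower y (s - a))).
  (* The truncated sums are bounded before the limit in the Mellin weight is taken. *)
  assert (Hmain : forall n, (N0 <= n)%nat ->
     Cmod kap * Gm * Cmod (Csum (ser_term c (x + u) y) n) <= B).
  { intros n Hn.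
    set (T := fun tau => Csum (fun k => RtoC (nu k ^ m) *
        ser_term (fun n => kap * fal_coef c a n - RtoC 0)%C (x + u) (y + tau) k)%C n).
    assert (HT : forall tau, 0 <= tau ->
       Cmod (T tau) <= KF * Mh * Rpower lam s * Rpower (y + tau) (s - INR m)).
    { intros tau Htau. unfold T.
      eapply Rle_trans; [apply (HN0 n Hn (y + tau) (x + u) h _ (Mh * Rpower lam s)); auto|].
      - lra.
      - apply Rmult_le_pos; [auto|apply Rlt_le, Rpower_pos].
      - intros t Ht. pose proof (Rabs_pos t) as Ht0. rewrite Rplus_assoc.
        destruct (Req_dec (u + t) 0) as [E|E].
        + rewrite E, Rplus_0_r, Hhx, Cmod_0. apply Rmult_le_pos; [|apply Rlt_le, Rpower_pos].
          apply Rmult_le_pos; [auto|apply Rlt_le, Rpower_pos].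
        + eapply Rle_trans; [apply Hhb; auto|].
          * eapply Rle_trans; [apply Rabs_triang|]. lra.
          * rewrite Rmult_assoc. apply Rmult_le_compat_l; auto.
            rewrite Rpower_mult_distr by lra. apply Rle_Rpower_l; [lra|].
            split; [now apply Rabs_pos_lt|].
            eapply Rle_trans; [apply Rabs_triang|].
            unfold lam. apply Rmult_le_reg_r with y; auto.
            replace ((y + Rabs u) / y * (y + tau + Rabs t) * y) with
              ((y + Rabs u) * (y + tau + Rabs t)) by (field; lra). nra.
      - right; ring. }
    assert (HTc : forall tau, 0 < tau -> ccont T tau).
    { intros tau _. unfold T.
      apply (ccont_Csum (fun k tau => RtoC (nu k ^ m) *
        ser_term (fun n => kap * fal_coef c a n - RtoC 0)%C (x + u) (y + tau) k)%C).
      intros k _. apply ccont_mult; [apply ccont_const|].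
      apply (ccont_comp (fun tau => y + tau)
        (fun y => ser_term (fun n => kap * fal_coef c a n - RtoC 0)%C (x + u) y k));
        [|apply ccont_ser_term_y].
      apply (ex_derive_continuous (fun t => y + t)). auto_derive; auto. }
    set (W := fun j k => mell_weight b j k).
    assert (HJ : forall j, Cmod (Csum (fun k => RtoC (nu k ^ m) *
        ser_term (fun n => kap * fal_coef c a n - RtoC 0)%C (x + u) y k * RtoC (W j k))%C n) <= B).
    { intros j. destruct (inv_nu_le j) as [Hj1 Hj2].
      replace (Csum (fun k => RtoC (nu k ^ m) *
        ser_term (fun n => kap * fal_coef c a n - RtoC 0)%C (x + u) y k * RtoC (W j k))%C n)
       with (CInt (fun tau => T tau * RtoC (Rpower tau (b - 1)))%C (/ nu j) (nu j)).
      - eapply Rle_trans; [apply CInt_bound with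
          (g := fun tau => (KF * Mh * Rpower lam s) *
              (Rpower (y + tau) (s - a - b) * Rpower tau (b - 1)))|].
        + lra.
        + intros t Ht. apply ccont_mult; [apply HTc; lra|]. apply ccont_real.
          apply continuous_Rpower. lra.
        + apply (ex_RInt_scal (fun tau => Rpower (y + tau) (s - a - b) * Rpower tau (b - 1))).
          apply ex_RInt_pos; [lra|]. intros t Ht.
          now apply continuous_shift_power.
        + intros t Ht. rewrite Cmod_mult, Cmod_R, Rabs_pos_eq by (apply Rlt_le, Rpower_pos).
          rewrite <- Rmult_assoc. apply Rmult_le_compat_r; [apply Rlt_le, Rpower_pos|].
          replace (s - a - b) with (s - INR m) by (unfold b; ring). apply HT. lra.
        + rewrite RInt_Rscal.
          * eapply Rle_trans; [apply Rmult_le_compat_l; [|apply HI; [auto|lra]]|].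
            -- apply Rmult_le_pos; [apply Rmult_le_pos; lra|apply Rlt_le, Rpower_pos].
            -- unfold B. right; ring.
          * apply ex_RInt_pos; [lra|]. intros t Ht.
            now apply continuous_shift_power.
      - transitivity (CInt (fun tau => Csum (fun k => (RtoC (nu k ^ m) *
          ser_term (fun n => kap * fal_coef c a n - RtoC 0)%C (x + u) y k) *
          RtoC (exp (- (2 * PI * nu k * tau)) * Rpower tau (b - 1)))%C n) (/ nu j) (nu j)).
        + apply CInt_ext; [lra|]. intros t Ht. unfold T. rewrite Cmult_comm, <- Csum_scal.
          apply Csum_ext. intros k _. unfold ser_term.
          replace (- (2 * PI * nu k * (y + t))) with (- (2 * PI * nu k * y) + - (2 * PI * nu k * t)) by ring.
          rewrite exp_plus, !RtoC_mult. ring.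
        + apply (CInt_mell (fun k => RtoC (nu k ^ m) *
            ser_term (fun n => kap * fal_coef c a n - RtoC 0) (x + u) y k)%C). }
    (* For fixed [n] the sum is finite and the Mellin truncation can be removed. *)
    assert (E : forall k, (RtoC (nu k ^ m) *
        ser_term (fun n => kap * fal_coef c a n - RtoC 0)%C (x + u) y k *
        RtoC (Gm * Rpower (nu k) (- b)))%C = (kap * RtoC Gm * ser_term c (x + u) y k)%C).
    { intros k. unfold ser_term, fal_coef.
      assert (EE : nu k ^ m * Rpower (nu k) (- a) * Rpower (nu k) (- b) = 1).
      { rewrite <- Rpower_pow by apply nu_pos. rewrite <- !Rpower_plus.
        replace (INR m + - a + - b) with 0 by (unfold b; ring). apply Rpower_O, nu_pos. }
      transitivity (RtoC (nu k ^ m * Rpower (nu k) (- a) * Rpower (nu k) (- b)) * (kap * RtoC Gm * (c k *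
        RtoC (exp (- (2 * PI * nu k * y))) * cis (nu k * (x + u)))))%C.
      - rewrite !RtoC_mult. ring.
      - rewrite EE. ring. }
    set (V := fun k => (RtoC (nu k ^ m) *
        ser_term (fun n => kap * fal_coef c a n - RtoC 0)%C (x + u) y k)%C).
    assert (Hlim : is_lim_seq (fun j => Cmod (Csum (fun k => V k *
       RtoC (W j k - Gm * Rpower (nu k) (- b)))%C n)) 0).
    { apply (Csum_weight_lim V W (fun k => Gm * Rpower (nu k) (- b))). intros k; apply HG. }
    apply le_of_le_lim0 with (1 := Hlim). exists 0%nat. intros j _.
    replace (Cmod kap * Gm * Cmod (Csum (ser_term c (x + u) y) n)) with
      (Cmod (Csum (fun k => V k * RtoC (Gm * Rpower (nu k) (- b)))%C n)).
    2:{ rewrite (Csum_ext _ (fun k => kap * RtoC Gm * ser_term c (x + u) y k)%C) by (intros; apply E).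
        rewrite Csum_scal, !Cmod_mult, Cmod_R, Rabs_pos_eq by lra. reflexivity. }
    replace (Csum (fun k => V k * RtoC (Gm * Rpower (nu k) (- b)))%C n) with
     (Csum (fun k => V k * RtoC (W j k))%C n -
      Csum (fun k => V k * RtoC (W j k - Gm * Rpower (nu k) (- b)))%C n)%C.
    2:{ rewrite <- Csum_minus. apply Csum_ext. intros k _. rewrite RtoC_minus. ring. }
    unfold Cminus. eapply Rle_trans; [apply Cmod_triangle|]. rewrite Cmod_opp.
    apply Rplus_le_compat_r. apply HJ. }
  assert (Hkg : 0 < Cmod kap * Gm) by (apply Rmult_lt_0_compat; auto).
  apply Rmult_le_reg_l with (Cmod kap * Gm); auto.
  replace (Cmod kap * Gm * (KF * Mh * KI * / (Cmod kap * Gm) * (Rpower lam s * Rpower y (s - a))))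
   with B by (unfold B; field; lra).
  destruct (ser_rate c y Hc Hy) as [e [He [_ HeS]]].
  apply le_of_le_lim0 with (e := fun n => Cmod kap * Gm * e n).
  { replace (Finite 0) with (Rbar_mult (Cmod kap * Gm) (Finite 0)) by (simpl; f_equal; ring).
    apply is_lim_seq_scal_l; auto. }
  exists N0. intros n Hn. specialize (Hmain n Hn). specialize (HeS (x + u) y n (Rle_refl y)).
  apply Rle_trans with (Cmod kap * Gm * (Cmod (Csum (ser_term c (x + u) y) n) + e n)).
  - apply Rmult_le_compat_l; [lra|].
    replace (ser c (x + u) y) with (Csum (ser_term c (x + u) y) n +
      (ser c (x + u) y - Csum (ser_term c (x + u) y) n))%C by ring.
    eapply Rle_trans; [apply Cmod_triangle|]. lra.
  - rewrite Rmult_plus_distr_l. apply Rplus_le_compat_r. exact Hmain.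
Qed.

(** * Mellin transform and Taylor coefficients *)

Lemma ser_weighted_ccont c x b tau : subexp c -> 0 < tau ->
  ccont (fun tau => ser c x tau * RtoC (Rpower tau (b - 1)))%C tau.
Proof.
  intros Hc Ht. apply ccont_mult; [now apply ser_ccont_y|].
  apply ccont_real. now apply continuous_Rpower.
Qed.

(** Away from the real axis the series converges uniformly in [tau] and may be integrated
    term by term. *)
Lemma ser_mellin_truncated c x b j : subexp c -> 0 < b ->
  is_lim_seq (fun n => Cmod (CInt (fun tau => ser c x tau * RtoC (Rpower tau (b - 1)))%C (/ nu j) (nu j)
    - Csum (fun k => c k * cis (nu k * x) * RtoC (mell_weight b j k))%C n)%C) 0.
Proof.
  intros Hc Hb. destruct (inv_nu_le j) as [Hj1 Hj2].
  destruct (ser_rate c (/ nu j) Hc (proj1 Hj1)) as [e [He [_ H]]].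
  destruct (RInt_Rpower (/ nu j) (nu j) b ltac:(lra) ltac:(lra)) as [E1 E2].
  set (I := RInt (fun t => Rpower t (b - 1)) (/ nu j) (nu j)).
  apply is_lim_seq_le_le with (u := fun _ => 0) (w := fun n => e n * I).
  - intros n. split; [apply Cmod_ge_0|].
    set (S := fun tau => (Csum (ser_term c x tau) n * RtoC (Rpower tau (b - 1)))%C).
    assert (HS : ccont_on S (/ nu j) (nu j)).
    { intros t Ht. apply ccont_mult; [|apply ccont_real, continuous_Rpower; lra].
      apply (ccont_Csum (fun k t => ser_term c x t k)). intros; apply ccont_ser_term_y. }
    assert (HF : ccont_on (fun tau => ser c x tau * RtoC (Rpower tau (b - 1)))%C (/ nu j) (nu j)).
    { intros t Ht. apply ser_weighted_ccont; auto; lra. }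
    replace (Csum (fun k => c k * cis (nu k * x) * RtoC (mell_weight b j k))%C n)
      with (CInt S (/ nu j) (nu j)).
    + rewrite <- CInt_minus; [|lra|auto|auto].
      unfold I. rewrite <- RInt_Rscal by auto. apply CInt_bound; [lra| | |].
      * intros t Ht. apply ccont_minus; auto.
      * apply (ex_RInt_scal (fun t => Rpower t (b - 1))). auto.
      * intros t Ht. unfold S.
        replace (ser c x t * RtoC (Rpower t (b - 1)) - Csum (ser_term c x t) n * RtoC (Rpower t (b - 1)))%C
          with ((ser c x t - Csum (ser_term c x t) n) * RtoC (Rpower t (b - 1)))%C by ring.
        rewrite Cmod_mult, Cmod_R, Rabs_pos_eq by (apply Rlt_le, Rpower_pos).
        apply Rmult_le_compat_r; [apply Rlt_le, Rpower_pos|]. apply H. lra.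
    + rewrite <- (CInt_mell (fun k => c k * cis (nu k * x))%C). apply CInt_ext; [lra|].
      intros t Ht. unfold S. rewrite Cmult_comm, <- Csum_scal.
      apply Csum_ext. intros k _. unfold ser_term. rewrite RtoC_mult. ring.
  - apply is_lim_seq_const.
  - replace (Finite 0) with (Rbar_mult (Finite 0) I) by (simpl; f_equal; ring).
    apply is_lim_seq_scal_r. exact He.
Qed.

(** The fractional integral as a Mellin transform in the imaginary direction, valid up
    to the real line although the series there converges only conditionally. *)
Lemma fal_mellin c r0 a Gm : subexp c -> power_sums c r0 -> r0 < a -> 0 < Gm ->
  (forall n, is_lim_seq (fun j => mell_weight a j n) (Gm * Rpower (nu n) (- a))) ->
  forall x, is_lim_seq (fun j => Cmod (CInt (fun tau => ser c x tau * RtoC (Rpower tau (a - 1)))%C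
     (/ nu j) (nu j) - RtoC Gm * fal c a x)%C) 0.
Proof.
  intros Hc Hps Ha HGm HG x. assert (Hr0 : 0 <= r0) by apply Hps.
  assert (Hb : 0 < a) by lra.
  set (rho := (r0 + a) / 2). assert (Hrho : r0 < rho < a) by (unfold rho; lra).
  destruct (proj2 Hps rho ltac:(lra)) as [M [HM HB]].
  set (b := fun k => (c k * cis (nu k * x))%C).
  set (T := fun n => M * Gm * abel_const rho a * Rpower (nu n) (- (a - rho))).
  assert (HT : is_lim_seq T 0) by (apply lim_nu_pow; lra).
  destruct (fal_rate c r0 a Hps Ha) as [e [He [_ HF]]].
  set (I := fun j => CInt (fun tau => ser c x tau * RtoC (Rpower tau (a - 1)))%C (/ nu j) (nu j)).
  assert (H1 : forall j N, Cmod (I j - Csum (fun k => b k * RtoC (mell_weight a j k))%C N)%C <= T N).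
  { intros j N. apply le_of_le_lim0 with (1 := ser_mellin_truncated c x a j Hc Hb).
    exists N. intros m Hm. fold (I j).
    eapply Rle_trans; [apply (Cmod_minus_triangle _ (Csum (fun k => b k * RtoC (mell_weight a j k))%C m))|].
    rewrite Rplus_comm. apply Rplus_le_compat; [|apply Rle_refl].
    apply (abel_tail b (fun k => mell_weight a j k) rho a M Gm); auto; try lra.
    - intros n. apply HB.
    - intros n. apply mell_weight_ok; auto.
    - intros n. apply mell_weight_ok; auto. }
  apply is_lim_seq_spec. intros eps.
  assert (Heps : 0 < eps / 3) by (pose proof (cond_pos eps); lra).
  destruct (lim0_ev T _ HT Heps) as [N1 HN1].
  assert (HGe : is_lim_seq (fun n => Gm * e n) 0).
  { replace (Finite 0) with (Rbar_mult Gm (Finite 0)) by (simpl; f_equal; ring).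
    apply is_lim_seq_scal_l; auto. }
  destruct (lim0_ev _ _ HGe Heps) as [N2 HN2].
  set (N := max N1 N2). specialize (HN1 N ltac:(lia)). specialize (HN2 N ltac:(lia)).
  pose proof (Csum_weight_lim b (fun j k => mell_weight a j k)
     (fun k => Gm * Rpower (nu k) (- a)) N HG) as HW.
  destruct (lim0_ev _ _ HW Heps) as [J HJ]. exists J. intros j Hj. specialize (HJ j Hj).
  rewrite Rminus_0_r, Rabs_pos_eq by apply Cmod_ge_0. fold (I j).
  simpl in HN2, HJ. rewrite (Rabs_pos_eq (Cmod _)) in HJ by apply Cmod_ge_0.
  pose proof (Rle_abs (T N)). pose proof (Rle_abs (Gm * e N)).
  specialize (H1 j N). specialize (HF x N).
  replace (I j - RtoC Gm * fal c a x)%C with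
    ((I j - Csum (fun k => b k * RtoC (mell_weight a j k)) N) +
     (Csum (fun k => b k * RtoC (mell_weight a j k - Gm * Rpower (nu k) (- a))) N +
      - (RtoC Gm * (fal c a x - Csum (fal_term c a x) N))))%C.
  - eapply Rle_lt_trans; [apply Cmod_triangle|].
    pose proof (Cmod_triangle (Csum (fun k => b k * RtoC (mell_weight a j k - Gm * Rpower (nu k) (- a)))%C N)
      (- (RtoC Gm * (fal c a x - Csum (fal_term c a x) N)))%C) as Q.
    rewrite Cmod_opp, Cmod_Rscal in Q by lra.
    assert (Gm * Cmod (fal c a x - Csum (fal_term c a x) N)%C <= Gm * e N)
      by (apply Rmult_le_compat_l; lra).
    lra.
  - replace (Csum (fun k => b k * RtoC (mell_weight a j k - Gm * Rpower (nu k) (- a)))%C N) with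
     (Csum (fun k => b k * RtoC (mell_weight a j k)) N - RtoC Gm * Csum (fal_term c a x) N)%C; [ring|].
    rewrite <- Csum_scal, <- Csum_minus. apply Csum_ext. intros k _. unfold fal_term, b.
    rewrite RtoC_minus, RtoC_mult. ring.
Qed.

(** The top coefficient is eliminated by passing from [P(u)] to [P(2u) - 2^d P(u)]. *)
Lemma poly_coef_bound d : exists K, 0 <= K /\ forall p rad M, 0 < rad ->
  (forall u, Rabs u <= rad -> Cmod (Csum (fun j => p j * RtoC (u ^ j))%C (S d)) <= M) ->
  forall j, (j <= d)%nat -> Cmod (p j) * rad ^ j <= K * M.
Proof.
  induction d as [|d [K [HK IH]]].
  - exists 1. split; [lra|]. intros p rad M Hrad H j Hj. replace j with 0%nat by lia.
    specialize (H 0). rewrite Rabs_R0 in H. specialize (H ltac:(lra)). simpl in H.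
    replace (RtoC 0 + p 0%nat * RtoC 1)%C with (p 0%nat) in H by ring. simpl. lra.
  - set (K1 := 2 ^ d * (K * (1 + 2 ^ S d))).
    assert (H2d : 1 <= 2 ^ d) by (apply pow_R1_Rle; lra).
    assert (H2Sd : 2 ^ S d = 2 * 2 ^ d) by reflexivity.
    assert (HK1 : 0 <= K1) by (unfold K1; repeat apply Rmult_le_pos; lra).
    exists (K1 + (1 + INR (S d) * K1)). split; [pose proof (pos_INR (S d)); nra|].
    intros p rad M Hrad H.
    assert (HM : 0 <= M).
    { eapply Rle_trans; [apply Cmod_ge_0|apply (H 0)]. rewrite Rabs_R0; lra. }
    set (p' := fun j => (p j * RtoC (2 ^ j - 2 ^ S d))%C).
    assert (Hp' : forall u, Rabs u <= rad / 2 ->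
      Cmod (Csum (fun j => p' j * RtoC (u ^ j))%C (S d)) <= (1 + 2 ^ S d) * M).
    { intros u Hu.
      assert (E : Csum (fun j => p' j * RtoC (u ^ j))%C (S d) =
        (Csum (fun j => p j * RtoC ((2 * u) ^ j)) (S (S d)) -
         RtoC (2 ^ S d) * Csum (fun j => p j * RtoC (u ^ j)) (S (S d)))%C).
      { rewrite <- Csum_scal, <- Csum_minus.
        set (v := fun k => (p k * RtoC ((2 * u) ^ k) - RtoC (2 ^ S d) * (p k * RtoC (u ^ k)))%C).
        change (Csum v (S (S d))) with (Csum v (S d) + v (S d))%C.
        replace (v (S d)) with (RtoC 0).
        2:{ unfold v. rewrite Rpow_mult_distr, RtoC_mult. ring. }
        rewrite Cplus_0_r. apply Csum_ext. intros k _. unfold p', v.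
        rewrite Rpow_mult_distr, RtoC_mult, RtoC_minus. ring. }
      rewrite E. unfold Cminus. eapply Rle_trans; [apply Cmod_triangle|].
      rewrite Cmod_opp, Cmod_Rscal by lra.
      assert (A1 : Cmod (Csum (fun j => p j * RtoC ((2 * u) ^ j))%C (S (S d))) <= M).
      { apply H. rewrite Rabs_mult, Rabs_pos_eq; lra. }
      assert (A2 : Cmod (Csum (fun j => p j * RtoC (u ^ j))%C (S (S d))) <= M) by (apply H; lra).
      assert (0 <= 2 ^ S d) by lra. nra. }
    assert (Hlow : forall j, (j <= d)%nat -> Cmod (p j) * rad ^ j <= K1 * M).
    { intros j Hj. assert (IHj := IH p' (rad / 2) _ ltac:(lra) Hp' j Hj).
      unfold p' in IHj. rewrite Cmod_mult, Cmod_R in IHj.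
      assert (Hjd : 2 ^ j <= 2 ^ d) by (apply Rle_pow; [lra|auto]).
      assert (Hab : 1 <= Rabs (2 ^ j - 2 ^ S d)) by (rewrite Rabs_left1; lra).
      assert (Hj0 : 0 < 2 ^ j) by (apply pow_lt; lra).
      unfold Rdiv in IHj. rewrite Rpow_mult_distr, pow_inv in IHj.
      set (P := Cmod (p j)) in *. assert (0 <= P) by apply Cmod_ge_0.
      set (Rj := rad ^ j) in *. assert (0 <= Rj) by (apply pow_le; lra).
      assert (Q1 : P * Rj * / 2 ^ j <= K * ((1 + 2 ^ S d) * M)).
      { eapply Rle_trans; [|apply IHj].
        replace (P * Rabs (2 ^ j - 2 ^ S d) * (Rj * / 2 ^ j)) with
          (P * Rj * / 2 ^ j * Rabs (2 ^ j - 2 ^ S d)) by ring.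
        rewrite <- (Rmult_1_r (P * Rj * / 2 ^ j)) at 1. apply Rmult_le_compat_l; auto.
        apply Rmult_le_pos; [nra|]. apply Rlt_le, Rinv_0_lt_compat; auto. }
      replace (P * Rj) with (2 ^ j * (P * Rj * / 2 ^ j)) by (field; lra).
      unfold K1. apply Rle_trans with (2 ^ d * (K * ((1 + 2 ^ S d) * M))); [|right; ring].
      apply Rmult_le_compat; auto; try lra.
      apply Rmult_le_pos; [nra|]. apply Rlt_le, Rinv_0_lt_compat; auto. }
    intros j Hj. destruct (Nat.eq_dec j (S d)) as [->|Hjd].
    + assert (E : (p (S d) * RtoC (rad ^ S d))%C =
        (Csum (fun j => p j * RtoC (rad ^ j)) (S (S d)) - Csum (fun j => p j * RtoC (rad ^ j)) (S d))%C).
      { cbn [Csum]. ring. }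
      assert (E2 : Cmod (p (S d)) * rad ^ S d = Cmod (p (S d) * RtoC (rad ^ S d))%C).
      { rewrite Cmod_mult, Cmod_R, Rabs_pos_eq; auto. apply pow_le; lra. }
      rewrite E2, E. unfold Cminus. eapply Rle_trans; [apply Cmod_triangle|]. rewrite Cmod_opp.
      assert (A1 : Cmod (Csum (fun j => p j * RtoC (rad ^ j))%C (S (S d))) <= M)
        by (apply H; rewrite Rabs_pos_eq; lra).
      assert (A2 : Cmod (Csum (fun j => p j * RtoC (rad ^ j))%C (S d)) <= INR (S d) * (K1 * M)).
      { apply Csum_bound. intros k Hk. rewrite Cmod_mult, Cmod_R, Rabs_pos_eq by (apply pow_le; lra).
        apply Hlow. lia. }
      assert (0 <= K1 * M) by nra. lra.
    + pose proof (Hlow j ltac:(lia)). pose proof (pos_INR (S d)).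
      assert (0 <= (1 + INR (S d) * K1) * M) by (apply Rmult_le_pos; nra). lra.
Qed.

Definition dcoef (c : nat -> C) (m : nat) : nat -> C := Nat.iter m deriv_coef c.

Lemma subexp_dcoef c m : subexp c -> subexp (dcoef c m).
Proof. intros H. induction m as [|m IH]; [exact H|]. apply subexp_deriv, IH. Qed.

Lemma dcoef_term c m x y n :
  ser_term (dcoef c m) x y n =
   (Cpow (RtoC (2 * PI) * Ci) m * (RtoC (nu n ^ m) * ser_term c x y n))%C.
Proof.
  induction m as [|m IH].
  - simpl. change (dcoef c 0) with c. ring.
  - change (dcoef c (S m)) with (deriv_coef (dcoef c m)).
    replace (ser_term (deriv_coef (dcoef c m)) x y n) with
      (RtoC (2 * PI * nu n) * Ci * ser_term (dcoef c m) x y n)%C.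
    + rewrite IH. simpl. rewrite !RtoC_mult. ring.
    + unfold ser_term, deriv_coef. ring.
Qed.

(** [fourier_bound] for the restriction of the series to height [y / 2], which leaves
    [exp (- pi n y)] for convergence. *)
Lemma ser_deriv_bound c m s : subexp c -> s < INR m -> exists K, 0 < K /\
  forall x y M, 0 < y -> 0 <= M ->
  (forall t, Rabs t <= 1 / 2 -> Cmod (ser c (x + t) (y / 2)) <= M * Rpower (y + Rabs t) s) ->
  Cmod (ser (dcoef c m) x y) <= K * M * Rpower y (s - INR m).
Proof.
  intros Hc Hs. destruct (fourier_bound m s Hs) as [K [HK H]]. pose proof PI_RGT_0 as HPI.
  set (L := (2 * PI) ^ m). assert (HL : 0 < L) by (apply pow_lt; lra).
  (* [Q] pays for passing from [y / 2 + |t|] to [y + |t|], whatever the sign of [s] *)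
  set (Q := Rpower 2 (Rabs s)). assert (HQ : 0 < Q) by apply Rpower_pos.
  set (Q2 := Rpower (/ 2) (s - INR m)). assert (HQ2 : 0 < Q2) by apply Rpower_pos.
  exists (L * (K * Q * Q2)). split; [repeat apply Rmult_lt_0_compat; auto|].
  intros x y M Hy HM Hb. assert (Hy2 : 0 < y / 2) by lra.
  destruct (H (y / 2) Hy2) as [N0 HN0].
  set (c' := fun k => (c k * RtoC (exp (- (2 * PI * nu k * (y / 2)))))%C).
  assert (Hc' : has_coef (fun t => ser c t (y / 2)) c').
  { destruct (ser_rate c (y / 2) Hc Hy2) as [e [He [_ He2]]].
    apply (coef_of_series _ c' e); auto.
    - intros t. now apply ser_ccont_x.
    - intros n t. apply He2. lra. }
  destruct (ser_rate (dcoef c m) y (subexp_dcoef c m Hc) Hy) as [e [He [_ He2]]].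
  apply le_of_le_lim0 with (1 := He). exists N0. intros n Hn.
  replace (ser (dcoef c m) x y) with (Csum (ser_term (dcoef c m) x y) n +
    (ser (dcoef c m) x y - Csum (ser_term (dcoef c m) x y) n))%C by ring.
  eapply Rle_trans; [apply Cmod_triangle|]. apply Rplus_le_compat; [|apply He2; lra].
  rewrite (Csum_ext _ _ n (fun k _ => dcoef_term c m x y k)), Csum_scal, Cmod_mult, Cmod_pow.
  replace (Cmod (RtoC (2 * PI) * Ci)%C) with (2 * PI)
    by (rewrite Cmod_mult, Cmod_Ci, Cmod_R, Rabs_pos_eq; lra).
  fold L.
  replace (L * (K * Q * Q2) * M * Rpower y (s - INR m)) with
    (L * (K * (Q * M) * (Q2 * Rpower y (s - INR m)))) by ring.
  apply Rmult_le_compat_l; [lra|].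
  unfold Q2. rewrite Rpower_mult_distr by lra.
  replace (/ 2 * y) with (y / 2) by field.
  rewrite (Csum_ext _ (fun k => RtoC (nu k ^ m) * ser_term c' x (y / 2) k)%C).
  - apply (HN0 n Hn (y / 2) x (fun t => ser c t (y / 2))); auto.
    + lra.
    + intros t. now apply ser_ccont_x.
    + apply Rmult_le_pos; lra.
    + intros t Ht. eapply Rle_trans; [apply Hb; auto|].
      pose proof (Rabs_pos t) as Ht0.
      replace (Q * M * Rpower (y / 2 + Rabs t) s) with (M * (Q * Rpower (y / 2 + Rabs t) s)) by ring.
      apply Rmult_le_compat_l; auto. unfold Q.
      destruct (Rle_dec 0 s) as [Hs0|Hs0].
      * rewrite (Rabs_pos_eq s) by auto. rewrite Rpower_mult_distr by lra.
        apply Rle_Rpower_l; lra.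
      * rewrite (Rabs_left s) by lra.
        apply Rle_trans with (1 * Rpower (y / 2 + Rabs t) s).
        -- rewrite Rmult_1_l. replace s with (- (- s)) by ring. apply Rpower_le_neg; lra.
        -- apply Rmult_le_compat_r; [apply Rlt_le, Rpower_pos|]. apply Rpower_ge1; lra.
  - intros k _. unfold ser_term, c'. f_equal.
    replace (- (2 * PI * nu k * y)) with (- (2 * PI * nu k * (y / 2)) + - (2 * PI * nu k * (y / 2))) by field.
    rewrite exp_plus, RtoC_mult. ring.
Qed.

Lemma improper_limit (phi : R -> C) (K a : R) : 0 < a -> 0 <= K ->
  (forall y, 0 < y -> ccont phi y) ->
  (forall y, 0 < y -> Cmod (phi y) <= K * Rpower y (a - 1)) ->
  (forall y, 1 <= y -> Cmod (phi y) <= K * Rpower y (- (1) - 1)) ->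
  exists l : C, is_lim_seq (fun j => Cmod (CInt phi (/ nu j) (nu j) - l)%C) 0.
Proof.
  intros Ha HK Hc H0 H1. set (I := fun j => CInt phi (/ nu j) (nu j)).
  set (e := fun n => K * / a * Rpower (nu n) (- a) + K * Rpower (nu n) (- (1))).
  assert (He : is_lim_seq e 0).
  { replace (Finite 0) with (Finite (0 + 0)) by (f_equal; ring).
    apply is_lim_seq_plus'; apply lim_nu_pow; lra. }
  assert (Hia : 0 < / a) by (apply Rinv_0_lt_compat; auto).
  assert (HI : forall n m, (n <= m)%nat -> Cmod (I m - I n)%C <= e n).
  { intros n m Hnm. destruct (inv_nu_le n) as [N1 N2]. destruct (inv_nu_le m) as [M1 M2].
    pose proof (nu_le n m Hnm) as Hle.
    assert (Hle2 : / nu m <= / nu n) by (apply Rinv_le_contravar; lra).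
    assert (Hon : forall u v, 0 < u -> ccont_on phi u v) by (intros u v Hu t Ht; apply Hc; lra).
    replace (I m - I n)%C with (CInt phi (/ nu m) (/ nu n) + CInt phi (nu n) (nu m))%C.
    2:{ unfold I. rewrite <- (CInt_Chasles phi (/ nu m) (/ nu n) (nu m)) by (auto; try lra; apply Hon; lra).
        rewrite <- (CInt_Chasles phi (/ nu n) (nu n) (nu m)) by (auto; try lra; apply Hon; lra). ring. }
    eapply Rle_trans; [apply Cmod_triangle|]. unfold e. apply Rplus_le_compat.
    - destruct (RInt_Rpower (/ nu m) (/ nu n) a ltac:(lra) ltac:(lra)) as [E1 E2].
      eapply Rle_trans; [apply CInt_bound with (g := fun y => K * Rpower y (a - 1))|].
      + lra.
      + apply Hon; lra.
      + apply (ex_RInt_scal (fun y => Rpower y (a - 1))); auto.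
      + intros t Ht. apply H0; lra.
      + rewrite RInt_Rscal, E2 by auto. rewrite Rmult_assoc. apply Rmult_le_compat_l; auto.
        unfold Rdiv. rewrite Rmult_comm. apply Rmult_le_compat_l; [lra|].
        replace (Rpower (nu n) (- a)) with (Rpower (/ nu n) a).
        * pose proof (Rpower_pos (/ nu m) a). lra.
        * unfold Rpower. rewrite ln_Rinv by lra. f_equal; ring.
    - destruct (RInt_Rpower (nu n) (nu m) (- (1)) ltac:(lra) ltac:(lra)) as [E1 E2].
      eapply Rle_trans; [apply CInt_bound with (g := fun y => K * Rpower y (- (1) - 1))|].
      + lra.
      + apply Hon; lra.
      + apply (ex_RInt_scal (fun y => Rpower y (- (1) - 1))); auto.
      + intros t Ht. apply H1; lra.
      + rewrite RInt_Rscal, E2 by auto. apply Rmult_le_compat_l; auto.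
        pose proof (Rpower_pos (nu m) (- (1))).
        replace ((Rpower (nu m) (- (1)) - Rpower (nu n) (- (1))) / - (1)) with
          (Rpower (nu n) (- (1)) - Rpower (nu m) (- (1))) by field. lra. }
  set (u := fun k => (I (S k) - I k)%C).
  assert (Eu : forall n, Csum u n = (I n - I 0%nat)%C).
  { induction n as [|n IH]; [simpl; ring|]. simpl. rewrite IH. unfold u. ring. }
  exists (I 0%nat + CSeries u)%C.
  apply is_lim_seq_le_le with (u := fun _ => 0) (w := e); [|apply is_lim_seq_const|exact He].
  intros n. split; [apply Cmod_ge_0|]. fold (I n).
  replace (I n - (I 0%nat + CSeries u))%C with (- (CSeries u - Csum u n))%C by (rewrite Eu; ring).
  rewrite Cmod_opp. apply (CSeries_rate u e); auto.
  intros i j Hij. rewrite !Eu.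
  replace (I j - I 0%nat - (I i - I 0%nat))%C with (I j - I i)%C by ring. auto.
Qed.

(** * Expansion at a point where the form is small *)

Lemma CInt_pow_pos h K p u v : 0 < u <= v -> 0 < p -> 0 <= K ->
  (forall y, 0 < y -> ccont h y) ->
  (forall y, u < y < v -> Cmod (h y) <= K * Rpower y (p - 1)) ->
  Cmod (CInt h u v) <= K * (Rpower v p * / p).
Proof.
  intros Huv Hp HK Hc H.
  destruct (RInt_Rpower u v p Huv ltac:(lra)) as [E1 E2].
  assert (Hip : 0 < / p) by (apply Rinv_0_lt_compat; auto).
  eapply Rle_trans; [apply CInt_bound with (g := fun y => K * Rpower y (p - 1))|]; auto.
  - lra.
  - intros t Ht. apply Hc. lra.
  - apply (ex_RInt_scal (fun y => Rpower y (p - 1))). auto.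
  - rewrite RInt_Rscal, E2 by auto. apply Rmult_le_compat_l; auto.
    apply Rmult_le_compat_r; [lra|]. pose proof (Rpower_pos u p). lra.
Qed.

Lemma CInt_pow_neg h K p u v : 0 < u <= v -> p < 0 -> 0 <= K ->
  (forall y, 0 < y -> ccont h y) ->
  (forall y, u < y < v -> Cmod (h y) <= K * Rpower y (p - 1)) ->
  Cmod (CInt h u v) <= K * (Rpower u p * / (- p)).
Proof.
  intros Huv Hp HK Hc H.
  destruct (RInt_Rpower u v p Huv ltac:(lra)) as [E1 E2].
  assert (Hip : 0 < / (- p)) by (apply Rinv_0_lt_compat; lra).
  eapply Rle_trans; [apply CInt_bound with (g := fun y => K * Rpower y (p - 1))|]; auto.
  - lra.
  - intros t Ht. apply Hc. lra.
  - apply (ex_RInt_scal (fun y => Rpower y (p - 1))). auto.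
  - rewrite RInt_Rscal, E2 by auto. apply Rmult_le_compat_l; auto.
    replace ((Rpower v p - Rpower u p) / p) with ((Rpower u p - Rpower v p) * / (- p)) by (field; lra).
    apply Rmult_le_compat_r; [lra|]. pose proof (Rpower_pos v p). lra.
Qed.

Lemma finite_choice (n : nat) (P : nat -> C -> Prop) :
  (forall j, (j < n)%nat -> exists l, P j l) -> exists f, forall j, (j < n)%nat -> P j (f j).
Proof.
  induction n as [|n IH]; intros H.
  - exists (fun _ => RtoC 0). intros; lia.
  - destruct IH as [f Hf]; [intros; apply H; lia|]. destruct (H n) as [l Hl]; [lia|].
    exists (fun j => if Nat.eq_dec j n then l else f j). intros j Hj.
    destruct (Nat.eq_dec j n) as [->|Hn]; [auto|]. apply Hf. lia.
Qed.

Lemma Csum_lim0 (V : nat -> C) (X : nat -> nat -> C) (l : nat -> C) m :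
  (forall j, (j < m)%nat -> is_lim_seq (fun n => Cmod (X n j - l j)%C) 0) ->
  is_lim_seq (fun n => Cmod (Csum (fun j => V j * (X n j - l j))%C m)) 0.
Proof.
  induction m as [|m IH]; intros H.
  - apply is_lim_seq_ext with (fun _ => 0); [intros; simpl; now rewrite Cmod_0|apply is_lim_seq_const].
  - apply is_lim_seq_le_le with (u := fun _ => 0)
      (w := fun n => Cmod (Csum (fun j => V j * (X n j - l j))%C m) + Cmod (V m) * Cmod (X n m - l m)%C).
    + intros n. split; [apply Cmod_ge_0|]. simpl. eapply Rle_trans; [apply Cmod_triangle|].
      rewrite (Cmod_mult (V m)). apply Rle_refl.
    + apply is_lim_seq_const.
    + replace (Finite 0) with (Finite (0 + Cmod (V m) * 0)) by (f_equal; ring).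
      apply is_lim_seq_plus'; [apply IH; intros; apply H; lia|].
      apply (is_lim_seq_scal_l _ (Cmod (V m)) (Finite 0)). apply H. lia.
Qed.

Lemma lt_INR_S (s : R) (d : nat) : s < INR d + 1 -> s < INR (S d).
Proof. rewrite S_INR. auto. Qed.

(** Near [x0] the form is so small inside cones that its Taylor polynomials in the
    horizontal direction may be integrated up to the boundary. *)
Section Expansion.
Variables (c : nat -> C) (r0 a x0 s : R) (d : nat).
Hypotheses (Hc : subexp c) (Hps : power_sums c r0) (Hra : r0 < a).
Hypothesis H1 : forall A, r0 <= A -> exists K, forall x y, 0 < y ->
  Cmod (ser c x y) <= K * Rpower y (- A).
Hypothesis H2 : forall A, r0 <= A -> exists K, forall u y, 0 < y ->
  Cmod (ser c (x0 + u) y) <= K * (Rpower y (- A) * Rpower (Rabs u + y) (2 * (A - r0))).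
Hypotheses (Hs : a - r0 <= s < 2 * (a - r0)) (Hd : INR d < s < INR d + 1).

Definition taylor_coef (y : R) (j : nat) : C := (ser (dcoef c j) x0 y * RtoC (/ INR (fact j)))%C.

Lemma cone_bound : exists K, 0 <= K /\ forall u y, 0 < y ->
  Cmod (ser c (x0 + u) y) <= K * (Rpower y (- (s + 2 * r0 - a)) *
      Rpower (Rabs u + y) (2 * (s + r0 - a))).
Proof.
  destruct (H2 (s + 2 * r0 - a)) as [K HK]; [lra|].
  replace (2 * (s + 2 * r0 - a - r0)) with (2 * (s + r0 - a)) in HK by ring.
  exists K. split; auto.
  specialize (HK 0 1 Rlt_0_1). rewrite Rabs_R0, Rplus_0_l, !Rpower_1_base in HK.
  pose proof (Cmod_ge_0 (ser c (x0 + 0) 1)). lra.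
Qed.

(** The order [d + 1] exceeds [2 (s + r0 - a)], so the growth of the bound away from [x0] is
    integrable against the kernel. *)
Lemma cone_deriv_bound : exists K, 0 <= K /\ forall u y, 0 < y -> Rabs u <= y ->
  Cmod (ser (dcoef c (S d)) (x0 + u) y) <= K * Rpower y (s - a - INR d - 1).
Proof.
  destruct cone_bound as [K [HK H]].
  set (sg := 2 * (s + r0 - a)) in *. set (A := s + 2 * r0 - a) in *.
  assert (Hsg : 0 <= sg) by (unfold sg; lra).
  destruct (ser_deriv_bound c (S d) sg Hc) as [L [HL HD]].
  { apply lt_INR_S. unfold sg. lra. }
  set (P := Rpower (/ 2) (- A) * Rpower 2 sg).
  assert (HP : 0 < P) by (apply Rmult_lt_0_compat; apply Rpower_pos).
  exists (L * (K * P)). split; [apply Rmult_le_pos; [lra|apply Rmult_le_pos; lra]|].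
  intros u y Hy Hu.
  eapply Rle_trans; [apply (HD (x0 + u) y (K * P * Rpower y (- A)) Hy)|].
  - pose proof (Rpower_pos y (- A)). apply Rmult_le_pos; [apply Rmult_le_pos; lra|lra].
  - intros t Ht. rewrite Rplus_assoc. eapply Rle_trans; [apply H; lra|].
    replace (K * P * Rpower y (- A) * Rpower (y + Rabs t) sg) with
      (K * ((Rpower (/ 2) (- A) * Rpower y (- A)) * (Rpower 2 sg * Rpower (y + Rabs t) sg)))
      by (unfold P; ring).
    pose proof (Rabs_pos t). pose proof (Rabs_pos (u + t)).
    rewrite !Rpower_mult_distr by lra. replace (/ 2 * y) with (y / 2) by field.
    apply Rmult_le_compat_l; auto. apply Rmult_le_compat_l; [apply Rlt_le, Rpower_pos|].
    apply Rle_Rpower_l; auto. split; [lra|]. pose proof (Rabs_triang u t). lra.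
  - right. rewrite S_INR.
    replace (s - a - INR d - 1) with (- A + (sg - (INR d + 1))) by (unfold A, sg; ring).
    rewrite Rpower_plus. ring.
Qed.

Lemma taylor_remainder : exists K, 0 <= K /\ forall u y, 0 < y -> Rabs u <= y ->
  Cmod (ser c (x0 + u) y - Csum (fun j => taylor_coef y j * RtoC (u ^ j)) (S d))%C <=
    K * (Rpower y (s - a - INR d - 1) * Rabs u ^ S d).
Proof.
  destruct cone_deriv_bound as [K [HK H]]. exists K. split; auto. intros u y Hy Hu.
  pose proof (taylor_bound d (fun j x => ser (dcoef c j) x y) x0 (Rabs u)
    (K * Rpower y (s - a - INR d - 1) * Rabs u) (Rabs_pos u)) as T.
  assert (Hder : forall j x, cder (fun x => ser (dcoef c j) x y) x (ser (dcoef c (S j)) x y)).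
  { intros j x. apply ser_cder_x; auto. now apply subexp_dcoef. }
  specialize (T (fun j x _ _ => Hder j x)).
  assert (Hlast : forall x, Rabs (x - x0) <= Rabs u ->
    Cmod (ser (dcoef c d) x y - ser (dcoef c d) x0 y)%C <= K * Rpower y (s - a - INR d - 1) * Rabs u).
  { intros x Hx. eapply Rle_trans; [apply (cder_mean_value (fun x => ser (dcoef c d) x y)
      (fun x => ser (dcoef c (S d)) x y) x0 x (K * Rpower y (s - a - INR d - 1)))|].
    - intros t _. apply Hder.
    - intros t Ht. replace t with (x0 + (t - x0)) by ring. apply H; auto.
      apply Rle_trans with (Rabs (x - x0)); [|lra].
      revert Ht. unfold Rmin, Rmax. destruct (Rle_dec x0 x); intros Ht.
      + rewrite !Rabs_pos_eq; lra.
      + rewrite !Rabs_left1; lra.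
    - apply Rmult_le_compat_l; auto. apply Rmult_le_pos; [auto|apply Rlt_le, Rpower_pos]. }
  specialize (T Hlast (x0 + u)). replace (x0 + u - x0) with u in T by ring.
  specialize (T (Rle_refl _)). simpl (dcoef c 0) in T. change (dcoef c 0) with c in T.
  rewrite (Csum_ext _ (fun j => ser (dcoef c j) x0 y * RtoC (/ INR (fact j) * u ^ j))%C).
  - eapply Rle_trans; [apply T|]. simpl. right; ring.
  - intros j _. unfold taylor_coef. rewrite RtoC_mult. ring.
Qed.

(** The Taylor polynomial is as small as the function and the remainder on [|u| <= y], so
    each of its coefficients is, up to the factor [y^(-j)]. *)
Lemma taylor_coef_small : exists K, 0 <= K /\ forall y j, 0 < y -> (j <= d)%nat ->
  Cmod (taylor_coef y j) <= K * Rpower y (s - a - INR j).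
Proof.
  destruct cone_bound as [K [HK HF]]. destruct taylor_remainder as [L [HL HR]].
  destruct (poly_coef_bound d) as [Q [HQ HP]].
  set (sg := 2 * (s + r0 - a)) in *. assert (Hsg : 0 <= sg) by (unfold sg; lra).
  pose proof (Rpower_pos 2 sg) as H2s.
  exists (Q * (K * Rpower 2 sg + L)).
  split; [apply Rmult_le_pos; [auto|]; apply Rplus_le_le_0_compat; [apply Rmult_le_pos; lra|auto]|].
  intros y j Hy Hj.
  assert (HT : forall u, Rabs u <= y ->
     Cmod (Csum (fun j => taylor_coef y j * RtoC (u ^ j))%C (S d)) <=
       (K * Rpower 2 sg + L) * Rpower y (s - a)).
  { intros u Hu.
    replace (Csum (fun j => taylor_coef y j * RtoC (u ^ j))%C (S d)) with
     (ser c (x0 + u) y - (ser c (x0 + u) y - Csum (fun j => taylor_coef y j * RtoC (u ^ j)) (S d)))%C by ring.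
    unfold Cminus at 1. eapply Rle_trans; [apply Cmod_triangle|]. rewrite Cmod_opp.
    rewrite Rmult_plus_distr_r. apply Rplus_le_compat.
    - eapply Rle_trans; [apply HF; auto|].
      replace (s - a) with (- (s + 2 * r0 - a) + sg) by (unfold sg; ring).
      rewrite Rpower_plus, Rmult_assoc. apply Rmult_le_compat_l; auto.
      replace (Rpower 2 sg * (Rpower y (- (s + 2 * r0 - a)) * Rpower y sg)) with
        (Rpower y (- (s + 2 * r0 - a)) * (Rpower 2 sg * Rpower y sg)) by ring.
      apply Rmult_le_compat_l; [apply Rlt_le, Rpower_pos|].
      rewrite Rpower_mult_distr by lra. apply Rle_Rpower_l; auto.
      pose proof (Rabs_pos u). lra.
    - eapply Rle_trans; [apply HR; auto|]. apply Rmult_le_compat_l; auto.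
      assert (E : Rpower y (s - a) = Rpower y (s - a - INR d - 1) * y ^ S d).
      { rewrite <- Rpower_pow, <- Rpower_plus by auto. f_equal. rewrite S_INR. ring. }
      rewrite E.
      apply Rmult_le_compat_l; [apply Rlt_le, Rpower_pos|].
      apply pow_incr. split; [apply Rabs_pos|auto]. }
  specialize (HP (taylor_coef y) y _ Hy HT j Hj).
  unfold Rminus at 1. rewrite Rpower_plus, Rpower_Ropp, Rpower_pow by auto.
  assert (Hyj : 0 < y ^ j) by (apply pow_lt; auto).
  apply Rmult_le_reg_r with (y ^ j); auto. eapply Rle_trans; [apply HP|].
  right. field. lra.
Qed.

Lemma taylor_coef_decay j : exists K, 0 <= K /\ forall y, 1 <= y ->
  Cmod (taylor_coef y j) <= K * Rpower y (- (a + 1)).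
Proof.
  assert (Hr0 : 0 <= r0) by apply Hps.
  destruct (H1 (a + 1)) as [K HK]; [lra|].
  assert (HK0 : 0 <= K).
  { specialize (HK 0 1 Rlt_0_1). rewrite Rpower_1_base in HK. pose proof (Cmod_ge_0 (ser c 0 1)). lra. }
  assert (Hf : 0 < / INR (fact j)) by (apply Rinv_0_lt_compat, INR_fact_lt_0).
  assert (E : forall y, Cmod (taylor_coef y j) = / INR (fact j) * Cmod (ser (dcoef c j) x0 y)).
  { intros y. unfold taylor_coef. rewrite Cmod_mult, Cmod_R, Rabs_pos_eq by lra. ring. }
  destruct j as [|j].
  - exists K. split; auto. intros y Hy. rewrite E. simpl. rewrite Rinv_1, Rmult_1_l.
    change (dcoef c 0) with c. apply HK. lra.
  - destruct (ser_deriv_bound c (S j) 0 Hc) as [L [HL HD]]; [apply lt_0_INR; lia|].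
    set (P := Rpower (/ 2) (- (a + 1))). assert (HP : 0 < P) by apply Rpower_pos.
    exists (/ INR (fact (S j)) * (L * (K * P))).
    split; [apply Rmult_le_pos; [lra|apply Rmult_le_pos; [lra|apply Rmult_le_pos; lra]]|].
    intros y Hy. rewrite E, Rmult_assoc. apply Rmult_le_compat_l; [lra|].
    pose proof (Rpower_pos y (- (a + 1))) as Hyp.
    eapply Rle_trans; [apply (HD x0 y (K * P * Rpower y (- (a + 1))))|].
    + lra.
    + apply Rmult_le_pos; [apply Rmult_le_pos; lra|lra].
    + intros t _. rewrite Rpower_O by (pose proof (Rabs_pos t); lra). rewrite Rmult_1_r.
      eapply Rle_trans; [apply HK; lra|]. rewrite Rmult_assoc. apply Rmult_le_compat_l; auto.
      unfold P. rewrite Rpower_mult_distr by lra. right. f_equal. field.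
    + rewrite <- (Rmult_1_r (L * (K * P) * Rpower y (- (a + 1)))).
      replace (L * (K * P * Rpower y (- (a + 1)))) with (L * (K * P) * Rpower y (- (a + 1))) by ring.
      apply Rmult_le_compat_l.
      * apply Rmult_le_pos; [apply Rmult_le_pos; [lra|apply Rmult_le_pos; lra]|lra].
      * replace (0 - INR (S j)) with (- INR (S j)) by ring. rewrite Rpower_Ropp, <- Rinv_1.
        apply Rinv_le_contravar; [lra|]. apply Rpower_ge1; [auto|apply pos_INR].
Qed.

Lemma taylor_coef_ccont j y : 0 < y -> ccont (fun y => taylor_coef y j) y.
Proof.
  intros Hy. unfold taylor_coef. apply ccont_mult; [|apply ccont_const].
  apply ser_ccont_y; auto. now apply subexp_dcoef.
Qed.

Lemma pointwise_expansion : exists p K, forall u, u <> 0 ->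
  Cmod (fal c a (x0 + u) - Csum (fun j => p j * RtoC (u ^ j)) (S d))%C <= K * Rpower (Rabs u) s.
Proof.
  assert (Hr0 : 0 <= r0) by apply Hps.
  destruct (mell_limit a) as [Gm [HGm HG]]; [lra|].
  destruct cone_bound as [K1 [HK1 HF]]. destruct taylor_remainder as [K2 [HK2 HR]].
  destruct taylor_coef_small as [K3 [HK3 HT]].
  set (sg := 2 * (s + r0 - a)) in *. set (A := s + 2 * r0 - a) in *.
  assert (Hsg : 0 <= sg) by (unfold sg; lra).
  set (phi := fun j y => (taylor_coef y j * RtoC (Rpower y (a - 1)))%C).
  assert (Hphi : forall j y, 0 < y -> ccont (phi j) y).
  { intros j y Hy. apply ccont_mult; [now apply taylor_coef_ccont|].
    apply ccont_real, continuous_Rpower, Hy. }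
  destruct (finite_choice (S d) (fun j l => is_lim_seq (fun n =>
      Cmod (CInt (phi j) (/ nu n) (nu n) - l)%C) 0)) as [l Hl].
  { intros j Hj. destruct (taylor_coef_decay j) as [K4 [HK4 HD]].
    assert (Hjd : INR j <= INR d) by (apply le_INR; lia).
    apply (improper_limit (phi j) (K3 + K4) (s - INR j)); [lra|lra|apply Hphi| |].
    - intros y Hy. unfold phi. rewrite Cmod_mult, Cmod_R, Rabs_pos_eq by (apply Rlt_le, Rpower_pos).
      specialize (HT y j Hy ltac:(lia)).
      replace (s - INR j - 1) with (s - a - INR j + (a - 1)) by ring.
      rewrite (Rpower_plus (s - a - INR j)), <- Rmult_assoc.
      apply Rmult_le_compat_r; [apply Rlt_le, Rpower_pos|].
      eapply Rle_trans; [apply HT|]. apply Rmult_le_compat_r; [apply Rlt_le, Rpower_pos|lra].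
    - intros y Hy. unfold phi. rewrite Cmod_mult, Cmod_R, Rabs_pos_eq by (apply Rlt_le, Rpower_pos).
      specialize (HD y Hy).
      replace (- (1) - 1) with (- (a + 1) + (a - 1)) by ring.
      rewrite (Rpower_plus (- (a + 1))), <- Rmult_assoc.
      apply Rmult_le_compat_r; [apply Rlt_le, Rpower_pos|].
      eapply Rle_trans; [apply HD|]. apply Rmult_le_compat_r; [apply Rlt_le, Rpower_pos|lra]. }
  assert (Hp1 : 0 < a - A) by (unfold A; lra).
  assert (Hp2 : 0 < s - INR d) by lra.
  assert (Hp3 : s - INR d - 1 < 0) by lra.
  set (B := K1 * Rpower 2 sg * / (a - A) + INR (S d) * K3 * / (s - INR d) + K2 * / (- (s - INR d - 1))).
  exists (fun j => (l j * RtoC (/ Gm))%C), (B * / Gm). intros u Hu.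
  set (v := Rabs u). assert (Hv : 0 < v) by (now apply Rabs_pos_lt).
  apply Rmult_le_reg_l with Gm; auto.
  replace (Gm * (B * / Gm * Rpower v s)) with (B * Rpower v s) by (field; lra).
  rewrite <- (Cmod_Rscal Gm) by lra.
  replace (RtoC Gm * (fal c a (x0 + u) - Csum (fun j => l j * RtoC (/ Gm) * RtoC (u ^ j)) (S d)))%C
    with (RtoC Gm * fal c a (x0 + u) - Csum (fun j => RtoC (u ^ j) * l j) (S d))%C.
  2:{ rewrite (Csum_ext (fun j => l j * RtoC (/ Gm) * RtoC (u ^ j))%C
        (fun j => RtoC (/ Gm) * (RtoC (u ^ j) * l j))%C) by (intros; ring).
      rewrite Csum_scal.
      replace (RtoC Gm * (fal c a (x0 + u) - RtoC (/ Gm) * Csum (fun j => RtoC (u ^ j) * l j) (S d)))%C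
       with (RtoC Gm * fal c a (x0 + u) - RtoC (Gm * / Gm) * Csum (fun j => RtoC (u ^ j) * l j) (S d))%C
        by (rewrite RtoC_mult; ring).
      rewrite Rinv_r by lra. ring. }
  pose proof (fal_mellin c r0 a Gm Hc Hps Hra HGm HG (x0 + u)) as L1.
  pose proof (Csum_lim0 (fun j => RtoC (u ^ j)) (fun n j => CInt (phi j) (/ nu n) (nu n)) l (S d) Hl) as L2.
  assert (L3 := is_lim_seq_plus' _ _ _ _ L1 L2). rewrite Rplus_0_l in L3.
  apply le_of_le_lim0 with (1 := L3).
  destruct (lim0_ev (fun n => / nu n) (Rmin v (/ v)) lim_inv_INR) as [N HN].
  { apply Rmin_glb_lt; [auto|apply Rinv_0_lt_compat; auto]. }
  exists N. intros n Hn. specialize (HN n Hn). simpl in HN.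
  destruct (inv_nu_le n) as [Hn1 Hn2].
  rewrite Rabs_pos_eq in HN by lra.
  assert (Hnv : / nu n <= v) by (apply Rlt_le; eapply Rlt_le_trans; [apply HN|apply Rmin_l]).
  assert (Hvn : v <= nu n).
  { rewrite <- (Rinv_inv v), <- (Rinv_inv (nu n)). apply Rlt_le, Rinv_lt_contravar.
    - apply Rmult_lt_0_compat; [lra|apply Rinv_0_lt_compat; auto].
    - eapply Rlt_le_trans; [apply HN|apply Rmin_r]. }
  set (I := CInt (fun tau => ser c (x0 + u) tau * RtoC (Rpower tau (a - 1)))%C (/ nu n) (nu n)).
  set (h := fun y => ((ser c (x0 + u) y - Csum (fun j => taylor_coef y j * RtoC (u ^ j)) (S d)) *
      RtoC (Rpower y (a - 1)))%C).
  assert (HTc : forall y, 0 < y -> ccont (fun y => Csum (fun j => taylor_coef y j * RtoC (u ^ j))%C (S d)) y).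
  { intros y Hy. apply (ccont_Csum (fun j y => taylor_coef y j * RtoC (u ^ j))%C). intros j _.
    apply ccont_mult; [now apply taylor_coef_ccont|apply ccont_const]. }
  assert (Hh : forall y, 0 < y -> ccont h y).
  { intros y Hy. apply ccont_mult; [|apply ccont_real, continuous_Rpower, Hy].
    apply ccont_minus; [now apply ser_ccont_y|auto]. }
  assert (EI : (I - Csum (fun j => RtoC (u ^ j) * CInt (phi j) (/ nu n) (nu n)) (S d))%C =
      CInt h (/ nu n) (nu n)).
  { transitivity (I - CInt (fun y => Csum (fun j => RtoC (u ^ j) * phi j y) (S d)) (/ nu n) (nu n))%C.
    - f_equal. f_equal. rewrite (CInt_Csum (fun j y => RtoC (u ^ j) * phi j y)%C); [|lra|].
      + apply Csum_ext. intros j _. rewrite CInt_scal; [auto|lra|]. intros t Ht. apply Hphi. lra.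
      + intros j _ t Ht. apply ccont_mult; [apply ccont_const|]. apply Hphi. lra.
    - unfold I. rewrite <- CInt_minus; [|lra| |].
      + apply CInt_ext; [lra|]. intros y _. unfold h, phi.
        rewrite (Csum_ext (fun j => RtoC (u ^ j) * (taylor_coef y j * RtoC (Rpower y (a - 1))))%C
          (fun j => RtoC (Rpower y (a - 1)) * (taylor_coef y j * RtoC (u ^ j)))%C) by (intros; ring).
        rewrite Csum_scal. ring.
      + intros t Ht. assert (Ht0 : 0 < t) by lra.
        exact (ser_weighted_ccont c (x0 + u) a t Hc Ht0).
      + intros t Ht. apply (ccont_Csum (fun j y => RtoC (u ^ j) * phi j y)%C). intros j _.
        apply ccont_mult; [apply ccont_const|]. apply Hphi. lra. }
  assert (Hmain : Cmod (CInt h (/ nu n) (nu n)) <= B * Rpower v s).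
  { rewrite <- (CInt_Chasles h (/ nu n) v (nu n)) by (auto; intros t Ht; apply Hh; lra).
    eapply Rle_trans; [apply Cmod_triangle|].
    replace (B * Rpower v s) with ((K1 * Rpower 2 sg * / (a - A) + INR (S d) * K3 * / (s - INR d)) * Rpower v s
       + K2 * / (- (s - INR d - 1)) * Rpower v s) by (unfold B; ring).
    apply Rplus_le_compat.
    - set (hF := fun y => (ser c (x0 + u) y * RtoC (Rpower y (a - 1)))%C).
      set (hT := fun y => (Csum (fun j => taylor_coef y j * RtoC (u ^ j)) (S d) * RtoC (Rpower y (a - 1)))%C).
      assert (HhF : forall y, 0 < y -> ccont hF y) by (intros y Hy; exact (ser_weighted_ccont c (x0 + u) a y Hc Hy)).
      assert (HhT : forall y, 0 < y -> ccont hT y).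
      { intros y Hy. apply ccont_mult; [auto|apply ccont_real, continuous_Rpower, Hy]. }
      replace (CInt h (/ nu n) v) with (CInt hF (/ nu n) v - CInt hT (/ nu n) v)%C.
      2:{ rewrite <- CInt_minus; [|lra| |].
          - apply CInt_ext; [lra|]. intros; unfold hF, hT, h; ring.
          - intros t Ht; apply HhF; lra.
          - intros t Ht; apply HhT; lra. }
      unfold Cminus. eapply Rle_trans; [apply Cmod_triangle|]. rewrite Cmod_opp, Rmult_plus_distr_r.
      apply Rplus_le_compat.
      + pose proof (Rpower_pos 2 sg) as H2s. pose proof (Rpower_pos v sg) as Hvs.
        eapply Rle_trans; [apply (CInt_pow_pos hF (K1 * (Rpower 2 sg * Rpower v sg)) (a - A)); auto; try lra|].
        * apply Rmult_le_pos; [auto|]. apply Rmult_le_pos; lra.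
        * intros y Hy. unfold hF. rewrite Cmod_mult, Cmod_R, Rabs_pos_eq by (apply Rlt_le, Rpower_pos).
          replace (a - A - 1) with (- A + (a - 1)) by ring. rewrite (Rpower_plus (- A)).
          rewrite <- Rmult_assoc. apply Rmult_le_compat_r; [apply Rlt_le, Rpower_pos|].
          eapply Rle_trans; [apply HF; lra|]. rewrite Rmult_assoc. apply Rmult_le_compat_l; auto.
          rewrite Rmult_comm. apply Rmult_le_compat_r; [apply Rlt_le, Rpower_pos|].
          rewrite Rpower_mult_distr by lra. apply Rle_Rpower_l; auto. unfold v in *. lra.
        * right. assert (E : Rpower v s = Rpower v sg * Rpower v (a - A)).
          { rewrite <- Rpower_plus. f_equal. unfold sg, A; ring. }
          rewrite E. ring.
      + eapply Rle_trans; [apply (CInt_pow_pos hT (INR (S d) * K3 * v ^ d) (s - INR d)); auto; try lra|].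
        * apply Rmult_le_pos; [apply Rmult_le_pos; [apply pos_INR|auto]|apply pow_le; lra].
        * intros y Hy. unfold hT. rewrite Cmod_mult, Cmod_R, Rabs_pos_eq by (apply Rlt_le, Rpower_pos).
          replace (s - INR d - 1) with (s - a - INR d + (a - 1)) by ring.
          rewrite (Rpower_plus (s - a - INR d)), <- Rmult_assoc.
          apply Rmult_le_compat_r; [apply Rlt_le, Rpower_pos|].
          rewrite !Rmult_assoc. apply Csum_bound. intros j Hj.
          rewrite Cmod_mult, Cmod_R, <- RPow_abs. fold v.
          assert (Hy0 : 0 < y) by lra.
          eapply Rle_trans; [apply Rmult_le_compat_r; [apply pow_le; lra|apply HT; [auto|lia]]|].
          rewrite Rmult_assoc. apply Rmult_le_compat_l; auto.
          unfold Rminus. rewrite !Rpower_plus, !Rpower_Ropp, !Rpower_pow by auto.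
          rewrite !(Rmult_comm _ (v ^ _)).
          replace d with (j + (d - j))%nat by lia. rewrite !pow_add.
          assert (Hyj : 0 < y ^ j) by (apply pow_lt; auto).
          assert (Hydj : 0 < y ^ (d - j)) by (apply pow_lt; auto).
          assert (Hvj : 0 < v ^ j) by (apply pow_lt; auto).
          assert (Hle : y ^ (d - j) <= v ^ (d - j)) by (apply pow_incr; lra).
          pose proof (Rpower_pos y s) as P1. pose proof (Rpower_pos y a) as P2.
          replace (v ^ j * v ^ (d - j) * (Rpower y s * / Rpower y a * / (y ^ j * y ^ (d - j)))) with
            (v ^ j * (Rpower y s * / Rpower y a * / y ^ j) * (v ^ (d - j) * / y ^ (d - j)))
            by (field; lra).
          rewrite <- (Rmult_1_r (v ^ j * (Rpower y s * / Rpower y a * / y ^ j))) at 1.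
          apply Rmult_le_compat_l.
          -- assert (0 < / Rpower y a) by (apply Rinv_0_lt_compat; auto).
             assert (0 < / y ^ j) by (apply Rinv_0_lt_compat; auto).
             apply Rlt_le. repeat apply Rmult_lt_0_compat; auto.
          -- apply Rmult_le_reg_r with (y ^ (d - j)); auto.
             rewrite Rmult_assoc, Rinv_l, Rmult_1_l, Rmult_1_r by lra. exact Hle.
        * right. replace (Rpower v s) with (v ^ d * Rpower v (s - INR d)).
          -- ring.
          -- rewrite <- Rpower_pow, <- Rpower_plus by auto. f_equal. ring.
    - eapply Rle_trans; [apply (CInt_pow_neg h (K2 * v ^ S d) (s - INR d - 1)); auto; try lra|].
      + apply Rmult_le_pos; [auto|apply pow_le; lra].
      + intros y Hy. unfold h. rewrite Cmod_mult, Cmod_R, Rabs_pos_eq by (apply Rlt_le, Rpower_pos).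
        replace (s - INR d - 1 - 1) with (s - a - INR d - 1 + (a - 1)) by ring.
        rewrite (Rpower_plus (s - a - INR d - 1)), <- Rmult_assoc.
        apply Rmult_le_compat_r; [apply Rlt_le, Rpower_pos|].
        eapply Rle_trans; [apply HR; [lra|unfold v in Hy; lra]|]. unfold v. right; ring.
      + right. replace (Rpower v s) with (v ^ S d * Rpower v (s - INR d - 1)).
        * ring.
        * rewrite <- Rpower_pow, <- Rpower_plus by auto. f_equal. rewrite S_INR. ring. }
  rewrite <- EI in Hmain.
  assert (EQ : (RtoC Gm * fal c a (x0 + u) - Csum (fun j => RtoC (u ^ j) * l j) (S d))%C =
    ((I - Csum (fun j => RtoC (u ^ j) * CInt (phi j) (/ nu n) (nu n)) (S d)) +
     (- (I - RtoC Gm * fal c a (x0 + u)) +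
      Csum (fun j => RtoC (u ^ j) * (CInt (phi j) (/ nu n) (nu n) - l j)) (S d)))%C).
  { rewrite (Csum_ext (fun j => RtoC (u ^ j) * (CInt (phi j) (/ nu n) (nu n) - l j))%C
      (fun j => RtoC (u ^ j) * CInt (phi j) (/ nu n) (nu n) - RtoC (u ^ j) * l j)%C) by (intros; ring).
    rewrite Csum_minus. ring. }
  rewrite EQ. eapply Rle_trans; [apply Cmod_triangle|]. apply Rplus_le_compat; [exact Hmain|].
  eapply Rle_trans; [apply Cmod_triangle|]. rewrite Cmod_opp. apply Rle_refl.
Qed.

End Expansion.

(** * The action of the modular group *)

Lemma mdetR (g : SL2Z) : IZR (ma g) * IZR (md g) - IZR (mb g) * IZR (mc g) = 1.
Proof. rewrite <- !mult_IZR, <- minus_IZR, mdet. reflexivity. Qed.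

Lemma jfac_nz g z : upper z -> jfac g z <> RtoC 0.
Proof.
  intros Hz E. unfold upper in Hz. destruct z as [x y]. simpl in Hz. unfold jfac in E.
  pose proof (f_equal Im E) as E2. pose proof (f_equal Re E) as E1. simpl in E1, E2.
  unfold Re, Im in *; simpl in *.
  pose proof (mdetR g) as D.
  assert (Hc : IZR (mc g) = 0) by nra. rewrite Hc in *. assert (IZR (md g) = 0) by lra. nra.
Qed.

Lemma Cmod_sq z : Cmod z ^ 2 = Re z ^ 2 + Im z ^ 2.
Proof. unfold Cmod, Re, Im. rewrite pow2_sqrt; [reflexivity|]. nra. Qed.

Lemma Im_mobius g z : upper z -> Im (mobius g z) = Im z / Cmod (jfac g z) ^ 2.
Proof.
  intros Hz. pose proof (jfac_nz g z Hz) as Hj. rewrite Cmod_sq.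
  assert (Hp : 0 < Re (jfac g z) ^ 2 + Im (jfac g z) ^ 2).
  { rewrite <- Cmod_sq. apply pow_lt. now apply Cmod_gt_0. }
  destruct z as [x y]. unfold mobius, jfac, Re, Im in *; simpl in *.
  pose proof (mdetR g) as D. field_simplify_eq; [|lra].
  transitivity (y * (IZR (ma g) * IZR (md g) - IZR (mb g) * IZR (mc g))); [ring|rewrite D; ring].
Qed.

Lemma mobius_upper g z : upper z -> upper (mobius g z).
Proof.
  intros Hz. pose proof (Im_mobius g z Hz) as E. unfold upper in *. rewrite E.
  apply Rdiv_lt_0_compat; auto. apply pow_lt. apply Cmod_gt_0. now apply jfac_nz.
Qed.

Lemma jfac_mul g h z : upper z ->
  jfac (SL2Z_mul g h) z = (jfac g (mobius h z) * jfac h z)%C.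
Proof.
  intros Hz. pose proof (jfac_nz h z Hz) as Hj. unfold mobius. unfold jfac in *; simpl.
  rewrite !plus_IZR, !mult_IZR, !RtoC_plus, !RtoC_mult. field. auto.
Qed.

Lemma mobius_mul g h z : upper z -> mobius (SL2Z_mul g h) z = mobius g (mobius h z).
Proof.
  intros Hz. pose proof (jfac_nz h z Hz) as Hj.
  pose proof (jfac_nz g (mobius h z) (mobius_upper h z Hz)) as Hgj.
  unfold mobius at 1. rewrite jfac_mul by auto. unfold mobius at 2.
  set (w := jfac g (mobius h z)) in *.
  replace (RtoC (IZR (ma (SL2Z_mul g h))) * z + RtoC (IZR (mb (SL2Z_mul g h))))%C with
   ((RtoC (IZR (ma g)) * mobius h z + RtoC (IZR (mb g))) * jfac h z)%C.
  - field. split; auto.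
  - unfold mobius. simpl. rewrite !plus_IZR, !mult_IZR, !RtoC_plus, !RtoC_mult.
    unfold jfac in *. field. auto.
Qed.

Lemma mobius_one z : mobius SL2Z_one z = z.
Proof.
  unfold mobius, jfac; simpl. replace (RtoC 0 * z + RtoC 1)%C with (RtoC 1) by ring.
  field.
Qed.

Lemma mobius_trans h z : mobius (SL2Z_trans h) z = (z + RtoC (IZR h))%C.
Proof.
  unfold mobius, jfac; simpl. replace (RtoC 0 * z + RtoC 1)%C with (RtoC 1) by ring.
  field.
Qed.

Lemma mobius_identity g z : upper z -> ma g = 1%Z -> mb g = 0%Z -> mc g = 0%Z -> md g = 1%Z ->
  mobius g z = z.
Proof.
  intros _ E1 E2 E3 E4. rewrite <- (mobius_one z) at 2. unfold mobius, jfac.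
  now rewrite E1, E2, E3, E4.
Qed.

Lemma mobius_inv_l g z : upper z -> mobius (SL2Z_inv g) (mobius g z) = z.
Proof.
  intros Hz. rewrite <- mobius_mul by auto. pose proof (mdet g) as D.
  apply mobius_identity; auto; simpl; lia.
Qed.

Lemma mobius_inv_r g z : upper z -> mobius g (mobius (SL2Z_inv g) z) = z.
Proof.
  intros Hz. rewrite <- mobius_mul by auto. pose proof (mdet g) as D.
  apply mobius_identity; auto; simpl; lia.
Qed.

Definition SL2Z_S : SL2Z := MkSL2Z 0 (-1) 1 0 eq_refl.

(** Each inversion after a translation into [|Re z| <= 1/2] doubles the height below 1/2,
    so the reduction stops. *)
Lemma reduce_height k : forall z, upper z -> / 2 <= 2 ^ k * Im z ->
  exists g, / 2 <= Im (mobius g z).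
Proof.
  induction k as [|k IH]; intros z Hz Hk.
  - exists SL2Z_one. rewrite mobius_one. simpl in Hk. lra.
  - destruct (Rle_dec (/ 2) (Im z)) as [H|H].
    { exists SL2Z_one. now rewrite mobius_one. }
    set (n := Int_part (Re z + / 2)).
    assert (Hn : Rabs (Re z - IZR n) <= / 2).
    { destruct (base_Int_part (Re z + / 2)) as [A1 A2]. fold n in A1, A2. apply Rabs_le. lra. }
    set (z' := mobius (SL2Z_trans (- n)) z).
    assert (Ez : z' = (z + RtoC (IZR (- n)))%C) by apply mobius_trans.
    assert (Hz' : upper z') by now apply mobius_upper.
    assert (Ei : Im z' = Im z) by (rewrite Ez; unfold Im; simpl; ring).
    assert (Er : Re z' = Re z - IZR n) by (rewrite Ez, opp_IZR; unfold Re; simpl; ring).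
    assert (Hm : Cmod (jfac SL2Z_S z') ^ 2 <= / 2).
    { unfold jfac; simpl mc; simpl md. replace (RtoC 1 * z' + RtoC 0)%C with z' by ring.
      rewrite Cmod_sq, Ei, Er. unfold upper in Hz.
      apply Rabs_le_between in Hn. nra. }
    assert (Hp : 0 < Cmod (jfac SL2Z_S z') ^ 2).
    { apply pow_lt, Cmod_gt_0. now apply jfac_nz. }
    assert (HS : 2 * Im z <= Im (mobius SL2Z_S z')).
    { rewrite Im_mobius by auto. rewrite Ei. unfold upper in Hz.
      apply Rmult_le_reg_r with (Cmod (jfac SL2Z_S z') ^ 2); auto.
      set (M := Cmod (jfac SL2Z_S z') ^ 2) in *.
      replace (Im z / M * M) with (Im z) by (field; lra). nra. }
    destruct (IH (mobius SL2Z_S z')) as [g Hg].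
    + now apply mobius_upper.
    + simpl in Hk. assert (0 < 2 ^ k) by (apply pow_lt; lra). nra.
    + exists (SL2Z_mul g (SL2Z_mul SL2Z_S (SL2Z_trans (- n)))).
      rewrite mobius_mul, (mobius_mul SL2Z_S) by auto. exact Hg.
Qed.

Lemma reduce_upper z : upper z -> exists g, / 2 <= Im (mobius g z).
Proof.
  intros Hz. unfold upper in Hz.
  destruct (Pow_x_infinity 2 ltac:(rewrite Rabs_pos_eq; lra) (/ Im z)) as [N HN].
  specialize (HN N (Nat.le_refl N)).
  apply (reduce_height N); auto.
  assert (H2 : 0 < 2 ^ N) by (apply pow_lt; lra). rewrite Rabs_pos_eq in HN by lra.
  apply Rge_le in HN. apply (Rmult_le_compat_r (Im z)) in HN; [|lra]. rewrite Rinv_l in HN by lra. lra.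
Qed.

Definition congruent_mod (N : Z) (g h : SL2Z) : Prop :=
  (N | ma g - ma h)%Z /\ (N | mb g - mb h)%Z /\ (N | mc g - mc h)%Z /\ (N | md g - md h)%Z.

Lemma congruent_quotient N g h : congruent_mod N g h ->
  principal_congruence N (SL2Z_mul g (SL2Z_inv h)).
Proof.
  intros [[k1 E1] [[k2 E2] [[k3 E3] [k4 E4]]]]. pose proof (mdet h) as D.
  repeat split; simpl.
  - exists (k1 * md h - k2 * mc h)%Z.
    transitivity ((ma g - ma h) * md h - (mb g - mb h) * mc h)%Z; [rewrite <- D; ring|rewrite E1, E2; ring].
  - exists (k2 * ma h - k1 * mb h)%Z.
    transitivity ((mb g - mb h) * ma h - (ma g - ma h) * mb h)%Z; [ring|rewrite E1, E2; ring].
  - exists (k3 * md h - k4 * mc h)%Z.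
    transitivity ((mc g - mc h) * md h - (md g - md h) * mc h)%Z; [ring|rewrite E3, E4; ring].
  - exists (k4 * ma h - k3 * mb h)%Z.
    transitivity ((md g - md h) * ma h - (mc g - mc h) * mb h)%Z; [rewrite <- D; ring|rewrite E3, E4; ring].
Qed.

(** The elements that move a point towards the cusp [g(oo)]. *)
Lemma parabolic_congruence N g k :
  principal_congruence N (SL2Z_mul (SL2Z_mul g (SL2Z_trans (N * k))) (SL2Z_inv g)).
Proof.
  pose proof (mdet g) as D. repeat split; simpl.
  - exists (- ma g * mc g * k)%Z.
    transitivity ((ma g * md g - mb g * mc g) - 1 + - ma g * mc g * k * N)%Z; [ring|rewrite D; ring].
  - exists (ma g * ma g * k)%Z. ring.
  - exists (- mc g * mc g * k)%Z. ring.
  - exists (ma g * mc g * k)%Z.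
    transitivity ((ma g * md g - mb g * mc g) - 1 + ma g * mc g * k * N)%Z; [ring|rewrite D; ring].
Qed.

Lemma finite_bound (n : nat) (P : nat -> R -> Prop) :
  (forall i K K', K <= K' -> P i K -> P i K') ->
  (forall i, (i < n)%nat -> exists K, P i K) -> exists K, forall i, (i < n)%nat -> P i K.
Proof.
  intros Hmon. induction n as [|n IH]; intros H.
  - exists 0. intros; lia.
  - destruct IH as [K HK]; [intros; apply H; lia|]. destruct (H n) as [K' HK']; [lia|].
    exists (Rmax K K'). intros i Hi. destruct (Nat.eq_dec i n) as [->|Hn].
    + apply Hmon with K'; [apply Rmax_r|auto].
    + apply Hmon with K; [apply Rmax_l|apply HK; lia].
Qed.

(** Finiteness of the index of the principal congruence group, in the form needed: a bound that
    depends only on the residues of the entries may be chosen uniformly. *)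
Lemma finite_residues (N : Z) (B : SL2Z -> R -> Prop) : (0 < N)%Z ->
  (forall g K K', K <= K' -> B g K -> B g K') ->
  (forall g h K, congruent_mod N g h -> B h K -> B g K) ->
  (forall g, exists K, B g K) -> exists K, forall g, B g K.
Proof.
  intros HN Hmon Hcong Hex.
  set (res := fun m : Z => Z.to_nat (m mod N)).
  assert (Hres : forall m, (res m < Z.to_nat N)%nat).
  { intros m. unfold res. pose proof (Z.mod_pos_bound m N HN). lia. }
  assert (Hdiv : forall m m', res m = res m' -> (N | m - m')%Z).
  { intros m m' E. unfold res in E. pose proof (Z.mod_pos_bound m N HN). pose proof (Z.mod_pos_bound m' N HN).
    assert (E2 : (m mod N = m' mod N)%Z) by lia.
    exists (m / N - m' / N)%Z. rewrite (Z.div_mod m N), (Z.div_mod m' N) at 1 by lia. rewrite E2. ring. }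
  set (P := fun i j k l K => forall g, res (ma g) = i -> res (mb g) = j -> res (mc g) = k ->
     res (md g) = l -> B g K).
  assert (HP : forall i j k l, exists K, P i j k l K).
  { intros i j k l.
    destruct (classic (exists h, res (ma h) = i /\ res (mb h) = j /\ res (mc h) = k /\ res (md h) = l))
      as [[h [E1 [E2 [E3 E4]]]]|Hno].
    - destruct (Hex h) as [K HK]. exists K. intros g F1 F2 F3 F4. apply Hcong with h; auto.
      repeat split; apply Hdiv; congruence.
    - exists 0. intros g F1 F2 F3 F4. exfalso. apply Hno. exists g. auto. }
  assert (M : forall i j k l K K', K <= K' -> P i j k l K -> P i j k l K').
  { intros i j k l K K' HK H g F1 F2 F3 F4. apply Hmon with K; auto. }
  set (n := Z.to_nat N) in *.
  assert (Q1 : forall i j k, exists K, forall l, (l < n)%nat -> P i j k l K).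
  { intros i j k. apply finite_bound; [intros l K K'; apply M|]. intros l _. apply HP. }
  assert (Q2 : forall i j, exists K, forall k, (k < n)%nat -> forall l, (l < n)%nat -> P i j k l K).
  { intros i j. apply (finite_bound n (fun k K => forall l, (l < n)%nat -> P i j k l K)).
    - intros k K K' HK H l Hl. apply M with K; auto.
    - intros k _. apply Q1. }
  assert (Q3 : forall i, exists K, forall j, (j < n)%nat -> forall k, (k < n)%nat ->
     forall l, (l < n)%nat -> P i j k l K).
  { intros i. apply (finite_bound n (fun j K => forall k, (k < n)%nat -> forall l, (l < n)%nat -> P i j k l K)).
    - intros j K K' HK H k Hk l Hl. apply M with K; auto.
    - intros j _. apply Q2. }
  destruct (finite_bound n (fun i K => forall j, (j < n)%nat -> forall k, (k < n)%nat ->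
     forall l, (l < n)%nat -> P i j k l K)) as [K HK].
  - intros i K K' HK H j Hj k Hk l Hl. apply M with K; auto.
  - intros i _. apply Q3.
  - exists K. intros g. apply (HK (res (ma g)) (Hres _) (res (mb g)) (Hres _) (res (mc g)) (Hres _)
      (res (md g)) (Hres _) g); auto.
Qed.

(** * The invariant function y^(r/2) |f(z)| *)

Lemma Cmod_Cexp z : Cmod (Cexp z) = exp (Re z).
Proof.
  unfold Cexp, Cmod; simpl.
  replace (exp (Re z) * cos (Im z) * (exp (Re z) * cos (Im z) * 1) +
    exp (Re z) * sin (Im z) * (exp (Re z) * sin (Im z) * 1)) with (Rsqr (exp (Re z))).
  - rewrite sqrt_Rsqr; [reflexivity|apply Rlt_le, exp_pos].
  - pose proof (sin2_cos2 (Im z)) as H. unfold Rsqr in *.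
    transitivity (exp (Re z) * exp (Re z) * (sin (Im z) * sin (Im z) + cos (Im z) * cos (Im z)));
      [rewrite H; ring|ring].
Qed.

Lemma Cmod_Crpow z s : Cmod (Crpow z s) = Rpower (Cmod z) s.
Proof. unfold Crpow. rewrite Cmod_Cexp. unfold Rpower. f_equal. simpl. ring. Qed.

Lemma ee_pt k x y : ee (RtoC k * (x, y))%C = (RtoC (exp (- (2 * PI * k * y))) * cis (k * x))%C.
Proof.
  unfold ee, Cexp, cis, Cmult, RtoC, Ci, Re, Im; simpl.
  replace ((2 * PI * 0 - 0 * 1) * (k * x - 0 * y) - (2 * PI * 1 + 0 * 0) * (k * y + 0 * x))
    with (- (2 * PI * k * y)) by ring.
  replace ((2 * PI * 0 - 0 * 1) * (k * y + 0 * x) + (2 * PI * 1 + 0 * 0) * (k * x - 0 * y))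
    with (2 * PI * (k * x)) by ring.
  f_equal; ring.
Qed.

Lemma Cmod_ee k z : Cmod (ee (RtoC k * z)%C) = exp (- (2 * PI * k * Im z)).
Proof.
  destruct z as [x y]. rewrite ee_pt, Cmod_mult, Cmod_cis, Cmod_R, Rabs_pos_eq.
  - simpl. ring.
  - apply Rlt_le, exp_pos.
Qed.

Lemma is_Cseries_term_bounded u l : is_Cseries u l -> exists B, 0 <= B /\ forall n, Cmod (u n) <= B.
Proof.
  intros H. pose proof (is_Cseries_lim u l H) as L.
  assert (Hb : forall e : nat -> R, is_lim_seq e 0 -> exists B, 0 <= B /\ forall n, Rabs (e n) <= B).
  { intros e He. destruct (lim0_ev e 1 He Rlt_0_1) as [N HN].
    destruct (finite_bound N (fun i K => Rabs (e i) <= K)) as [K HK].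
    - intros; lra.
    - intros i _. exists (Rabs (e i)). lra.
    - exists (Rmax K 1). split; [apply Rle_trans with 1; [lra|apply Rmax_r]|]. intros n.
      destruct (Nat.lt_ge_cases n N) as [Hn|Hn].
      + eapply Rle_trans; [apply HK, Hn|apply Rmax_l].
      + eapply Rle_trans; [apply Rlt_le, HN, Hn|apply Rmax_r]. }
  destruct (Hb _ L) as [B [HB0 HB]]. exists (B + B). split; [lra|]. intros n.
  replace (u n) with ((Csum u (S n) - l) - (Csum u n - l))%C by (simpl; ring).
  unfold Cminus at 1. eapply Rle_trans; [apply Cmod_triangle|]. rewrite Cmod_opp.
  pose proof (HB n) as B1. pose proof (HB (S n)) as B2.
  rewrite Rabs_pos_eq in B1, B2 by apply Cmod_ge_0. lra.
Qed.

(** Exponents with a nonzero coefficient are at least [k1 > 0], since the form vanishes at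
    the cusp.  Convergence at height 1/4 bounds the coefficients, and above height 1/2 half of
    the remaining decay is given to [exp (- del y)], half to a geometric series. *)
Lemma cusp_decay G r f sigma : cusp_form G r f -> exists K del, 0 <= K /\ 0 < del /\
  forall w, / 2 <= Im w -> Cmod (slash r f sigma w) <= K * exp (- (del * Im w)).
Proof.
  intros [[_ [_ Hhol]] Hvan]. destruct (Hhol sigma) as [h [kap [c Hexp]]].
  pose proof (Hvan sigma h kap c Hexp) as Hc0. destruct Hexp as [[Hh _] [Hkap Hser]].
  pose proof PI_RGT_0 as HPI.
  assert (HhR : 0 < IZR h) by (apply IZR_lt; auto).
  assert (Hih : 0 < / IZR h) by (apply Rinv_0_lt_compat; auto).
  assert (Hup : upper (0, / 4)) by (unfold upper; simpl; lra).
  destruct (is_Cseries_term_bounded _ _ (Hser _ Hup)) as [B [HB0 HB]].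
  set (k1 := if Rle_dec kap 0 then 1 else kap).
  assert (Hk1 : 0 < k1) by (unfold k1; destruct (Rle_dec kap 0); lra).
  set (q := exp (- (PI * / IZR h * / 4))).
  assert (Hpos : 0 < PI * / IZR h) by (apply Rmult_lt_0_compat; auto).
  assert (Hq : 0 < q < 1).
  { unfold q. split; [apply exp_pos|]. rewrite <- exp_0. apply exp_increasing. lra. }
  assert (Hiq : 0 < / (1 - q)) by (apply Rinv_0_lt_compat; lra).
  set (del := PI * / IZR h * k1 / 2).
  assert (Hdel : 0 < del) by (unfold del; assert (0 < PI * / IZR h * k1) by (apply Rmult_lt_0_compat; auto); lra).
  exists (B * / (1 - q)), del.
  split; [apply Rmult_le_pos; lra|]. split; auto. intros w Hw.
  assert (Hwu : upper w) by (unfold upper; lra).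
  set (u := fun n => (c n * ee (RtoC ((INR n + kap) / IZR h) * w))%C).
  assert (Hterm : forall n, Cmod (u n) <= B * exp (- (del * Im w)) * q ^ n).
  { intros n. destruct (classic (c n = RtoC 0)) as [E|E].
    - unfold u. rewrite E. replace (RtoC 0 * ee (RtoC ((INR n + kap) / IZR h) * w))%C with (RtoC 0) by ring.
      rewrite Cmod_0. apply Rmult_le_pos; [apply Rmult_le_pos; [auto|apply Rlt_le, exp_pos]|apply pow_le; lra].
    - assert (Hn : k1 <= INR n + kap).
      { unfold k1. pose proof (pos_INR n). destruct (Rle_dec kap 0) as [K|K]; [|lra].
        destruct n as [|n]; [exfalso; apply E, Hc0; lra|]. rewrite S_INR in *.
        pose proof (pos_INR n). lra. }
      unfold u. rewrite Cmod_mult, Cmod_ee. specialize (HB n). rewrite Cmod_mult, Cmod_ee in HB.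
      simpl Im in HB. set (m := INR n + kap) in *. set (y := Im w) in *.
      assert (Hlast : exp (- (2 * PI * (m / IZR h) * y)) <=
         exp (- (2 * PI * (m / IZR h) * / 4)) * (exp (- (del * y)) * q ^ n)).
      { unfold q. rewrite exp_pow, <- !exp_plus. apply exp_le_mono. unfold del.
        assert (Hnm : INR n <= m) by (unfold m; lra). pose proof (pos_INR n) as Hn0.
        set (P := PI * / IZR h) in *. replace (2 * PI * (m / IZR h)) with (2 * P * m) by (unfold P; field; lra).
        assert (0 <= P * (y - / 2)) by (apply Rmult_le_pos; lra).
        assert (0 <= P * (m - k1)) by (apply Rmult_le_pos; lra).
        assert (0 <= P * (m - INR n)) by (apply Rmult_le_pos; lra).
        assert (A1 : P * k1 / 2 * y <= P * m / 2 * y) by nra.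
        assert (A2 : INR n * (P * / 4) <= m * (P * / 4)) by nra.
        assert (A3 : P * m * / 2 <= P * m * y) by (apply Rmult_le_compat_l; [apply Rmult_le_pos; lra|auto]).
        nra. }
      apply Rle_trans with (Cmod (c n) * (exp (- (2 * PI * (m / IZR h) * / 4)) * (exp (- (del * y)) * q ^ n))).
      + apply Rmult_le_compat_l; [apply Cmod_ge_0|exact Hlast].
      + rewrite <- Rmult_assoc, (Rmult_assoc B). apply Rmult_le_compat_r; auto.
        apply Rmult_le_pos; [apply Rlt_le, exp_pos|apply pow_le; lra]. }
  set (X := B * exp (- (del * Im w))).
  assert (HX : 0 <= X) by (apply Rmult_le_pos; [auto|apply Rlt_le, exp_pos]).
  assert (Hsum : forall n, Cmod (Csum u n) <= X * / (1 - q)).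
  { intros n. pose proof (Csum_telescope u (fun k => X * / (1 - q) * q ^ k) 0 n (Nat.le_0_l n)) as T.
    simpl (Csum u 0) in T. replace (Csum u n - RtoC 0)%C with (Csum u n) in T by ring.
    eapply Rle_trans; [apply T|].
    - intros k _. eapply Rle_trans; [apply Hterm|]. fold X. simpl. right. field. lra.
    - simpl. assert (0 <= X * / (1 - q) * q ^ n); [|lra].
      apply Rmult_le_pos; [apply Rmult_le_pos; lra|apply pow_le; lra]. }
  specialize (Hser w Hwu). fold u in Hser.
  apply le_of_le_lim0 with (1 := is_Cseries_lim u _ Hser). exists 0%nat. intros n _.
  pose proof (Cmod_ge_minus (slash r f sigma w) (Csum u n)) as T. rewrite Cmod_minus_sym in T.
  specialize (Hsum n). replace (B * / (1 - q) * exp (- (del * Im w))) with (X * / (1 - q))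
    by (unfold X; ring). lra.
Qed.

Definition Phi (r : R) (f : C -> C) (z : C) : R := Rpower (Im z) (r / 2) * Cmod (f z).

Lemma Rpower_div_sq y m r : 0 < y -> 0 < m -> Rpower (y / m ^ 2) (r / 2) = Rpower y (r / 2) * Rpower m (- r).
Proof.
  intros Hy Hm. unfold Rdiv at 1. rewrite <- Rpower_mult_distr.
  - f_equal. unfold Rpower. rewrite ln_Rinv by (apply pow_lt; auto).
    simpl. rewrite Rmult_1_r, ln_mult by auto. f_equal. field.
  - auto.
  - apply Rinv_0_lt_compat, pow_lt; auto.
Qed.

Lemma Phi_slash r f sigma w : upper w ->
  Phi r f (mobius sigma w) = Rpower (Im w) (r / 2) * Cmod (slash r f sigma w).
Proof.
  intros Hw. unfold Phi, slash. pose proof (jfac_nz sigma w Hw) as Hj.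
  assert (Hp : 0 < Cmod (jfac sigma w)) by now apply Cmod_gt_0.
  rewrite Im_mobius, Rpower_div_sq by auto.
  rewrite Cmod_div.
  - rewrite Cmod_Crpow, Rpower_Ropp. unfold Rdiv. ring.
  - apply Cmod_gt_0. rewrite Cmod_Crpow. apply Rpower_pos.
Qed.

Lemma Phi_invariant G r f g z : cusp_form G r f -> G g -> upper z -> Phi r f (mobius g z) = Phi r f z.
Proof.
  intros [[_ [[m [[Hm _] Hf]] _]] _] Hg Hz.
  rewrite Phi_slash by auto. unfold Phi, slash. f_equal.
  rewrite (Hf g Hg z Hz), Cmod_div.
  - rewrite !Cmod_mult, (Hm g Hg), Cmod_Crpow. field. apply Rgt_not_eq, Rpower_pos.
  - apply Cmod_gt_0. rewrite Cmod_Crpow. apply Rpower_pos.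
Qed.

(** Every point is moved above height 1/2, where the expansions at the cusps apply; only
    finitely many of these are different. *)
Lemma Phi_bounded G r f : congruence_group G -> 0 < r -> cusp_form G r f ->
  exists K, 0 <= K /\ forall z, upper z -> Phi r f z <= K.
Proof.
  intros [_ [N [HN HG]]] Hr Hf.
  destruct (finite_residues N (fun g K => forall w, / 2 <= Im w -> Phi r f (mobius g w) <= K)) as [K HK];
    auto.
  - intros g K K' HK H w Hw. eapply Rle_trans; [apply H; auto|auto].
  - intros g h K Hgh H w Hw. assert (Hu : upper w) by (unfold upper; lra).
    assert (Hq : G (SL2Z_mul h (SL2Z_inv g))).
    { apply HG, congruent_quotient. destruct Hgh as [[k1 E1] [[k2 E2] [[k3 E3] [k4 E4]]]].
      repeat split; [exists (- k1)%Z|exists (- k2)%Z|exists (- k3)%Z|exists (- k4)%Z]; lia. }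
    rewrite <- (Phi_invariant G r f _ _ Hf Hq (mobius_upper g w Hu)).
    rewrite mobius_mul by (now apply mobius_upper). rewrite mobius_inv_l by auto. auto.
  - intros g. destruct (cusp_decay G r f g Hf) as [K [del [HK [Hdel Hd]]]].
    destruct (Rpower_exp_bound (r / 2) del) as [L [HL HLb]]; [lra|auto|].
    exists (L * K). intros w Hw. assert (Hu : upper w) by (unfold upper; lra).
    rewrite Phi_slash by auto. specialize (HLb (Im w) Hu). specialize (Hd w Hw).
    rewrite exp_Ropp in Hd. pose proof (exp_pos (del * Im w)) as He.
    apply Rle_trans with ((L * exp (del * Im w)) * (K * / exp (del * Im w))).
    + apply Rmult_le_compat; auto; [apply Rlt_le, Rpower_pos|apply Cmod_ge_0].
    + right. field. lra.
  - assert (Hall : forall z, upper z -> Phi r f z <= K).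
    { intros z Hz. destruct (reduce_upper z Hz) as [g Hg].
      rewrite <- (mobius_inv_l g z Hz). apply HK. auto. }
    exists K. split; auto. eapply Rle_trans; [|apply (Hall (0, 1)); unfold upper; simpl; lra].
    unfold Phi. apply Rmult_le_pos; [apply Rlt_le, Rpower_pos|apply Cmod_ge_0].
Qed.

(** Above height 1/2 the exponential decay beats every power; below, the exponent
    [r/2 - A <= 0] makes the bound weaker than boundedness. *)
Lemma Phi_cusp G r f sigma A : congruence_group G -> 0 < r -> cusp_form G r f -> r / 2 <= A ->
  exists K, 0 <= K /\ forall w, upper w -> Phi r f (mobius sigma w) <= K * Rpower (Im w) (r / 2 - A).
Proof.
  intros HG Hr Hf HA. destruct (Phi_bounded G r f HG Hr Hf) as [K0 [HK0 H0]].
  destruct (cusp_decay G r f sigma Hf) as [K [del [HK [Hdel Hd]]]].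
  destruct (Rpower_exp_bound A del) as [L [HL HLb]]; [lra|auto|].
  exists (K0 + L * K). split; [nra|]. intros w Hw. unfold upper in Hw.
  pose proof (Rpower_pos (Im w) (r / 2 - A)) as Hp.
  destruct (Rle_dec (/ 2) (Im w)) as [H|H].
  - rewrite Phi_slash by auto. specialize (HLb (Im w) Hw). specialize (Hd w H).
    rewrite exp_Ropp in Hd. pose proof (exp_pos (del * Im w)) as He.
    replace (r / 2) with (r / 2 - A + A) at 1 by ring. rewrite Rpower_plus.
    apply Rle_trans with (Rpower (Im w) (r / 2 - A) * ((L * exp (del * Im w)) * (K * / exp (del * Im w)))).
    + rewrite Rmult_assoc. apply Rmult_le_compat_l; [lra|].
      apply Rmult_le_compat; auto; [apply Rlt_le, Rpower_pos|apply Cmod_ge_0].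
    + replace (L * exp (del * Im w) * (K * / exp (del * Im w))) with (L * K) by (field; lra). nra.
  - eapply Rle_trans; [apply H0; now apply mobius_upper|].
    assert (1 <= Rpower (Im w) (r / 2 - A)).
    { replace (r / 2 - A) with (- (A - r / 2)) by ring. rewrite <- (Rpower_1_base (- (A - r / 2))).
      apply Rpower_le_neg; lra. }
    assert (0 <= L * K) by (apply Rmult_le_pos; lra). nra.
Qed.

(** * Bounds for the Fourier series of a cusp form *)

(** The index is shifted so that [coefs a n] belongs to the frequency [n + 1]. *)
Definition coefs (a : nat -> C) (n : nat) : C := a (S n).

Lemma ser_term_ee a x y n :
  ser_term (coefs a) x y n = (a (S n) * ee (RtoC (INR (S n)) * (x, y)))%C.
Proof. unfold ser_term, coefs. rewrite ee_pt. unfold nu. ring. Qed.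

Lemma form_ser a f : (forall z, upper z ->
     is_Cseries (fun n => a (S n) * ee (RtoC (INR (S n)) * z))%C (f z)) ->
  forall x y, 0 < y -> f (x, y) = ser (coefs a) x y.
Proof.
  intros H x y Hy. unfold ser. symmetry.
  assert (E : CSeries (ser_term (coefs a) x y) =
    CSeries (fun n => (a (S n) * ee (RtoC (INR (S n)) * (x, y)))%C)).
  { unfold CSeries. f_equal; apply Series_ext; intros n; now rewrite ser_term_ee. }
  rewrite E. apply CSeries_is. apply H. exact Hy.
Qed.

Lemma form_subexp a f : (forall z, upper z ->
     is_Cseries (fun n => a (S n) * ee (RtoC (INR (S n)) * z))%C (f z)) -> subexp (coefs a).
Proof.
  intros H eta Heta. pose proof PI_RGT_0 as HPI.
  set (y := eta / (2 * PI)). assert (Hy : 0 < y) by (apply Rdiv_lt_0_compat; lra).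
  destruct (is_Cseries_term_bounded _ _ (H (0, y) Hy)) as [B [_ HB]].
  exists B. intros n. specialize (HB n). rewrite Cmod_mult, Cmod_ee in HB. simpl Im in HB.
  unfold coefs. fold (nu n) in HB.
  replace (2 * PI * nu n * y) with (eta * nu n) in HB by (unfold y; field; lra).
  rewrite exp_Ropp in HB. pose proof (exp_pos (eta * nu n)).
  apply Rmult_le_reg_r with (/ exp (eta * nu n)); [apply Rinv_0_lt_compat; auto|].
  rewrite (Rmult_assoc B), Rinv_r, Rmult_1_r by lra. exact HB.
Qed.

Lemma Rpower_unbounded e K : 0 < e -> exists X0, 0 < X0 /\ forall X, X0 <= X -> K < Rpower X e.
Proof.
  intros He. exists (Rpower (Rabs K + 1) (/ e)). split; [apply Rpower_pos|]. intros X HX.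
  pose proof (Rabs_pos K). pose proof (Rle_abs K).
  apply Rlt_le_trans with (Rabs K + 1); [lra|].
  replace (Rabs K + 1) with (Rpower (Rpower (Rabs K + 1) (/ e)) e).
  - apply Rle_Rpower_l; [lra|]. split; [apply Rpower_pos|auto].
  - rewrite Rpower_mult, Rinv_l, Rpower_1; lra.
Qed.

Section Form.
Variables (G : SL2Z -> Prop) (r : R) (f : C -> C) (a : nat -> C).
Hypotheses (HG : congruence_group G) (Hr : 0 < r) (Hf : cusp_form G r f).
Hypothesis ha : forall z, upper z ->
     is_Cseries (fun n => a (S n) * ee (RtoC (INR (S n)) * z))%C (f z).

Lemma Cmod_ser_Phi x y : 0 < y ->
  Cmod (ser (coefs a) x y) = Rpower y (- (r / 2)) * Phi r f (x, y).
Proof.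
  intros Hy. rewrite <- (form_ser a f ha) by auto. unfold Phi. simpl Im.
  rewrite <- Rmult_assoc, <- Rpower_plus, Rplus_opp_l, Rpower_O by auto. ring.
Qed.

Lemma form_bound A : r / 2 <= A -> exists K, forall x y, 0 < y ->
  Cmod (ser (coefs a) x y) <= K * Rpower y (- A).
Proof.
  intros HA. destruct (Phi_cusp G r f SL2Z_one A HG Hr Hf HA) as [K [HK H]].
  exists K. intros x y Hy. rewrite Cmod_ser_Phi by auto.
  specialize (H (x, y) Hy). rewrite mobius_one in H. simpl Im in H.
  replace (- A) with (- (r / 2) + (r / 2 - A)) by ring. rewrite (Rpower_plus (- (r / 2))).
  pose proof (Rpower_pos y (- (r / 2))). nra.
Qed.

(** A matrix sending the infinite cusp to [q]; the fraction has to be reduced first. *)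
Lemma rational_cusp (q : QArith_base.Q) : exists sigma, (0 < mc sigma)%Z /\
  Q2R q = IZR (ma sigma) / IZR (mc sigma).
Proof.
  destruct q as [n d]. set (g := Z.gcd n (Zpos d)).
  assert (Hg : (0 < g)%Z).
  { pose proof (Z.gcd_nonneg n (Zpos d)). assert (g <> 0%Z); [|unfold g in *; lia].
    intros E. apply Z.gcd_eq_0_r in E. discriminate. }
  destruct (Z.gcd_divide_l n (Zpos d)) as [n' En]. destruct (Z.gcd_divide_r n (Zpos d)) as [d' Ed].
  fold g in En, Ed.
  assert (Hd' : (0 < d')%Z) by nia.
  destruct (Z.gcd_bezout n (Zpos d) g eq_refl) as [u [v E]].
  assert (E1 : (u * n' + v * d' = 1)%Z).
  { apply (Z.mul_reg_r _ _ g); [lia|]. nia. }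
  assert (D : (n' * u - (- v) * d' = 1)%Z) by (rewrite <- E1; ring).
  exists (MkSL2Z n' (- v) d' u D). simpl. split; auto.
  unfold Q2R; simpl. rewrite En, Ed, !mult_IZR.
  assert (IZR g <> 0) by (apply not_0_IZR; lia). assert (IZR d' <> 0) by (apply not_0_IZR; lia).
  field. split; auto.
Qed.

(** [Phi_cusp] at the cusp [x0], where the height is [y / (t |w|)^2] with [t] the
    denominator of [x0]. *)
Lemma form_bound_rational (q : QArith_base.Q) A : r / 2 <= A -> exists K, forall u y, 0 < y ->
  Cmod (ser (coefs a) (Q2R q + u) y) <=
    K * (Rpower y (- A) * Rpower (Rabs u + y) (2 * (A - r / 2))).
Proof.
  intros HA. destruct (rational_cusp q) as [sigma [Hc Eq]].
  destruct (Phi_cusp G r f sigma A HG Hr Hf HA) as [K [HK H]].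
  set (t := IZR (mc sigma)) in *. assert (Ht : 0 < t) by (apply IZR_lt; auto).
  exists (K * Rpower t (2 * (A - r / 2))). intros u y Hy. rewrite Cmod_ser_Phi by auto.
  set (z := (Q2R q + u, y) : C). assert (Hz : upper z) by exact Hy.
  set (w := mobius (SL2Z_inv sigma) z). assert (Hw : upper w) by now apply mobius_upper.
  specialize (H w Hw). unfold w in H at 1. rewrite mobius_inv_r in H by auto.
  set (m := Rabs u + y). assert (Hm : 0 < m) by (unfold m; pose proof (Rabs_pos u); lra).
  assert (Hj : Cmod (jfac (SL2Z_inv sigma) z) ^ 2 <= (t * m) ^ 2).
  { rewrite Cmod_sq. unfold jfac, z, Re, Im; simpl. rewrite opp_IZR. fold t. rewrite Eq.
    replace (- t * (IZR (ma sigma) / t + u) - 0 * y + IZR (ma sigma)) with (- (t * u)) by (field; lra).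
    unfold m. pose proof (Rabs_pos u). pose proof (pow2_abs u) as Q. simpl in Q.
    assert (0 <= t * t) by nra. assert (0 <= Rabs u * y) by nra.
    assert (T : u * (u * 1) + y * y <= (Rabs u + y) * (Rabs u + y)) by nra.
    apply (Rmult_le_compat_l (t * t)) in T; [|auto]. nra. }
  assert (Hj0 : 0 < Cmod (jfac (SL2Z_inv sigma) z) ^ 2).
  { apply pow_lt, Cmod_gt_0. now apply jfac_nz. }
  assert (HIm : y / (t * m) ^ 2 <= Im w).
  { unfold w. rewrite Im_mobius by auto. simpl Im. unfold Rdiv. apply Rmult_le_compat_l; [lra|].
    apply Rinv_le_contravar; auto. }
  assert (Htm : 0 < t * m) by (apply Rmult_lt_0_compat; auto).
  assert (HP : Rpower (Im w) (r / 2 - A) <= Rpower (y / (t * m) ^ 2) (r / 2 - A)).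
  { replace (r / 2 - A) with (- (A - r / 2)) by ring. apply Rpower_le_neg; [lra|].
    split; auto. apply Rdiv_lt_0_compat; auto. apply pow_lt; auto. }
  assert (HE : Rpower (y / (t * m) ^ 2) (r / 2 - A) =
     Rpower y (r / 2 - A) * (Rpower t (2 * (A - r / 2)) * Rpower m (2 * (A - r / 2)))).
  { rewrite Rpower_mult_distr by auto.
    replace (r / 2 - A) with (2 * (r / 2 - A) / 2) by field.
    rewrite Rpower_div_sq by auto. f_equal. f_equal. ring. }
  rewrite HE in HP.
  replace (- A) with (- (r / 2) + (r / 2 - A)) by ring. rewrite (Rpower_plus (- (r / 2))).
  pose proof (Rpower_pos y (- (r / 2))) as Hpy.
  apply Rle_trans with (Rpower y (- (r / 2)) * (K * (Rpower y (r / 2 - A) *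
     (Rpower t (2 * (A - r / 2)) * Rpower m (2 * (A - r / 2)))))).
  - apply Rmult_le_compat_l; [lra|]. eapply Rle_trans; [apply H|]. apply Rmult_le_compat_l; auto.
  - right; ring.
Qed.

(** The images of one point under the parabolic subgroup fixing a rational number tend to it
    tangentially, and the invariant function is constant along them. *)
Lemma form_large (q : QArith_base.Q) : (exists z, upper z /\ f z <> RtoC 0) ->
  exists t Y c0, 0 < t /\ 0 < Y /\ 0 < c0 /\ forall X0, exists X, X0 <= X /\ 0 < X /\
   Cmod (ser (coefs a) (Q2R q + - (X / (t * (X ^ 2 + Y ^ 2)))) (Y / (t * (X ^ 2 + Y ^ 2)))) =
     c0 * Rpower (Y / (t * (X ^ 2 + Y ^ 2))) (- (r / 2)).
Proof.
  intros [z0 [Hz0 Hfz0]]. destruct (rational_cusp q) as [sigma [Hc Eq]].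
  pose proof HG as [_ [N [HN HGN]]].
  set (t := IZR (mc sigma)) in *. assert (Ht : 0 < t) by (apply IZR_lt; auto).
  set (w := mobius (SL2Z_inv sigma) z0). assert (Hw : upper w) by now apply mobius_upper.
  set (Y := t * Im w). assert (HY : 0 < Y) by (apply Rmult_lt_0_compat; auto).
  exists t, Y, (Phi r f z0). split; auto. split; auto. split.
  { apply Rmult_lt_0_compat; [apply Rpower_pos|]. now apply Cmod_gt_0. }
  intros X0. set (b := t * Re w + IZR (md sigma)).
  assert (HNR : 1 <= IZR N) by (apply IZR_le; lia).
  destruct (exists_nat_gt ((Rabs X0 + 1 + Rabs b) / t)) as [k Hk].
  set (X := t * (Re w + IZR (N * Z.of_nat k)) + IZR (md sigma)).
  assert (HX : Rabs X0 + 1 <= X).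
  { unfold X. rewrite mult_IZR, <- INR_IZR_INZ.
    apply (Rmult_lt_compat_l t) in Hk; auto.
    replace (t * ((Rabs X0 + 1 + Rabs b) / t)) with (Rabs X0 + 1 + Rabs b) in Hk by (field; lra).
    pose proof (Rle_abs (- b)) as Q. rewrite Rabs_Ropp in Q.
    assert (t * INR k <= t * (IZR N * INR k)).
    { apply Rmult_le_compat_l; [lra|]. pose proof (pos_INR k). nra. }
    unfold b in *. lra. }
  exists X. pose proof (Rle_abs X0). pose proof (Rabs_pos X0). split; [lra|]. split; [lra|].
  set (D := t * (X ^ 2 + Y ^ 2)).
  assert (HXY : 0 < X ^ 2 + Y ^ 2) by nra.
  assert (HD : 0 < D) by (apply Rmult_lt_0_compat; auto).
  set (g := SL2Z_mul (SL2Z_mul sigma (SL2Z_trans (N * Z.of_nat k))) (SL2Z_inv sigma)).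
  assert (Hg : G g) by apply HGN, parabolic_congruence.
  assert (Ez : mobius g z0 = (Q2R q + - (X / D), Y / D)).
  { unfold g. rewrite mobius_mul by auto. fold w. rewrite mobius_mul by auto. rewrite mobius_trans.
    set (w' := (w + RtoC (IZR (N * Z.of_nat k)))%C).
    assert (EX : X = t * Re w' + IZR (md sigma)) by (unfold X, w', Re; simpl; ring).
    assert (EY : Y = t * Im w') by (unfold Y, w', Im; simpl; ring).
    pose proof (mdetR sigma) as Dt. fold t in Dt.
    assert (Hb : IZR (mb sigma) = (IZR (ma sigma) * IZR (md sigma) - 1) / t) by (field_simplify_eq; lra).
    assert (Ej : jfac sigma w' = (X, Y)).
    { unfold jfac. fold t. rewrite EX, EY. destruct w' as [w1 w2].
      unfold Cmult, Cplus, RtoC, Re, Im; simpl. f_equal; ring. }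
    assert (Hj : ((X, Y) : C) <> RtoC 0).
    { intros E. apply (f_equal snd) in E. simpl in E. lra. }
    assert (Htc : RtoC t <> RtoC 0) by (intros E; apply RtoC_inj in E; lra).
    transitivity (RtoC (IZR (ma sigma) / t) - RtoC (/ t) * / ((X, Y) : C))%C.
    - unfold mobius. rewrite Ej, Hb.
      assert (Ew : w' = (((X, Y) - RtoC (IZR (md sigma))) / RtoC t)%C).
      { rewrite <- Ej. unfold jfac. fold t. field. auto. }
      rewrite Ew. rewrite !RtoC_div, RtoC_inv, RtoC_minus, RtoC_mult by lra.
      field. split; auto.
    - rewrite Eq. unfold D, Cminus, Cplus, Copp, Cmult, Cinv, RtoC. simpl.
      f_equal; field; split; simpl in HXY; lra. }
  rewrite Cmod_ser_Phi by (apply Rdiv_lt_0_compat; auto).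
  rewrite <- Ez, (Phi_invariant G r f g z0) by auto. ring.
Qed.

(** Along the sequence the height is of order [X^(-2)], so the lower bound [y^(-r/2)] and the assumed upper bound
    compare as powers of [X]. *)
Lemma form_growth (q : QArith_base.Q) : (exists z, upper z /\ f z <> RtoC 0) ->
  exists t Y, 0 < t /\ 0 < Y /\ forall e sg K X2, 0 < e -> sg < 2 * e ->
   ~ (forall X, X2 <= X -> 1 <= X ->
      Cmod (ser (coefs a) (Q2R q + - (X / (t * (X ^ 2 + Y ^ 2)))) (Y / (t * (X ^ 2 + Y ^ 2)))) <=
      K * (Rpower X sg * Rpower (Y / (t * (X ^ 2 + Y ^ 2))) (e - r / 2))).
Proof.
  intros Hf0. destruct (form_large q Hf0) as [t [Y [c0 [Ht [HY [Hc0 HL]]]]]].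
  exists t, Y. split; auto. split; auto. intros e sg K X2 He Hsg HB.
  set (W := Rpower (t / Y) e). assert (HW : 0 < W) by apply Rpower_pos.
  assert (HcW : 0 < c0 * W) by (apply Rmult_lt_0_compat; auto).
  destruct (Rpower_unbounded (2 * e - sg) (K * / (c0 * W))) as [X1 [HX1 HXu]]; [lra|].
  destruct (HL (Rmax (Rmax X1 1) X2)) as [X [HX [HXp HE]]].
  pose proof (Rmax_l (Rmax X1 1) X2). pose proof (Rmax_r (Rmax X1 1) X2).
  pose proof (Rmax_l X1 1). pose proof (Rmax_r X1 1).
  specialize (HB X ltac:(lra) ltac:(lra)). specialize (HXu X ltac:(lra)). rewrite HE in HB. clear HE.
  set (D := t * (X ^ 2 + Y ^ 2)) in *.
  assert (HX2 : 0 < X ^ 2) by (apply pow_lt; auto).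
  assert (HD2 : t * X ^ 2 <= D) by (unfold D; nra).
  assert (HD : 0 < D) by nra.
  assert (Hy : 0 < Y / D) by (apply Rdiv_lt_0_compat; auto).
  assert (HB2 : c0 * Rpower (Y / D) (- e) <= K * Rpower X sg).
  { pose proof (Rpower_pos (Y / D) (r / 2 - e)) as P.
    apply Rmult_le_compat_r with (r := Rpower (Y / D) (r / 2 - e)) in HB; [|lra].
    rewrite !Rmult_assoc, <- !Rpower_plus in HB.
    replace (- (r / 2) + (r / 2 - e)) with (- e) in HB by ring.
    replace (e - r / 2 + (r / 2 - e)) with 0 in HB by ring.
    rewrite (Rpower_O (Y / D)), Rmult_1_r in HB by auto. exact HB. }
  assert (HL1 : W * Rpower X (2 * e) <= Rpower (Y / D) (- e)).
  { unfold W. replace (Rpower X (2 * e)) with (Rpower (X ^ 2) e).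
    - rewrite Rpower_mult_distr by (auto; apply Rdiv_lt_0_compat; auto).
      replace (Rpower (Y / D) (- e)) with (Rpower (D / Y) e).
      + apply Rle_Rpower_l; [lra|]. split.
        * apply Rmult_lt_0_compat; [apply Rdiv_lt_0_compat; auto|auto].
        * unfold Rdiv. rewrite Rmult_assoc, (Rmult_comm (/ Y)), <- Rmult_assoc.
          apply Rmult_le_compat_r; [apply Rlt_le, Rinv_0_lt_compat; auto|auto].
      + unfold Rpower. replace (Y / D) with (/ (D / Y)) by (field; lra).
        rewrite ln_Rinv by (apply Rdiv_lt_0_compat; auto). f_equal; ring.
    - rewrite <- (Rpower_pow 2 X) by auto. rewrite Rpower_mult. f_equal. }
  apply (Rmult_lt_compat_l (c0 * W)) in HXu; auto.
  replace (c0 * W * (K * / (c0 * W))) with K in HXu by (field; lra).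
  pose proof (Rpower_pos X sg) as P.
  apply (Rmult_lt_compat_r (Rpower X sg)) in HXu; auto.
  replace (c0 * W * Rpower X (2 * e - sg) * Rpower X sg) with (c0 * (W * Rpower X (2 * e))) in HXu.
  - assert (c0 * (W * Rpower X (2 * e)) <= c0 * Rpower (Y / D) (- e)) by (apply Rmult_le_compat_l; lra).
    lra.
  - replace (2 * e) with (2 * e - sg + sg) at 1 by ring. rewrite Rpower_plus. ring.
Qed.

Lemma form_power_sums : power_sums (coefs a) (r / 2).
Proof.
  split; [lra|]. intros rho Hrho. destruct (form_bound (r / 2) (Rle_refl _)) as [K HK].
  apply (partial_sum_bound (coefs a) (r / 2) rho K); auto; [|lra]. now apply form_subexp with f.
Qed.

End Form.

(** * Hölder exponents *)

Lemma ccont_Ccontinuous_at g x : ccont g x <-> Ccontinuous_at g x.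
Proof.
  split.
  - intros [H1 H2]. unfold Ccontinuous_at.
    intros P [eps HP]. 
    assert (B1 := proj1 (filterlim_locally _ _) H1 eps).
    assert (B2 := proj1 (filterlim_locally _ _) H2 eps).
    unfold filtermap. generalize (filter_and _ _ B1 B2). apply filter_imp.
    intros y [K1 K2]. apply HP. split; [exact K1|exact K2].
  - intros H. split.
    + apply (continuous_comp g (fun z : C => Re z)); [exact H|]. 
      intros P [eps HP]. exists eps. intros y [K1 _]. apply HP. exact K1.
    + apply (continuous_comp g (fun z : C => Im z)); [exact H|].
      intros P [eps HP]. exists eps. intros y [_ K1]. apply HP. exact K1.
Qed.

Lemma cder_is_derive_RC g x l : cder g x l <-> is_derive_RC g x l.
Proof.
  set (V := prod_NormedModule R_AbsRing R_NormedModule R_NormedModule).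
  split.
  - intros [H1 H2]. unfold is_derive_RC.
    pose proof (is_derive_plus (V := V) _ _ x _ _
      (is_derive_scal_l (V := V) (fun s => Re (g s)) x (Re l) ((1, 0) : V) H1)
      (is_derive_scal_l (V := V) (fun s => Im (g s)) x (Im l) ((0, 1) : V) H2)) as H.
    assert (E : forall z : C, plus (scal (Re z) ((1, 0) : V)) (scal (Im z) ((0, 1) : V)) = z).
    { intros [z1 z2]. unfold plus, scal; simpl. unfold prod_plus, prod_scal, plus, scal; simpl.
      unfold mult; simpl. unfold Re, Im; simpl. f_equal; ring. }
    rewrite E in H.
    apply (is_derive_ext (V := V)) with (2 := H). intros t. exact (E (g t)).
  - intros H. unfold is_derive_RC in H. split.
    + apply (filterdiff_ext_lin _ (fun y => fst (scal (V := V) y l))).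
      * apply (filterdiff_comp' (V := V) g (fun z : V => fst z) x _ (fun z : V => fst z) H).
        apply filterdiff_linear, is_linear_fst.
      * intros y. reflexivity.
    + apply (filterdiff_ext_lin _ (fun y => snd (scal (V := V) y l))).
      * apply (filterdiff_comp' (V := V) g (fun z : V => snd z) x _ (fun z : V => snd z) H).
        apply filterdiff_linear, is_linear_snd.
      * intros y. reflexivity.
Qed.

Lemma Cpoly_Csum d p t : Cpoly d p t = Csum (fun j => p j * RtoC (t ^ j))%C (S d).
Proof. unfold Cpoly. apply sum_n_Csum. Qed.

(** What the identity, the real part and the imaginary part have in common; regularity passes
    from [f_alpha] to its image under such a map. *)
Record contraction (T : C -> C) : Prop := Contraction
  { ctr_plus : forall z w, T (z + w)%C = (T z + T w)%C;
    ctr_scal : forall z (t : R), T (z * RtoC t)%C = (T z * RtoC t)%C;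
    ctr_le : forall z, Cmod (T z) <= Cmod z;
    ctr_cder : forall h t l, cder h t l -> cder (fun s => T (h s)) t (T l);
    ctr_ccont : forall h t, ccont h t -> ccont (fun s => T (h s)) t }.

Lemma contraction_id : contraction (fun z => z).
Proof. split; auto. intros; apply Rle_refl. Qed.

Lemma contraction_Re : contraction (fun z => RtoC (Re z)).
Proof.
  split.
  - intros z w. rewrite <- RtoC_plus. reflexivity.
  - intros z t. rewrite <- RtoC_mult. f_equal. unfold Re; simpl; ring.
  - intros z. rewrite Cmod_R. apply Re_le_Cmod.
  - intros h t l [H _]. now apply cder_real.
  - intros h t [H _]. now apply ccont_real.
Qed.

Lemma contraction_Im : contraction (fun z => RtoC (Im z)).
Proof.
  split.
  - intros z w. rewrite <- RtoC_plus. reflexivity.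
  - intros z t. rewrite <- RtoC_mult. f_equal. unfold Im; simpl; ring.
  - intros z. rewrite Cmod_R. apply Im_le_Cmod.
  - intros h t l [_ H]. now apply (cder_real (fun s => Im (h s))).
  - intros h t [_ H]. now apply (ccont_real (fun s => Im (h s))).
Qed.

Lemma ctr_minus T z w : contraction T -> T (z - w)%C = (T z - T w)%C.
Proof.
  intros H. replace (T z) with (T ((z - w) + w)%C) by (f_equal; ring).
  rewrite (ctr_plus T H). ring.
Qed.

Lemma ctr_Csum T p t n : contraction T ->
  T (Csum (fun j => p j * RtoC (t ^ j))%C n) = Csum (fun j => T (p j) * RtoC (t ^ j))%C n.
Proof.
  intros H. induction n as [|n IH]; simpl.
  - replace (RtoC 0) with (RtoC 0 * RtoC 0)%C at 1 by ring. rewrite (ctr_scal T H). ring.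
  - rewrite (ctr_plus T H), IH, (ctr_scal T H). reflexivity.
Qed.

Lemma open_interval_neighborhood (u v : Rbar) (x0 : R) : Defs.open_interval u v x0 ->
  exists del, 0 < del /\ forall x, Rabs (x - x0) <= del -> Defs.open_interval u v x.
Proof.
  intros [Hu Hv].
  assert (A : exists d1, 0 < d1 /\ forall x : R, x0 - d1 <= x -> Rbar_lt u x).
  { destruct u as [u| |]; [simpl in Hu|exact (False_ind _ Hu)|exists 1; split; [lra|intros; exact I]].
    exists ((x0 - u) / 2). split; [lra|]. intros x Hx. simpl. lra. }
  assert (B : exists d2, 0 < d2 /\ forall x : R, x <= x0 + d2 -> Rbar_lt x v).
  { destruct v as [v| |]; [simpl in Hv|exists 1; split; [lra|intros; exact I]|exact (False_ind _ Hv)].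
    exists ((v - x0) / 2). split; [lra|]. intros x Hx. simpl. lra. }
  destruct A as [d1 [Hd1 A]]. destruct B as [d2 [Hd2 B]].
  exists (Rmin d1 d2). split; [apply Rmin_glb_lt; auto|]. intros x Hx.
  pose proof (Rmin_l d1 d2). pose proof (Rmin_r d1 d2). apply Rabs_le_between in Hx.
  split; [apply A; lra|apply B; lra].
Qed.

Lemma ccont_locally_bounded h x0 : ccont h x0 -> exists del B, 0 < del /\ 0 <= B /\
  forall x, Rabs (x - x0) <= del -> Cmod (h x) <= B.
Proof.
  intros [H1 H2].
  destruct (proj1 (filterlim_locally _ _) H1 (mkposreal 1 Rlt_0_1)) as [d1 D1].
  destruct (proj1 (filterlim_locally _ _) H2 (mkposreal 1 Rlt_0_1)) as [d2 D2].
  pose proof (cond_pos d1). pose proof (cond_pos d2).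
  exists (Rmin d1 d2 / 2), (Rabs (Re (h x0)) + 1 + (Rabs (Im (h x0)) + 1)).
  assert (Hm : 0 < Rmin d1 d2) by (apply Rmin_glb_lt; auto).
  pose proof (Rabs_pos (Re (h x0))). pose proof (Rabs_pos (Im (h x0))).
  split; [lra|]. split; [lra|]. intros x Hx.
  pose proof (Rmin_l d1 d2). pose proof (Rmin_r d1 d2).
  assert (B1 : Rabs (Re (h x) - Re (h x0)) < 1).
  { apply (D1 x). unfold ball; simpl. unfold AbsRing_ball, abs, minus, plus, opp; simpl.
    unfold Rminus in Hx. lra. }
  assert (B2 : Rabs (Im (h x) - Im (h x0)) < 1).
  { apply (D2 x). unfold ball; simpl. unfold AbsRing_ball, abs, minus, plus, opp; simpl.
    unfold Rminus in Hx. lra. }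
  eapply Rle_trans; [apply Cmod_le_abs|].
  pose proof (Rabs_triang_inv (Re (h x)) (Re (h x0))).
  pose proof (Rabs_triang_inv (Im (h x)) (Im (h x0))). lra.
Qed.

(** Uniform Taylor expansions near [x0]; for [s = 0] the bound on the top derivative
    replaces its continuity modulus. *)
Lemma holder_on_taylor g U x0 k s : (exists del, 0 < del /\ forall x, Rabs (x - x0) <= del -> U x) ->
  0 <= s <= 1 -> 0 < INR k + s -> holder_on g U k s ->
  exists (d : nat) del M, 0 < del <= 1 /\ 0 <= M /\ forall x, Rabs (x - x0) <= del ->
    exists p, (forall j, (j < d)%nat -> Cmod (p j) <= M) /\
      (forall t, Rabs t <= del -> t <> 0 ->
        Cmod (g (x + t)%R - Csum (fun j => p j * RtoC (t ^ j))%C d)%C <= M * Rpower (Rabs t) (INR k + s)) /\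
      g x = Csum (fun j => p j * RtoC (0 ^ j))%C d.
Proof.
  intros [d0 [Hd0 HU]] Hs Hks [D [HD0 [HD Hlast]]].
  assert (HDc : forall j x, (j < k)%nat -> U x -> cder (D j) x (D (S j) x)).
  { intros j x Hj Hx. apply cder_is_derive_RC. auto. }
  assert (Hx0 : U x0) by (apply HU; rewrite Rminus_diag, Rabs_R0; lra).
  assert (Hbk : forall j, (j <= k)%nat -> exists del B, 0 < del /\ 0 <= B /\
    forall x, Rabs (x - x0) <= del -> Cmod (D j x) <= B).
  { intros j Hj. destruct (Nat.eq_dec j k) as [->|Hjk].
    - destruct Hlast as [[_ Hc]|[Hs0 [M HM]]].
      + apply ccont_locally_bounded. apply ccont_Ccontinuous_at. auto.
      + exists (Rmin d0 1), (Cmod (D k x0) + Rabs M).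
        pose proof (Cmod_ge_0 (D k x0)). pose proof (Rabs_pos M).
        split; [apply Rmin_glb_lt; lra|]. split; [lra|]. intros x Hx.
        pose proof (Rmin_l d0 1). pose proof (Rmin_r d0 1).
        destruct (Req_dec x x0) as [->|Hne]; [lra|].
        pose proof (HM x x0 (HU x ltac:(lra)) Hx0 Hne) as Q.
        pose proof (Cmod_ge_minus (D k x) (D k x0)).
        assert (Rpower (Rabs (x - x0)) s <= 1).
        { rewrite <- (Rpower_1_base s). apply Rle_Rpower_l; [lra|]. split; [apply Rabs_pos_lt; lra|lra]. }
        pose proof (Rpower_pos (Rabs (x - x0)) s). pose proof (Rle_abs M). nra.
    - apply ccont_locally_bounded. eapply cder_ccont. apply HDc; [lia|auto]. }
  assert (Hb : forall n, (n <= S k)%nat -> exists del B, 0 < del /\ 0 <= B /\ forall j, (j < n)%nat ->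
    forall x, Rabs (x - x0) <= del -> Cmod (D j x) <= B).
  { induction n as [|n IH]; intros Hn.
    - exists 1, 0. split; [lra|]. split; [lra|]. intros; lia.
    - destruct IH as [d1 [B1 [Hd1 [HB1 H1]]]]; [lia|].
      destruct (Hbk n) as [d2 [B2 [Hd2 [HB2 H2]]]]; [lia|].
      exists (Rmin d1 d2), (B1 + B2). split; [apply Rmin_glb_lt; auto|]. split; [lra|].
      intros j Hj x Hx. pose proof (Rmin_l d1 d2). pose proof (Rmin_r d1 d2).
      destruct (Nat.eq_dec j n) as [->|Hjn].
      + specialize (H2 x ltac:(lra)). lra.
      + specialize (H1 j ltac:(lia) x ltac:(lra)). lra. }
  destruct (Hb (S k) (Nat.le_refl _)) as [d1 [B [Hd1 [HB HBj]]]].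
  assert (Hmod : exists (k' : nat) (s' M : R), (k' <= k)%nat /\ 0 < s' /\ 0 <= M /\ INR k' + s' = INR k + s /\
     forall x y, Rabs (x - x0) <= Rmin d0 d1 -> Rabs (y - x0) <= Rmin d0 d1 -> x <> y ->
       Cmod (D k' x - D k' y)%C <= M * Rpower (Rabs (x - y)) s').
  { pose proof (Rmin_l d0 d1) as Hm1. pose proof (Rmin_r d0 d1) as Hm2.
    destruct Hlast as [[E _]|[Hs0 [M HM]]].
    - destruct k as [|k']; [simpl in Hks; lra|]. exists k', 1, B.
      split; [lia|]. split; [lra|]. split; [auto|]. split; [rewrite S_INR, E; ring|].
      intros x y Hx Hy Hxy. rewrite Rpower_1 by (apply Rabs_pos_lt; lra).
      apply (cder_mean_value (D k') (D (S k')) y x B).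
      + intros t Ht. apply HDc; [lia|]. apply HU. apply Rabs_le.
        apply Rabs_le_between in Hx. apply Rabs_le_between in Hy.
        revert Ht. unfold Rmin at 1, Rmax. destruct (Rle_dec y x); lra.
      + intros t Ht. apply HBj; [lia|]. apply Rabs_le.
        apply Rabs_le_between in Hx. apply Rabs_le_between in Hy.
        revert Ht. unfold Rmin at 1, Rmax. destruct (Rle_dec y x); lra.
    - exists k, s, (Rabs M). split; [lia|]. split; [lra|]. split; [apply Rabs_pos|]. split; [reflexivity|].
      intros x y Hx Hy Hxy. eapply Rle_trans; [apply HM; auto; apply HU; lra|].
      apply Rmult_le_compat_r; [apply Rlt_le, Rpower_pos|apply Rle_abs]. }
  destruct Hmod as [k' [s' [M [Hk' [Hs' [HM0 [Eks HM]]]]]]].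
  set (m := Rmin d0 d1) in *. assert (Hm : 0 < m) by (apply Rmin_glb_lt; auto).
  exists (S k'), (Rmin (m / 2) 1), (M + B).
  assert (Hdel : 0 < Rmin (m / 2) 1 <= 1) by (split; [apply Rmin_glb_lt; lra|apply Rmin_r]).
  pose proof (Rmin_l (m / 2) 1) as Hdm.
  split; auto. split; [lra|]. intros x Hx.
  exists (fun j => (D j x * RtoC (/ INR (fact j)))%C).
  assert (Hin : forall t, Rabs t <= m / 2 -> Rabs (x + t - x0) <= m).
  { intros t Ht. replace (x + t - x0) with ((x - x0) + t) by ring.
    eapply Rle_trans; [apply Rabs_triang|]. lra. }
  assert (Hm1 : m <= d0) by apply Rmin_l. assert (Hm2 : m <= d1) by apply Rmin_r.
  split; [|split].
  - intros j Hj. rewrite Cmod_mult, Cmod_R.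
    assert (Hf : 0 < / INR (fact j) <= 1).
    { split; [apply Rinv_0_lt_compat, INR_fact_lt_0|]. rewrite <- Rinv_1. apply Rinv_le_contravar; [lra|].
      change 1 with (INR 1). apply le_INR, lt_O_fact. }
    rewrite Rabs_pos_eq by lra. specialize (HBj j ltac:(lia) x ltac:(lra)).
    pose proof (Cmod_ge_0 (D j x)). nra.
  - intros t Ht Ht0. assert (Hat : 0 < Rabs t) by (now apply Rabs_pos_lt).
    assert (Hloc : forall y, Rabs (y - x) <= Rabs t -> Rabs (y - x0) <= m).
    { intros y Hy. replace y with (x + (y - x)) by ring. apply Hin. lra. }
    assert (HxU : U x) by (apply HU; lra).
    pose proof (taylor_bound k' D x (Rabs t) (M * Rpower (Rabs t) s') (Rabs_pos t)) as T.
    assert (T1 : forall (j : nat) y, (j < k')%nat -> Rabs (y - x) <= Rabs t -> cder (D j) y (D (S j) y)).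
    { intros j y Hj Hy. apply HDc; [lia|]. apply HU. specialize (Hloc y Hy). lra. }
    assert (T2 : forall y, Rabs (y - x) <= Rabs t -> Cmod (D k' y - D k' x)%C <= M * Rpower (Rabs t) s').
    { intros y Hy. destruct (Req_dec y x) as [->|Hne].
      - replace (D k' x - D k' x)%C with (RtoC 0) by ring. rewrite Cmod_0.
        apply Rmult_le_pos; [auto|apply Rlt_le, Rpower_pos].
      - eapply Rle_trans; [apply HM; auto; lra|]. apply Rmult_le_compat_l; auto.
        apply Rle_Rpower_l; [lra|]. split; [apply Rabs_pos_lt; lra|auto]. }
    specialize (T T1 T2 (x + t)). replace (x + t - x) with t in T by ring. specialize (T (Rle_refl _)).
    rewrite (HD0 (x + t)) in T by (apply HU; specialize (Hin t ltac:(lra)); lra).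
    rewrite (Csum_ext _ (fun j => D j x * RtoC (/ INR (fact j) * t ^ j))%C).
    + eapply Rle_trans; [apply T|].
      rewrite <- Eks, (Rplus_comm (INR k')), Rpower_plus, Rpower_pow by auto.
      rewrite <- Rmult_assoc. apply Rmult_le_compat_r; [apply pow_le; lra|].
      apply Rmult_le_compat_r; [apply Rlt_le, Rpower_pos|lra].
    + intros j _. rewrite RtoC_mult. ring.
  - rewrite Csum_head. rewrite Csum_zero.
    + simpl. rewrite Rinv_1, <- (HD0 x) by (apply HU; lra). ring.
    + intros j _. simpl. rewrite Rmult_0_l. ring.
Qed.

Lemma holder_at_taylor g x0 s : 0 < s -> holder_at g x0 s ->
  exists (d : nat) del M p, 0 < del <= 1 /\ 0 <= M /\
    (forall j, (j < d)%nat -> Cmod (p j) <= M) /\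
    (forall t, Rabs t <= del -> t <> 0 ->
        Cmod (g (x0 + t)%R - Csum (fun j => p j * RtoC (t ^ j))%C d)%C <= M * Rpower (Rabs t) s) /\
    g x0 = Csum (fun j => p j * RtoC (0 ^ j))%C d.
Proof.
  intros Hs [Hc [d [p [_ [M [eps HM]]]]]].
  destruct (finite_bound (S d) (fun j K => Cmod (p j) <= K)) as [B HB].
  { intros; lra. }
  { intros j _. exists (Cmod (p j)). lra. }
  assert (HB0 : 0 <= B) by (eapply Rle_trans; [apply (Cmod_ge_0 (p 0%nat))|apply HB; lia]).
  set (del := Rmin (eps / 2) 1).
  assert (Hdel : 0 < del <= 1).
  { split; [apply Rmin_glb_lt; [pose proof (cond_pos eps); lra|lra]|apply Rmin_r]. }
  assert (Hdel2 : del <= eps / 2) by apply Rmin_l. pose proof (cond_pos eps) as Hep.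
  assert (HP : forall t, Rabs t <= del -> t <> 0 ->
     Cmod (g (x0 + t)%R - Csum (fun j => p j * RtoC (t ^ j))%C (S d))%C <= Rabs M * Rpower (Rabs t) s).
  { intros t Ht Ht0. specialize (HM (x0 + t)). rewrite Cpoly_Csum in HM.
    replace (x0 + t - x0) with t in HM by ring. eapply Rle_trans; [apply HM|].
    - unfold ball; simpl. unfold AbsRing_ball, abs, minus, plus, opp; simpl.
      replace (x0 + t + - x0) with t by ring. lra.
    - lra.
    - apply Rmult_le_compat_r; [apply Rlt_le, Rpower_pos|apply Rle_abs]. }
  exists (S d), del, (B + Rabs M), p. pose proof (Rabs_pos M) as HM0.
  split; auto. split; [lra|]. split; [intros j Hj; specialize (HB j Hj); lra|]. split.
  - intros t Ht Ht0. eapply Rle_trans; [apply HP; auto|].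
    apply Rmult_le_compat_r; [apply Rlt_le, Rpower_pos|lra].
  - (* the bound holds for t <> 0 only; continuity extends it to t = 0, along t = 1 / n *)
    set (h := fun t => (g (x0 + t)%R - Csum (fun j => p j * RtoC (t ^ j))%C (S d))%C).
    assert (Hh : ccont h 0).
    { apply ccont_minus.
      - apply (ccont_comp (fun t => x0 + t) g).
        + apply (ex_derive_continuous (fun t => x0 + t)). auto_derive; auto.
        + apply ccont_Ccontinuous_at, Hc.
      - apply (ccont_Csum (fun j t => p j * RtoC (t ^ j))%C). intros j _.
        apply ccont_mult; [apply ccont_const|]. apply ccont_real.
        apply (ex_derive_continuous (fun t => t ^ j)). auto_derive; auto. }
    assert (H0 : Cmod (h 0) <= 0).
    { apply le_of_le_lim0 with (e := fun n => Rabs M * Rpower (nu n) (- s) + Cmod (h (/ nu n)%R - h 0%R)%C).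
      - replace (Finite 0) with (Finite (0 + 0)) by (f_equal; ring).
        apply is_lim_seq_plus'; [now apply lim_nu_pow|].
        assert (L : forall q : R -> R, continuous q 0 -> is_lim_seq (fun n => Rabs (q (/ nu n) - q 0)) 0).
        { intros q Hq. rewrite <- Rabs_R0 at 1. apply (is_lim_seq_abs _ (Finite 0)).
          replace (Finite 0) with (Finite (q 0 - q 0)) by (f_equal; ring).
          apply is_lim_seq_minus'; [|apply is_lim_seq_const].
          apply (is_lim_seq_continuous q (fun n => / nu n) 0); [|apply lim_inv_INR].
          now apply continuity_pt_filterlim. }
        apply is_lim_seq_le_le with (u := fun _ => 0)
          (w := fun n => Rabs (Re (h (/ nu n)) - Re (h 0)) + Rabs (Im (h (/ nu n)) - Im (h 0))).
        + intros n. split; [apply Cmod_ge_0|]. apply (Cmod_le_abs (h (/ nu n)%R - h 0%R)%C).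
        + apply is_lim_seq_const.
        + replace (Finite 0) with (Finite (0 + 0)) by (f_equal; ring).
          apply is_lim_seq_plus'; [apply (L (fun t => Re (h t)))|apply (L (fun t => Im (h t)))]; apply Hh.
      - destruct (lim0_ev (fun n => / nu n) del lim_inv_INR (proj1 Hdel)) as [N HN].
        exists N. intros n Hn. specialize (HN n Hn). simpl in HN. destruct (inv_nu_le n) as [Hn1 Hn2].
        rewrite Rplus_0_l. pose proof (Cmod_ge_minus (h 0) (h (/ nu n))) as Q.
        rewrite Cmod_minus_sym in Q.
        specialize (HP (/ nu n) ltac:(lra) ltac:(lra)). fold (h (/ nu n)) in HP.
        rewrite (Rabs_pos_eq (/ nu n)) in HP by lra.
        replace (Rpower (nu n) (- s)) with (Rpower (/ nu n) s); [lra|].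
        unfold Rpower. rewrite ln_Rinv by lra. f_equal; ring. }
    assert (E : h 0 = RtoC 0) by (apply Cmod_eq_0, Rle_antisym; [auto|apply Cmod_ge_0]).
    unfold h in E. rewrite Rplus_0_r in E.
    replace (g x0) with ((g x0 - Csum (fun j => p j * RtoC (0 ^ j)) (S d)) +
       Csum (fun j => p j * RtoC (0 ^ j)) (S d))%C by ring. rewrite E. ring.
Qed.

(** * The three series and their exponents *)

Lemma ee_real t : ee (RtoC t) = cis t.
Proof.
  unfold ee, Cexp, cis, Cmult, RtoC, Ci, Re, Im; simpl.
  replace ((2 * PI * 0 - 0 * 1) * t - (2 * PI * 1 + 0 * 0) * 0) with 0 by ring.
  replace ((2 * PI * 0 - 0 * 1) * 0 + (2 * PI * 1 + 0 * 0) * t) with (2 * PI * t) by ring.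
  rewrite exp_0. f_equal; ring.
Qed.

Lemma CSeries_ext u v : (forall n, u n = v n) -> CSeries u = CSeries v.
Proof. intros E. unfold CSeries. f_equal; apply Series_ext; intros n; now rewrite E. Qed.

Lemma f_alpha_term a alpha x n :
  (a (S n) / RtoC (Rpower (INR (S n)) alpha) * ee (RtoC (INR (S n) * x)))%C = fal_term (coefs a) alpha x n.
Proof.
  unfold fal_term, coefs. fold (nu n). rewrite ee_real, Rpower_Ropp.
  rewrite RtoC_inv by (apply Rgt_not_eq, Rpower_pos). unfold Cdiv. ring.
Qed.

Lemma f_alpha_fal a alpha : f_alpha a alpha = fal (coefs a) alpha.
Proof.
  apply functional_extensionality. intros x. apply CSeries_ext. intros n. apply f_alpha_term.
Qed.

Lemma CSeries_RtoC (u : nat -> R) : CSeries (fun n => RtoC (u n)) = RtoC (Series u).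
Proof.
  unfold CSeries, RtoC. f_equal. simpl. apply is_series_unique. unfold is_series.
  apply filterlim_ext with (fun _ => 0); [|apply filterlim_const].
  intros n. induction n as [|n IH]; [now rewrite sum_O|].
  rewrite sum_Sn, <- IH. symmetry. apply Rplus_0_l.
Qed.

Lemma real_coef a n : (forall n : nat, (1 <= n)%nat -> Im (a n) = 0) -> a (S n) = RtoC (Re (a (S n))).
Proof.
  intros Ha. specialize (Ha (S n) ltac:(lia)). destruct (a (S n)) as [a1 a2].
  unfold Re, Im, RtoC in *. simpl in *. now rewrite Ha.
Qed.

Lemma real_term a alpha x n : (forall n : nat, (1 <= n)%nat -> Im (a n) = 0) ->
  fal_term (coefs a) alpha x n =
   (RtoC (Re (a (S n)) * Rpower (nu n) (- alpha)) * cis (nu n * x))%C.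
Proof.
  intros Ha. unfold fal_term, coefs.
  rewrite (real_coef a n Ha) at 1. rewrite RtoC_mult. ring.
Qed.

Lemma f_alpha_c_fal a alpha : (forall n : nat, (1 <= n)%nat -> Im (a n) = 0) ->
  f_alpha_c a alpha = (fun x => RtoC (Re (fal (coefs a) alpha x))).
Proof.
  intros Ha. apply functional_extensionality. intros x.
  transitivity (CSeries (fun n => RtoC (Re (fal_term (coefs a) alpha x n)))).
  - apply CSeries_ext. intros n. rewrite real_term by auto.
    rewrite (real_coef a n Ha) at 1. fold (nu n). unfold Cdiv.
    rewrite <- RtoC_inv by (apply Rgt_not_eq, Rpower_pos). rewrite <- Rpower_Ropp, <- !RtoC_mult.
    f_equal. unfold cis, Re; simpl. replace (2 * PI * nu n * x) with (2 * PI * (nu n * x)) by ring. ring.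
  - rewrite CSeries_RtoC. reflexivity.
Qed.

Lemma f_alpha_s_fal a alpha : (forall n : nat, (1 <= n)%nat -> Im (a n) = 0) ->
  f_alpha_s a alpha = (fun x => RtoC (Im (fal (coefs a) alpha x))).
Proof.
  intros Ha. apply functional_extensionality. intros x.
  transitivity (CSeries (fun n => RtoC (Im (fal_term (coefs a) alpha x n)))).
  - apply CSeries_ext. intros n. rewrite real_term by auto.
    rewrite (real_coef a n Ha) at 1. fold (nu n). unfold Cdiv.
    rewrite <- RtoC_inv by (apply Rgt_not_eq, Rpower_pos). rewrite <- Rpower_Ropp, <- !RtoC_mult.
    f_equal. unfold cis, Re, Im; simpl.
    replace (2 * PI * nu n * x) with (2 * PI * (nu n * x)) by ring. ring.
  - rewrite CSeries_RtoC. reflexivity.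
Qed.

Lemma has_coef_lin h k c d (A B : C) : (forall t, ccont h t) -> (forall t, ccont k t) ->
  has_coef h c -> has_coef k d -> has_coef (fun t => A * h t + B * k t)%C (fun n => A * c n + B * d n)%C.
Proof.
  intros Hh Hk Hc Hd n b. rewrite <- (Hc n b), <- (Hd n b).
  assert (Hb : b <= b + 1) by lra.
  assert (H1 : ccont_on (fun t => h t * cis (- nu n * t))%C b (b + 1))
    by (intros t _; apply ccont_mult; [auto|apply ccont_cis_scal]).
  assert (H2 : ccont_on (fun t => k t * cis (- nu n * t))%C b (b + 1))
    by (intros t _; apply ccont_mult; [auto|apply ccont_cis_scal]).
  rewrite <- (CInt_scal A), <- (CInt_scal B), <- CInt_plus; auto.
  - apply CInt_ext; auto. intros; ring.
  - intros t Ht. apply ccont_mult; [apply ccont_const|auto].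
  - intros t Ht. apply ccont_mult; [apply ccont_const|auto].
Qed.

Section Main.
Variables (G : SL2Z -> Prop) (r alpha : R) (f : C -> C) (a : nat -> C).
Hypotheses (hG : congruence_group G) (hr : 0 < r) (hf : cusp_form G r f)
  (hf0 : exists z, upper z /\ f z <> RtoC 0).
Hypothesis ha : forall z, upper z ->
     is_Cseries (fun n => a (S n) * ee (RtoC (INR (S n)) * z))%C (f z).
Hypothesis halpha : r / 2 < alpha.

Let c := coefs a.
Let F := fal c alpha.

Lemma main_subexp : subexp c.
Proof. exact (form_subexp a f ha). Qed.

Lemma main_power_sums : power_sums c (r / 2).
Proof. exact (form_power_sums G r f a hG hr hf ha). Qed.

Lemma F_ccont x : ccont F x.
Proof. exact (fal_ccont c (r / 2) alpha x main_power_sums halpha). Qed.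

Lemma F_bounded : exists M, forall x, Cmod (F x) <= M.
Proof.
  destruct (fal_rate c (r / 2) alpha main_power_sums halpha) as [e [_ [_ H]]].
  exists (e 0%nat). intros x. specialize (H x 0%nat). simpl in H.
  replace (fal c alpha x - RtoC 0)%C with (F x) in H by (unfold F; ring). exact H.
Qed.

(** The maps under which the positive frequencies of [F] survive up to a common factor. *)
Definition coef_map (T : C -> C) : Prop :=
  contraction T /\ exists kap, kap <> RtoC 0 /\
    has_coef (fun x => T (F x)) (fun n => kap * fal_coef c alpha n)%C.

Lemma F_coef : has_coef F (fal_coef c alpha).
Proof. exact (fal_has_coef c (r / 2) alpha main_power_sums halpha). Qed.

Lemma F_conj_coef : has_coef (fun x => Cconj (F x)) (fun _ => RtoC 0).
Proof. exact (fal_conj_coef c (r / 2) alpha main_power_sums halpha). Qed.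

Lemma coef_map_id : coef_map (fun z => z).
Proof.
  split; [apply contraction_id|]. exists (RtoC 1). split.
  - intros E. apply RtoC_inj in E. lra.
  - intros n b. rewrite (F_coef n b). ring.
Qed.

Lemma coef_map_lin (T : C -> C) (A B : C) : contraction T -> A <> RtoC 0 ->
  (forall z, T z = A * z + B * Cconj z)%C -> coef_map T.
Proof.
  intros HT HA E. split; auto. exists A. split; auto. intros n b.
  replace (A * fal_coef c alpha n)%C with (A * fal_coef c alpha n + B * RtoC 0)%C by ring.
  rewrite <- (has_coef_lin F (fun x => Cconj (F x)) _ _ A B F_ccont
    (fun t => ccont_conj F t (F_ccont t)) F_coef F_conj_coef n b).
  apply CInt_ext; [lra|]. intros t _. now rewrite E.
Qed.

Lemma coef_map_Re : coef_map (fun z => RtoC (Re z)).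
Proof.
  apply (coef_map_lin _ (RtoC (/ 2)) (RtoC (/ 2)) contraction_Re).
  - intros E. apply RtoC_inj in E. lra.
  - intros [z1 z2]. unfold RtoC, Re, Cconj, Cmult, Cplus; simpl. f_equal; field.
Qed.

Lemma coef_map_Im : coef_map (fun z => RtoC (Im z)).
Proof.
  apply (coef_map_lin _ (0, - / 2) (0, / 2) contraction_Im).
  - intros E. apply (f_equal snd) in E. simpl in E. lra.
  - intros [z1 z2]. unfold RtoC, Im, Cconj, Cmult, Cplus; simpl. f_equal; field.
Qed.

Lemma holder_on_lower T U k s : contraction T -> 0 < s <= 1 -> INR k + s < alpha - r / 2 ->
  holder_on (fun x => T (F x)) U k s.
Proof.
  intros HT Hs Hks. exists (fun j x => T (fal_deriv c alpha j x)). split; [|split].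
  - intros x _. unfold fal_deriv. simpl. rewrite Rminus_0_r. f_equal. unfold F. ring.
  - intros j x Hj _. apply cder_is_derive_RC. apply (ctr_cder T HT).
    apply (fal_deriv_cder c (r / 2)); [apply main_power_sums|].
    assert (INR (S j) <= INR k) by (apply le_INR; lia). lra.
  - right. split; auto.
    destruct (fal_holder c (r / 2) (alpha - INR k) s main_power_sums Hs ltac:(lra)) as [M HM].
    set (P := Cmod (Cpow (RtoC (2 * PI) * Ci) k)%C).
    exists (P * M). intros x y _ _ Hxy. rewrite <- (ctr_minus T) by auto.
    eapply Rle_trans; [apply (ctr_le T HT)|]. unfold fal_deriv.
    match goal with |- Cmod (?p * ?z - ?p * ?w)%C <= _ =>
      replace (p * z - p * w)%C with (p * (z - w))%C by ring end.
    rewrite Cmod_mult. fold P. rewrite Rmult_assoc.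
    apply Rmult_le_compat_l; [apply Cmod_ge_0|auto].
Qed.

(** The degree [d] must be below [s], hence the restriction to non-integral [s], harmless for
    a supremum. *)
Lemma holder_at_lower T (q : QArith_base.Q) s d : contraction T ->
  alpha - r / 2 <= s < 2 * alpha - r -> INR d < s < INR d + 1 ->
  holder_at (fun x => T (F x)) (Q2R q) s.
Proof.
  intros HT Hs Hd. split.
  - intros x. apply ccont_Ccontinuous_at. apply (ctr_ccont T HT), F_ccont.
  - destruct (pointwise_expansion c (r / 2) alpha (Q2R q) s d main_subexp main_power_sums halpha
      (fun A HA => form_bound G r f a hG hr hf ha A HA)
      (fun A HA => form_bound_rational G r f a hG hr hf ha q A HA) ltac:(lra) Hd) as [p [K HK]].
    exists d, (fun j => T (p j)). split; [lra|]. exists K.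
    exists (mkposreal 1 Rlt_0_1). intros x _ Hx. rewrite Cpoly_Csum, <- (ctr_Csum T) by auto.
    rewrite <- (ctr_minus T) by auto. eapply Rle_trans; [apply (ctr_le T HT)|].
    unfold F. replace (fal c alpha x) with (fal c alpha (Q2R q + (x - Q2R q))) by (f_equal; ring).
    apply HK. lra.
Qed.

(** [s] is first lowered to some [s'] between [2 alpha - r] and [alpha].  On the tangential
    sequence [y] is of order [X^(-2)] and [(y + |u|) / y] of order [X]. *)
Lemma holder_at_upper T (q : QArith_base.Q) s : coef_map T -> 2 * alpha - r < alpha ->
  holder_at (fun x => T (F x)) (Q2R q) s -> s <= 2 * alpha - r.
Proof.
  intros [HT [kap [Hkap Hco]]] Hlt H. apply Rnot_lt_le. intros Hs.
  destruct (holder_at_taylor _ _ s ltac:(lra) H) as [d [del [M [p [Hdel [HM [Hp [Happ Hx0]]]]]]]].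
  set (s' := Rmin s ((2 * alpha - r + alpha) / 2)).
  assert (Hs1 : s' <= s) by apply Rmin_l.
  assert (Hs2 : 2 * alpha - r < s') by (apply Rmin_glb_lt; lra).
  assert (Hs3 : s' < alpha).
  { apply Rle_lt_trans with ((2 * alpha - r + alpha) / 2); [apply Rmin_r|lra]. }
  destruct F_bounded as [M0 HM0].
  assert (Hbd : forall t, Cmod (T (F t)) <= M0) by (intros t; eapply Rle_trans; [apply (ctr_le T HT)|auto]).
  destruct (boundary_regularity_bound c (fun x => T (F x)) kap alpha s' M0 M del d main_subexp ltac:(lra)
     Hkap (fun t => ctr_ccont T HT F t (F_ccont t)) Hco Hbd ltac:(lra) Hdel HM) as [K [HK HB]].
  specialize (HB (Q2R q) p Hp).
  assert (Happ' : forall t, Rabs t <= del -> t <> 0 ->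
     Cmod (T (F (Q2R q + t)) - Csum (fun j => p j * RtoC (t ^ j)) d)%C <= M * Rpower (Rabs t) s').
  { intros t Ht Ht0. eapply Rle_trans; [apply Happ; auto|]. apply Rmult_le_compat_l; auto.
    apply Rpower_anti; auto. split; [now apply Rabs_pos_lt|lra]. }
  specialize (HB Happ' Hx0).
  destruct (form_growth G r f a hG hf ha q hf0) as [t [Y [Ht [HY HL]]]].
  apply (HL (s' + r / 2 - alpha) s' (K * Rpower (1 + / Y) s') (2 / t)); [lra|lra|].
  intros X HXc HXb. fold c. set (D := t * (X ^ 2 + Y ^ 2)).
  assert (HtX : 2 <= t * X).
  { apply (Rmult_le_compat_l t) in HXc; [|lra]. replace (t * (2 / t)) with 2 in HXc by (field; lra). auto. }
  assert (HD2 : t * X ^ 2 <= D) by (unfold D; nra).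
  assert (HtX2 : 2 * X <= t * X ^ 2) by (simpl; nra).
  assert (HD : 0 < D) by lra.
  assert (Hu : Rabs (- (X / D)) = X / D).
  { rewrite Rabs_Ropp, Rabs_pos_eq; auto. apply Rlt_le, Rdiv_lt_0_compat; lra. }
  assert (Hu2 : X / D <= 1 / 2).
  { apply Rmult_le_reg_r with D; auto. replace (X / D * D) with X by (field; lra). lra. }
  eapply Rle_trans; [apply HB; [rewrite Hu; auto|apply Rdiv_lt_0_compat; auto]|].
  rewrite Hu. replace ((Y / D + X / D) / (Y / D)) with (1 + X / Y) by (field; lra).
  replace (s' + r / 2 - alpha - r / 2) with (s' - alpha) by ring.
  rewrite Rmult_assoc. apply Rmult_le_compat_l; auto. rewrite <- Rmult_assoc.
  apply Rmult_le_compat_r; [apply Rlt_le, Rpower_pos|].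
  assert (0 < / Y) by (apply Rinv_0_lt_compat; auto).
  rewrite Rpower_mult_distr by lra. apply Rle_Rpower_l; [lra|].
  unfold Rdiv. assert (0 <= X * / Y) by (apply Rmult_le_pos; lra). nra.
Qed.

(** The expansion is used at the moving centres [x0 + u] themselves, so that the factor
    [((y + |u|) / y)^s] disappears. *)
Lemma holder_on_upper T (q : QArith_base.Q) (u v : Rbar) k s : coef_map T ->
  Defs.open_interval u v (Q2R q) -> 0 <= s <= 1 ->
  holder_on (fun x => T (F x)) (Defs.open_interval u v) k s -> INR k + s <= alpha - r / 2.
Proof.
  intros [HT [kap [Hkap Hco]]] Hq Hs H. apply Rnot_lt_le. intros Hks.
  destruct (holder_on_taylor _ _ (Q2R q) k s (open_interval_neighborhood u v _ Hq) Hs ltac:(lra) H)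
    as [d [del [M [Hdel [HM Happ]]]]].
  set (ks := INR k + s) in *.
  set (s' := Rmin ks ((alpha - r / 2 + alpha) / 2)).
  assert (Hs1 : s' <= ks) by apply Rmin_l.
  assert (Hs2 : alpha - r / 2 < s') by (apply Rmin_glb_lt; lra).
  assert (Hs3 : s' < alpha).
  { apply Rle_lt_trans with ((alpha - r / 2 + alpha) / 2); [apply Rmin_r|lra]. }
  destruct F_bounded as [M0 HM0].
  assert (Hbd : forall t, Cmod (T (F t)) <= M0) by (intros t; eapply Rle_trans; [apply (ctr_le T HT)|auto]).
  destruct (boundary_regularity_bound c (fun x => T (F x)) kap alpha s' M0 M del d main_subexp ltac:(lra)
     Hkap (fun t => ctr_ccont T HT F t (F_ccont t)) Hco Hbd ltac:(lra) Hdel HM) as [K [HK HB]].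
  destruct (form_growth G r f a hG hf ha q hf0) as [t [Y [Ht [HY HL]]]].
  apply (HL (s' + r / 2 - alpha) 0 K (/ (t * del))); [lra|lra|].
  intros X HXc HXb. fold c. set (D := t * (X ^ 2 + Y ^ 2)).
  assert (Htd : 0 < t * del) by (apply Rmult_lt_0_compat; lra).
  assert (HtX : 1 <= t * del * X).
  { apply (Rmult_le_compat_l (t * del)) in HXc; [|lra]. rewrite Rinv_r in HXc by lra. auto. }
  assert (HD2 : t * X ^ 2 <= D) by (unfold D; nra).
  assert (HtX2 : X <= t * X ^ 2 * del) by (simpl; nra).
  assert (HD : 0 < D) by nra.
  assert (Hu : Rabs (Q2R q + - (X / D) - Q2R q) <= del).
  { replace (Q2R q + - (X / D) - Q2R q) with (- (X / D)) by ring.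
    rewrite Rabs_Ropp, Rabs_pos_eq by (apply Rlt_le, Rdiv_lt_0_compat; lra).
    apply Rmult_le_reg_r with D; auto. replace (X / D * D) with X by (field; lra). nra. }
  set (x := Q2R q + - (X / D)) in *.
  destruct (Happ x Hu) as [p [Hp [Hpt Hpx]]].
  assert (Happ' : forall t, Rabs t <= del -> t <> 0 ->
     Cmod (T (F (x + t)) - Csum (fun j => p j * RtoC (t ^ j)) d)%C <= M * Rpower (Rabs t) s').
  { intros w Hw Hw0. eapply Rle_trans; [apply Hpt; auto|]. apply Rmult_le_compat_l; auto.
    apply Rpower_anti; auto. split; [now apply Rabs_pos_lt|lra]. }
  assert (Hy : 0 < Y / D) by (apply Rdiv_lt_0_compat; auto).
  specialize (HB x p Hp Happ' Hpx 0 (Y / D) ltac:(rewrite Rabs_R0; lra) Hy).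
  rewrite Rplus_0_r, Rabs_R0, Rplus_0_r in HB.
  replace (Y / D / (Y / D)) with 1 in HB by (field; lra).
  rewrite Rpower_1_base in HB. rewrite Rpower_O by lra.
  replace (s' + r / 2 - alpha - r / 2) with (s' - alpha) by ring. exact HB.
Qed.

Lemma local_exponent T (q : QArith_base.Q) : coef_map T ->
  is_local_holder_exponent (fun x => T (F x)) (Q2R q) (alpha - r / 2).
Proof.
  intros HT u v [_ Huv].
  assert (E : forall n, holder_sup_on (fun x => T (F x)) (Defs.open_interval (u n) (v n)) =
      Finite (alpha - r / 2)).
  { intros n. apply is_lub_Rbar_unique.
    assert (Hq : Defs.open_interval (u n) (v n) (Q2R q)) by (apply (proj2 (Huv (Q2R q))); reflexivity).
    assert (Hlow : forall t, 0 < t < alpha - r / 2 -> exists k s, 0 <= s <= 1 /\ t = INR k + s /\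
        holder_on (fun x => T (F x)) (Defs.open_interval (u n) (v n)) k s).
    { intros t Ht. destruct (nfloor1_ex t (proj1 Ht)) as [k Hk].
      exists k, (t - INR k). split; [lra|]. split; [ring|].
      apply holder_on_lower; [apply HT|lra|lra]. }
    split.
    - intros t [k [s [Hs [-> H]]]]. exact (holder_on_upper T q (u n) (v n) k s HT Hq Hs H).
    - intros b Hb. destruct b as [b| |]; simpl; auto.
      + apply Rnot_lt_le. intros Hlt. pose proof (Rmax_l b 0). pose proof (Rmax_r b 0).
        assert (Hm : Rmax b 0 < alpha - r / 2) by (apply Rmax_lub_lt; lra).
        set (t := (Rmax b 0 + (alpha - r / 2)) / 2).
        assert (Ht : 0 < t < alpha - r / 2) by (unfold t; lra).
        specialize (Hb t (Hlow t Ht)). simpl in Hb. unfold t in Hb. lra.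
      + set (t := (alpha - r / 2) / 2).
        assert (Ht : 0 < t < alpha - r / 2) by (unfold t; lra).
        exact (Hb t (Hlow t Ht)). }
  split.
  - exists 0%nat. intros n _. rewrite E. reflexivity.
  - apply is_lim_seq_ext with (fun _ => alpha - r / 2); [intros n; now rewrite E|apply is_lim_seq_const].
Qed.

Lemma pointwise_exponent T (q : QArith_base.Q) : coef_map T ->
  1 + IZR (Int_part (2 * alpha - r)) <= alpha ->
  pointwise_holder_exponent (fun x => T (F x)) (Q2R q) = Finite (2 * alpha - r).
Proof.
  intros HT Hint. destruct (base_Int_part (2 * alpha - r)) as [_ Hi].
  apply is_lub_Rbar_unique. set (L := 2 * alpha - r) in *.
  assert (Hlow : forall b, b < L -> exists s, b < s /\ 0 <= s /\ holder_at (fun x => T (F x)) (Q2R q) s).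
  { intros b Hb. set (m := Rmax b (alpha - r / 2)).
    assert (Hm1 : b <= m) by apply Rmax_l. assert (Hm2 : alpha - r / 2 <= m) by apply Rmax_r.
    assert (Hm3 : m < L) by (apply Rmax_lub_lt; [auto|unfold L; lra]).
    assert (Hm0 : 0 <= m) by lra.
    destruct (nfloor_ex m Hm0) as [d Hd].
    set (s := (m + Rmin L (INR d + 1)) / 2).
    assert (A1 : Rmin L (INR d + 1) <= L) by apply Rmin_l.
    assert (A2 : Rmin L (INR d + 1) <= INR d + 1) by apply Rmin_r.
    assert (A3 : m < Rmin L (INR d + 1)) by (apply Rmin_glb_lt; lra).
    exists s. split; [unfold s; lra|]. split; [unfold s; lra|].
    apply (holder_at_lower T q s d); [apply HT|unfold s; fold L; lra|unfold s; lra]. }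
  split.
  - intros s [_ Hs]. simpl. apply (holder_at_upper T q s HT); [unfold L in *; lra|exact Hs].
  - intros b Hb. destruct b as [b| |]; simpl; auto.
    + apply Rnot_lt_le. intros Hlt. destruct (Hlow b Hlt) as [s [H1 [H2 H3]]].
      specialize (Hb s (conj H2 H3)). simpl in Hb. lra.
    + destruct (Hlow (L - 1) ltac:(lra)) as [s [H1 [H2 H3]]]. exact (Hb s (conj H2 H3)).
Qed.

End Main.

Theorem theorem3p3
  (G : SL2Z -> Prop) (r alpha : R) (f : C -> C) (a : nat -> C)
  (hG : congruence_group G)
  (hwidth : cusp_width G SL2Z_one 1)
  (hr : 0 < r)
  (hf : cusp_form G r f)
  (hf0 : exists z, upper z /\ f z <> RtoC 0)
  (ha : forall z, upper z ->
     is_Cseries (fun n => a (S n) * ee (RtoC (INR (S n)) * z))%C (f z))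
  (halpha : r / 2 < alpha) :
  (forall q : QArith_base.Q,
     is_local_holder_exponent (f_alpha a alpha) (Q2R q) (alpha - r / 2)) /\
  (1 + IZR (Int_part (2 * alpha - r)) <= alpha ->
   forall q : QArith_base.Q,
     pointwise_holder_exponent (f_alpha a alpha) (Q2R q) = Finite (2 * alpha - r)) /\
  ((forall n : nat, (1 <= n)%nat -> Im (a n) = 0) ->
   ((forall q : QArith_base.Q,
       is_local_holder_exponent (f_alpha_c a alpha) (Q2R q) (alpha - r / 2)) /\
    (1 + IZR (Int_part (2 * alpha - r)) <= alpha ->
     forall q : QArith_base.Q,
       pointwise_holder_exponent (f_alpha_c a alpha) (Q2R q) = Finite (2 * alpha - r))) /\
   ((forall q : QArith_base.Q,
       is_local_holder_exponent (f_alpha_s a alpha) (Q2R q) (alpha - r / 2)) /\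
    (1 + IZR (Int_part (2 * alpha - r)) <= alpha ->
     forall q : QArith_base.Q,
       pointwise_holder_exponent (f_alpha_s a alpha) (Q2R q) = Finite (2 * alpha - r)))).
Proof.
  assert (Hloc := local_exponent G r alpha f a hG hr hf hf0 ha halpha).
  assert (Hpt := pointwise_exponent G r alpha f a hG hr hf hf0 ha halpha).
  rewrite f_alpha_fal.
  pose proof (coef_map_id G r alpha f a hG hr hf ha halpha) as Tid.
  pose proof (coef_map_Re G r alpha f a hG hr hf ha halpha) as TRe.
  pose proof (coef_map_Im G r alpha f a hG hr hf ha halpha) as TIm.
  split; [intros q; exact (Hloc _ q Tid)|]. split; [intros Hi q; exact (Hpt _ q Tid Hi)|].
  intros Hreal. rewrite f_alpha_c_fal, f_alpha_s_fal by auto. split.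
  - split; [intros q; exact (Hloc _ q TRe)|intros Hi q; exact (Hpt _ q TRe Hi)].
  - split; [intros q; exact (Hloc _ q TIm)|intros Hi q; exact (Hpt _ q TIm Hi)].
Qed.
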